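(* Let $C_0\ge1$ and let $k>k_*$. There exists a positive constant $C_{\mathrm{global},4}$, depending only on $R$, $d$, $k_*$, $\Sigma$ and $C_0$, such that for every true mixing measure $G_*=\sum_{j=1}^{k_*}\pi_j^*\delta_{\theta_j^*}$ (as in the context) whose components are partitioned into one cluster of diameter $C_0\Delta_{\mathrm{sep}}$, i.e. $\max_{j,l}\|\theta_j^*-\theta_l^*\|\le C_0\Delta_{\mathrm{sep}}$, $$d_H(p_G,p_{G_*})\ \ge\ C_{\mathrm{global},4}\,\Delta_{\mathrm{sep}}^{2k_*-2}\,W_2^2(G,G_* )$$ uniformly for all mixing measures $G\in\mathcal{G}_k(\Theta)$ (at most $k$ components). As a consequence, there exist positive constants $C_{\mathrm{density}},c_{\mathrm{density}}$ (the constants of the density estimation rate, see context) depending only on $\Theta$ and $k_*$ such that, for the over-specified maximum likelihood estimator $\widehat G_n$ over $\mathcal{G}_k(\Theta)$, $$\mathbb{P}\left(W_2(\widehat G_n,G_* )>\Big(\frac{C_{\mathrm{density}}}{C_{\mathrm{global},4}}\Big)^{1/2}\Big(\frac{d\log n}{n}\Big)^{1/4}\Delta_{\mathrm{sep}}^{-(k_*-1)}\right)\ \lesssim\ \exp(-c_{\mathrm{density}}\log n).$$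
   Context: Setting. $\Sigma$ is a known, fixed symmetric positive-definite $d\times d$ matrix with eigenvalues in $[\lambda_{\min},\lambda_{\max}]$, $0<\lambda_{\min}\le\lambda_{\max}$; $f(\cdot\mid\theta,\Sigma)$ is the density of the Gaussian $N(\theta,\Sigma)$ on $\mathbb{R}^d$. $\Theta\subset\mathbb{R}^d$ is compact and contained in the closed ball of radius $R>0$ centred at $0$. For a discrete probability measure $G=\sum_i\pi_i\delta_{\theta_i}$ put $p_G(x)=\sum_i\pi_i f(x\mid\theta_i,\Sigma)$. The true mixing measure is $G_*=\sum_{j=1}^{k_*}\pi_j^*\delta_{\theta_j^*}$ with $k_*\ge 2$, $\theta_j^*\in\Theta$, $\pi_j^*>0$, $\sum_j\pi_j^*=1$. Put $\Delta_{\mathrm{sep}}=\min_{j\ne l}\|\theta_j^*-\theta_l^*\|$ (Euclidean norm), assumed positive. $\mathcal{G}_k(\Theta)=\{\sum_{i=1}^{k'}\pi_i\delta_{\theta_i}:1\le k'\le k,\ \theta_i\in\Theta,\ 0\le\pi_i\le1,\ \sum_i\pi_i=1\}$. Hellinger distance: $d_H(p,q)=\big(\tfrac12\int(\sqrt p-\sqrt q)^2dx\big)^{1/2}$. $W_2$ is the 2-Wasserstein distance with respect to the Euclidean norm. Estimator. $X_1,\dots,X_n$ are i.i.d. with density $p_{G_*}$, and $\widehat G_n\in\arg\max_{G\in\mathcal{G}_k(\Theta)}\frac1n\sum_{i=1}^n\log p_G(X_i)$. Probabilities are under the true law. $\lesssim$ means inequality up to a positive multiplicative constant independent of $n$ and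 $G_*$. $C_{\mathrm{density}},c_{\mathrm{density}}$ are the constants in the density estimation bound $\mathbb{P}(d_H(p_{\widehat G_n},p_{G_*})>C_{\mathrm{density}}[d\log(n)/n]^{1/2})\lesssim n^{-c_{\mathrm{density}}}$. *)

(* Defs.v *)
From HB Require Import structures.
From mathcomp Require Import all_boot all_order all_algebra.
From mathcomp Require Import all_classical all_reals all_analysis.

Set Implicit Arguments.
Unset Strict Implicit.
Unset Printing Implicit Defensive.

Import Order.TTheory GRing.Theory Num.Theory.
Import numFieldNormedType.Exports.

Local Open Scope classical_set_scope.
Local Open Scope ring_scope.

(* The product (equivalently, Borel) sigma-algebra on row vectors, generated by
   the coordinate maps. *)
Definition measure_rV_display : measure_display -> measure_display.
Proof. exact. Qed.

Section measurable_rV.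
Context {dsp : measure_display} {T : measurableType dsp}.
Variable n : nat.

Let coors : 'I_n -> 'rV[T]_n -> T := fun i x => x ord0 i.

Let rV_set0 : g_sigma_preimage coors set0.
Proof. exact: sigma_algebra0. Qed.

Let rV_setC A : g_sigma_preimage coors A -> g_sigma_preimage coors (~` A).
Proof. exact: sigma_algebraC. Qed.

Let rV_bigcup (F : _^nat) : (forall i, g_sigma_preimage coors (F i)) ->
  g_sigma_preimage coors (\bigcup_i (F i)).
Proof. exact: sigma_algebra_bigcup. Qed.

HB.instance Definition _ := @isMeasurable.Build (measure_rV_display dsp)
  'rV[T]_n (g_sigma_preimage coors) rV_set0 rV_setC rV_bigcup.

End measurable_rV.

Section measurable_rV_theory.
Context {dsp dsp' : measure_display} {T : measurableType dsp}
  {S : measurableType dsp'}.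

Lemma measurable_coord n (i : 'I_n) :
  measurable_fun [set: 'rV[T]_n] (fun x : 'rV[T]_n => x ord0 i).
Proof.
move=> _ Y mY; rewrite setTI; apply: sub_sigma_algebra => /=.
rewrite -bigcup_seq/=; exists i => /=; first by rewrite mem_index_enum.
by exists Y => //; rewrite setTI.
Qed.

Lemma measurable_rVP n (f : S -> 'rV[T]_n) :
  (forall i, measurable_fun [set: S] (fun x => f x ord0 i)) ->
  measurable_fun [set: S] f.
Proof.
move=> mf _ Y mY; rewrite setTI; move: Y mY.
suff : (measurable : set (set 'rV[T]_n)) `<=` [set Y | measurable (f @^-1` Y)].
  by [].
apply: smallest_sub => /=.
  split => /=.
  - by rewrite preimage_set0.
  - by move=> A mA; rewrite setTD preimage_setC; exact: measurableC.
  - by move=> A mA; rewrite preimage_bigcup; exact: bigcupT_measurable.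
move=> A; rewrite -bigcup_seq/= => -[i _ [B mB <-]].
rewrite setTI /= -comp_preimage -[X in measurable X]setTI.
exact: mf.
Qed.

End measurable_rV_theory.

Section lebesgue_rV.
Context {R : realType}.

(* [consV (a, x)] prepends the coordinate [a]; ['rV_(1 + n)] is ['rV_n.+1]. *)
Definition consV n (z : measurableTypeR R * 'rV[R]_n) : 'rV[R]_n.+1 :=
  row_mx (z.1 : R)%:M z.2.

Definition unconsV n (x : 'rV[R]_n.+1) : measurableTypeR R * 'rV[R]_n :=
  (x ord0 ord0, \row_i x ord0 (lift ord0 i)).

Lemma consV0 n z : @consV n z ord0 ord0 = z.1.
Proof.
have -> : (ord0 : 'I_n.+1) = lshift n (ord0 : 'I_1) by exact/val_inj.
by rewrite [LHS]row_mxEl mxE eqxx mulr1n.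
Qed.

Lemma consVS n z i : @consV n z ord0 (lift ord0 i) = z.2 ord0 i.
Proof.
have -> : lift ord0 i = rshift 1 i by exact/val_inj.
by rewrite [LHS]row_mxEr.
Qed.

Lemma consVK n : cancel (@consV n) (@unconsV n).
Proof.
move=> [a x]; rewrite /unconsV consV0; congr (_, _).
by apply/rowP => i; rewrite mxE consVS.
Qed.

Lemma unconsVK n : cancel (@unconsV n) (@consV n).
Proof.
move=> x; apply/rowP => i; have [j ->|->] := unliftP ord0 i.
  by rewrite consVS mxE.
by rewrite consV0.
Qed.

Lemma measurable_consV n : measurable_fun setT (@consV n).
Proof.
apply: measurable_rVP => i; have [j ->|->] := unliftP ord0 i.
- rewrite (_ : (fun _ => _) = (fun y : 'rV[R]_n => y ord0 j) \o snd).
    apply: (measurableT_comp (@measurable_coord _ R n j)).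
    exact: (@measurable_snd _ _ (measurableTypeR R) 'rV[R]_n).
  by apply/funext => z; rewrite consVS.
- rewrite (_ : (fun _ => _) = fst); last by apply/funext => z; rewrite consV0.
  exact: (@measurable_fst _ _ (measurableTypeR R) 'rV[R]_n).
Qed.

Lemma measurable_unconsV n : measurable_fun setT (@unconsV n).
Proof.
apply: measurable_fun_pair; first exact: (@measurable_coord _ R n.+1 ord0).
apply: measurable_rVP => i /=.
rewrite (_ : (fun _ => _) = fun x : 'rV[R]_n.+1 => x ord0 (lift ord0 i)).
  exact: measurable_coord.
by apply/funext => x; rewrite mxE.
Qed.

Section step.
Variables (n : nat) (m : {sigma_finite_measure set 'rV[R]_n -> \bar R}).

Definition lebesgueS : set 'rV[R]_n.+1 -> \bar R :=
  pushforward (lebesgue_measure \x m)%E (@consV n).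

Let lebesgueS0 : lebesgueS set0 = 0%E.
Proof. by rewrite /lebesgueS /pushforward preimage_set0 measure0. Qed.

Let lebesgueS_ge0 A : (0 <= lebesgueS A)%E.
Proof. by rewrite /lebesgueS /pushforward measure_ge0. Qed.

Let lebesgueS_sigma_additive : semi_sigma_additive lebesgueS.
Proof.
have mf := @measurable_consV n.
move=> F mF tF mUF; rewrite /lebesgueS /pushforward preimage_bigcup.
apply: measure_semi_sigma_additive.
- by move=> k; rewrite -[X in measurable X]setTI; exact: mf.
- apply/trivIsetP => /= i j _ _ ij; rewrite -preimage_setI.
  by move/trivIsetP : tF => /(_ _ _ _ _ ij) ->//; rewrite preimage_set0.
- by rewrite -preimage_bigcup -[X in measurable X]setTI; exact: mf.
Qed.

HB.instance Definition _ := isMeasure.Build _ _ _ lebesgueS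
  lebesgueS0 lebesgueS_ge0 lebesgueS_sigma_additive.

Let lebesgueS_sigma_finite : sigma_finite setT lebesgueS.
Proof.
have /sigma_finiteP[F [TF ndF Foo]] := sigma_finiteT (@lebesgue_measure R).
have /sigma_finiteP[G [TG ndG Goo]] := sigma_finiteT m.
exists (fun k => @unconsV n @^-1` (F k `*` G k)).
  rewrite -preimage_bigcup -[LHS](preimage_setT (@unconsV n)); congr preimage.
  rewrite -setXTT TF TG predeqE => -[x y]; split.
    move=> [/= [j _ Fjx] [k _ Gky]]; exists (maxn j k) => //; split.
    - by move: x Fjx; exact/subsetPset/ndF/leq_maxl.
    - by move: y Gky; exact/subsetPset/ndG/leq_maxr.
  by move=> [k _ []/= ? ?]; split; exists k.
move=> k; have [mF Fk] := Foo k; have [mG Gk] := Goo k; split.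
  rewrite -[X in measurable X]setTI; apply: measurable_unconsV => //.
  exact: measurableX.
rewrite /lebesgueS /pushforward -comp_preimage.
rewrite (_ : @unconsV n \o @consV n = id); last first.
  by apply/funext => z /=; rewrite consVK.
by rewrite preimage_id product_measure1E// lte_mul_pinfty// ge0_fin_numE.
Qed.

HB.instance Definition _ := Measure_isSigmaFinite.Build _ _ _ lebesgueS
  lebesgueS_sigma_finite.

End step.

(* d-dimensional Lebesgue measure as an iterated product; [lebesgue_rV_box]
   below is its value on boxes. *)
Fixpoint lebesgue_rV n : {sigma_finite_measure set 'rV[R]_n -> \bar R} :=
  if n is n'.+1 then lebesgueS (lebesgue_rV n') else \d_(0 : 'rV[R]_0).

Lemma lebesgue_rV_box n (A : 'I_n -> set (measurableTypeR R)) :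
  (forall i, measurable (A i)) ->
  lebesgue_rV n [set x | forall i, A i (x ord0 i)] =
  (\prod_(i < n) lebesgue_measure (A i))%E.
Proof.
elim: n A => [|n IH] A mA.
  rewrite big_ord0 /= diracE mem_set//= => -[].
  by [].
rewrite big_ord_recl -IH; last by move=> i; exact: mA.
pose B := [set x : 'rV[R]_n | forall i, A (lift ord0 i) (x ord0 i)].
have mB : measurable B.
  rewrite (_ : B = \big[setI/setT]_(i < n)
      ((fun x : 'rV[R]_n => x ord0 i) @^-1` A (lift ord0 i))).
    apply: bigsetI_measurable => i _; rewrite -[X in measurable X]setTI.
    exact: (@measurable_coord _ R n i measurableT _ (mA (lift ord0 i))).
  rewrite -bigcap_seq; apply/seteqP; split=> x /= Bx i; first by move=> _.
  by apply: (Bx i); rewrite /= mem_index_enum.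
rewrite -/B /= /lebesgueS /pushforward -product_measure1E//.
congr product_measure1; apply/seteqP; split=> [[a x] /= Aax|[a x] [/= Aa Bx] i].
  split => /=; first by have := Aax ord0; rewrite consV0.
  by move=> i; have := Aax (lift ord0 i); rewrite consVS.
have [j ->|->] := unliftP ord0 i; first by rewrite consVS; exact: Bx.
by rewrite consV0.
Qed.

End lebesgue_rV.

Section gaussian_mixtures.
Context {R : realType} {d : nat}.
Implicit Types (Sigma : 'M[R]_d) (theta x : 'rV[R]_d) (Theta : set 'rV[R]_d).

Definition enorm x : R := Num.sqrt (\sum_(i < d) x ord0 i ^+ 2).

Definition symposdef Sigma : Prop :=
  Sigma^T = Sigma /\
  forall x, x != 0 -> 0 < (x *m Sigma *m x^T) ord0 ord0.

Definition gauss_pdf Sigma theta x : R :=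
  (Num.sqrt ((2 * pi) ^+ d * \det Sigma))^-1 *
  expR (- 2^-1 * ((x - theta) *m invmx Sigma *m (x - theta)^T) ord0 ord0).

(* A finitely supported mixing measure, given by weights and atoms; the same
   measure may have several presentations (repeated atoms, zero weights). *)
Record mixing := Mixing {
  ncomp : nat;
  weight : 'I_ncomp -> R;
  atom : 'I_ncomp -> 'rV[R]_d }.

Definition mixing_measure (G : mixing) : set 'rV[R]_d -> \bar R :=
  fun A => (\sum_(i < ncomp G) (weight i)%:E * \d_(atom i) A)%E.

Definition mixture_pdf Sigma (G : mixing) x : R :=
  \sum_(i < ncomp G) weight i * gauss_pdf Sigma (atom i) x.

Definition mixing_le (k : nat) Theta (G : mixing) : Prop :=
  [/\ (1 <= ncomp G <= k)%N,
      forall i : 'I_(ncomp G), Theta (atom i),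
      forall i : 'I_(ncomp G), 0 <= weight i <= 1
    & \sum_(i < ncomp G) weight i = 1].

(* For two or more atoms this infimum of a finite nonempty set is the minimum. *)
Definition sep (G : mixing) : R :=
  inf [set enorm (atom jl.1 - atom jl.2)
      | jl in [set jl : 'I_(ncomp G) * 'I_(ncomp G) | jl.1 != jl.2]].

Definition true_mixing (kstar : nat) Theta (G : mixing) : Prop :=
  [/\ ncomp G = kstar,
      forall j : 'I_(ncomp G), Theta (atom j),
      forall j : 'I_(ncomp G), 0 < weight j,
      \sum_(j < ncomp G) weight j = 1
    & 0 < sep G].

Definition one_cluster (C0 : R) (G : mixing) : Prop :=
  forall j l : 'I_(ncomp G), enorm (atom j - atom l) <= C0 * sep G.

Definition hellinger (p q : 'rV[R]_d -> R) : R :=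
  Num.sqrt (2^-1 *
    \int[lebesgue_rV d]_x ((Num.sqrt (p x) - Num.sqrt (q x)) ^+ 2)).

Definition coupling (mu nu : set 'rV[R]_d -> \bar R)
    (g : {measure set ('rV[R]_d * 'rV[R]_d)%type -> \bar R}) : Prop :=
  (forall A, measurable A -> g (A `*` setT) = mu A) /\
  (forall B, measurable B -> g (setT `*` B) = nu B).

(* [fine] is harmless on mixing measures: the product coupling has finite cost. *)
Definition W2 (G H : mixing) : R :=
  Num.sqrt (fine (ereal_inf
    [set (\int[g]_z (enorm (z.1 - z.2) ^+ 2)%:E)%E
    | g in coupling (mixing_measure G) (mixing_measure H)])).

Definition loglik Sigma n (x : 'I_n -> 'rV[R]_d) (G : mixing) : R :=
  n%:R^-1 * \sum_(i < n) ln (mixture_pdf Sigma G (x i)).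

Definition is_mle Sigma k Theta n (x : 'I_n -> 'rV[R]_d) (G : mixing) : Prop :=
  mixing_le k Theta G /\
  forall H, mixing_le k Theta H -> loglik Sigma x H <= loglik Sigma x G.

(* Common law with Lebesgue density [p], and mutual independence as the product
   rule over every subfamily [J]. *)
Definition iid_with_density dsp (T : measurableType dsp) (P : probability T R)
    n (X : 'I_n -> {RV P >-> 'rV[R]_d}) (p : 'rV[R]_d -> R) : Prop :=
  (forall i A, measurable A ->
     distribution P (X i) A = (\int[lebesgue_rV d]_(x in A) (p x)%:E)%E) /\
  (forall (J : {set 'I_n}) (A : 'I_n -> set 'rV[R]_d),
     (forall i, measurable (A i)) ->
     P (\bigcap_(i in [set` J]) (X i @^-1` A i)) =
     (\prod_(i in J) P (X i @^-1` A i))%E).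

End gaussian_mixtures.
Arguments mixing : clear implicits.

(* Main.v *)
(* Lower bound. By translation invariance of the Gaussian, the integral of a
   polynomial against G - H is a combination of integrals of polynomially growing
   functions against p_G - p_H, which are O(d_H) by Cauchy-Schwarz. Two families of
   polynomials of degree at most 2 kstar are tested. The product of the squared
   distances to the atoms of H vanishes on H and controls the cost of moving every
   atom of G to its nearest atom of H. The Hermite interpolation polynomials, equal
   to 1 at one atom of H, to 0 at the others, and of zero gradient at all of them,
   differ from the indicator of a nearest-atom cell by at most a multiple of that
   product, so they control the differences between the cell masses and the weights
   of H. No constant depends on the number of atoms of G.

   Rate. If G is at least as likely as H on the sample, then the normalized scores
   (sqrt (p_G / p_H) - 1) / d_H(p_G, p_H) have a nonnegative sum, while under p_H
   their mean is - d_H and their second moment is 2. Expanding exp (llr x t) on the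
   at most k + kstar atoms of G and H by Newton's divided differences shows that
   these scores are a family with finitely many bounded parameters (nodes, moment
   gaps divided by d_H, and d_H itself), Hoelder in the parameters, with an
   exponential envelope; this uses the moment estimate above to stay bounded as
   d_H tends to 0. A two-level covering of the parameters and a truncated Bernstein
   inequality then rule out d_H >= 18 sqrt (ln n / n) up to probability O(1 / n). *)

From HB Require Import structures.
Require Import Defs.
From mathcomp Require Import all_boot all_order all_algebra.
From mathcomp Require Import ring lra zify.
From mathcomp Require Import all_classical all_reals all_analysis.
From mathcomp Require Import measurable_realfun.

Set Implicit Arguments.
Unset Strict Implicit.
Unset Printing Implicit Defensive.

Import Order.TTheory GRing.Theory Num.Theory.
Import numFieldNormedType.Exports.

Local Open Scope classical_set_scope.
Local Open Scope ring_scope.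

(** Two demands on the constants shape the proof. In the lower bound, with [D = sep H] and [eta] the
    Hellinger distance, a mass error is of order [eta / D ^+ (2 * kstar)] but travels at most the
    diameter [C0 * D]. The factor [D ^+ 2] so gained, the one use of the one-cluster hypothesis,
    brings this term down to the exponent [2 * kstar - 2] already reached by the cost inside the
    cells. In the rate, the factor of [sqrt (ln n / n)] is fixed before [k]; only the factor of
    [1 / n] in the probability bound may depend on [k]. A union bound over a single covering with
    polynomially many cells in [n] would need a deviation level that grows with the number of
    parameters, hence with [k]. Splitting off the score of a coarse representative avoids this: the
    remaining increments have variance at most the inverse of the number of parameters, so one
    absolute level serves at both stages. The coarse part, the increment and the discretization
    remainder each receive 6 times the scale, whence 18. *)

Lemma eq_ler {R : numDomainType} (x y : R) : x = y -> x <= y.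
Proof. by move=> ->. Qed.

(** * Translations and products in Lebesgue integrals *)

Section lebesgue_rV_integral.
Context {R : realType}.
Implicit Types n : nat.

(** The image of Lebesgue measure under the translation agrees with it on half-open intervals, which
    determine it. *)
Lemma ge0_integral_shift (c : R) (f : R -> \bar R) :
  measurable_fun setT f -> (forall x, (0 <= f x)%E) ->
  (\int[lebesgue_measure]_x f (x + c)%R = \int[lebesgue_measure]_x f x)%E.
Proof.
move=> mf f0.
have mphi : measurable_fun setT
    (fun x : measurableTypeR R => (x + c : measurableTypeR R)).
  by apply: (@measurable_funD _ _ _ _ (fun x : R => x) (cst c)).
pose phi : {mfun measurableTypeR R >-> measurableTypeR R} :=
  HB.pack (fun x : measurableTypeR R => (x + c : measurableTypeR R))
    (isMeasurableFun.Build _ _ _ _ _ mphi).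
have phiE A : measurable A -> lebesgue_measure A = pushforward lebesgue_measure phi A.
  apply: (lebesgue_measure_unique (mu := pushforward lebesgue_measure phi)).
  move=> _ [[a b] _ <-] /=; rewrite /pushforward.
  rewrite (_ : phi @^-1` _ = `]a - c, b - c]%classic); last first.
    by apply/seteqP; split=> x /=; rewrite !in_itv /= ltrBlDr lerBrDr.
  rewrite !lebesgue_measure_itv /= !lte_fin ltrD2r; case: ifP => // _.
  by congr (_%:E); ring.
transitivity (\int[pushforward lebesgue_measure phi]_x f x)%E.
  by rewrite (ge0_integral_pushforward mphi).
by apply: eq_measure_integral => /= A mA _; rewrite -phiE.
Qed.

Lemma ge0_integral_consV n (f : 'rV[R]_n.+1 -> \bar R) :
  measurable_fun setT f -> (forall x, (0 <= f x)%E) ->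
  (\int[lebesgue_rV n.+1]_x f x =
   \int[lebesgue_measure]_a \int[lebesgue_rV n]_x f (consV (a, x)))%E.
Proof.
move=> mf f0; rewrite /= /lebesgueS.
rewrite (ge0_integral_pushforward (@measurable_consV R n))//.
rewrite preimage_setT fubini_tonelli1//; last by move=> x; exact: f0.
by apply: measurableT_comp => //; exact: measurable_consV.
Qed.

Lemma measurable_fun_shiftV n (v : 'rV[R]_n) :
  measurable_fun setT (fun x : 'rV[R]_n => x + v).
Proof.
apply: measurable_rVP => i.
rewrite (_ : (fun _ => _) = fun x : 'rV[R]_n => x ord0 i + v ord0 i).
  by apply: measurable_funD => //; exact: measurable_coord.
by apply/funext => x; rewrite mxE.
Qed.

Lemma ge0_integral_shiftV n (v : 'rV[R]_n) (f : 'rV[R]_n -> \bar R) :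
  measurable_fun setT f -> (forall x, (0 <= f x)%E) ->
  (\int[lebesgue_rV n]_x f (x + v)%R = \int[lebesgue_rV n]_x f x)%E.
Proof.
elim: n v f => [|n IH] v f mf f0.
  by apply: eq_integral => x _; congr f; apply/rowP => -[].
rewrite [LHS]ge0_integral_consV//; last first.
  by apply: measurableT_comp => //; exact: measurable_fun_shiftV.
rewrite [RHS]ge0_integral_consV//.
pose w : 'rV[R]_n := \row_i v ord0 (lift ord0 i).
have E a x : consV (a, x) + v = consV (a + v ord0 ord0, x + w).
  apply/rowP => i; rewrite mxE; have [j ->|->] := unliftP ord0 i.
    by rewrite !consVS !mxE.
  by rewrite !consV0.
have mfa a : measurable_fun setT (fun x => f (consV (a, x))).
  apply: measurableT_comp => //.
  apply: (measurableT_comp (@measurable_consV R n)).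
  exact: measurable_pair1.
transitivity (\int[lebesgue_measure]_a
    \int[lebesgue_rV n]_x f (consV (a + v ord0 ord0, x))%R)%E.
  apply: eq_integral => a _.
  rewrite -(IH w (fun x => f (consV (a + v ord0 ord0, x))))//.
  by apply: eq_integral => x _; rewrite E.
apply: (@ge0_integral_shift _
  (fun a => \int[lebesgue_rV n]_x f (consV (a, x)))%E).
- apply: (@measurable_fun_fubini_tonelli_F _ _ _ _ R (lebesgue_rV n)
    (fun z => f (consV z))) => //.
  by apply: measurableT_comp => //; exact: measurable_consV.
- by move=> a; apply: integral_ge0.
Qed.

(** The positive and negative parts are shifted separately, which also covers integrals that
    diverge. *)
Lemma Rintegral_shiftV n (v : 'rV[R]_n) (f : 'rV[R]_n -> R) :
  measurable_fun setT f ->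
  \int[lebesgue_rV n]_x f (x + v) = \int[lebesgue_rV n]_x f x.
Proof.
move=> mf; rewrite /Rintegral; congr fine; rewrite integralE [RHS]integralE.
have mfE : measurable_fun setT (EFin \o f) by apply/measurable_EFinP.
congr (_ - _)%E.
- transitivity (\int[lebesgue_rV n]_x (EFin \o f)^\+ (x + v)%R)%E.
    by apply: eq_integral => x _; rewrite ?funeposE ?funenegE.
  rewrite ge0_integral_shiftV//.
  exact: measurable_funepos.
- transitivity (\int[lebesgue_rV n]_x (EFin \o f)^\- (x + v)%R)%E.
    by apply: eq_integral => x _; rewrite ?funeposE ?funenegE.
  rewrite ge0_integral_shiftV//.
  exact: measurable_funeneg.
Qed.

(** Reduces integrability to dimension one: a Gaussian with arbitrary [Sigma] is dominated by such a
    product, without diagonalizing [Sigma]. *)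
Lemma integral_prod_lty n (phi : R -> R) :
  measurable_fun setT phi -> (forall x, 0 <= phi x) ->
  (\int[lebesgue_measure]_x (phi x)%:E < +oo)%E ->
  (\int[lebesgue_rV n]_x (\prod_(i < n) phi (x ord0 i))%:E < +oo)%E.
Proof.
move=> mphi phi0 phioo; elim: n => [|n IH].
  rewrite /= integral_dirac//= ?diracT ?mul1e ?big_ord0 ?ltry//.
  by apply/measurable_EFinP; rewrite (_ : (fun _ => _) = cst 1)//;
    apply/funext => x; rewrite big_ord0.
have mprod k : measurable_fun setT
    (fun x : 'rV[R]_k => (\prod_(i < k) phi (x ord0 i))%:E).
  apply/measurable_EFinP; apply: measurable_prod => i _.
  by apply: measurableT_comp => //; exact: measurable_coord.
rewrite ge0_integral_consV//; last by move=> x; rewrite lee_fin prodr_ge0.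
have P0 (x : 'rV[R]_n) : (0 <= (\prod_(i < n) phi (x ord0 i))%:E)%E.
  by rewrite lee_fin prodr_ge0.
rewrite (eq_integral (fun a : measurableTypeR R => (phi a)%:E *
    \int[lebesgue_rV n]_x (\prod_(i < n) phi (x ord0 i))%:E)%E); last first.
  move=> a _; rewrite -ge0_integralZl ?lee_fin//=; last exact: mprod.
  apply: eq_integral => x _; rewrite big_ord_recl consV0 EFinM.
  by congr (_ * _%:E)%E; apply: eq_bigr => i _; rewrite consVS.
have c0 : (0 <= \int[lebesgue_rV n]_x (\prod_(i < n) phi (x ord0 i))%:E)%E.
  by apply: integral_ge0 => x _.
have phiE0 (x : measurableTypeR R) : setT x -> (0 <= (phi x)%:E)%E.
  by rewrite lee_fin.
have mphiE : measurable_fun setT (fun x : measurableTypeR R => (phi x)%:E).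
  exact/measurable_EFinP.
have := ge0_integralZr lebesgue_measure measurableT mphiE phiE0 c0.
move=> /= ->.
have i0 : (0 <= \int[lebesgue_measure]_x (phi x)%:E)%E by apply: integral_ge0.
by apply: lte_mul_pinfty; rewrite ?ge0_fin_numE.
Qed.

End lebesgue_rV_integral.

(** * Gaussian densities and integrals *)

Section quadratic_form.
Context {R : realType} {d : nat}.
Implicit Types (B S : 'M[R]_d) (x y theta : 'rV[R]_d).

Definition qform B x y : R := (x *m B *m y^T) ord0 ord0.

Lemma qformE B x y :
  qform B x y = \sum_j (\sum_i x ord0 i * B i j) * y ord0 j.
Proof.
rewrite /qform mxE; apply: eq_bigr => j _; rewrite !mxE; congr (_ * _).
Qed.

Lemma qformDl B x x' y : qform B (x + x') y = qform B x y + qform B x' y.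
Proof. by rewrite /qform !mulmxDl mxE. Qed.

Lemma qformDr B x y y' : qform B x (y + y') = qform B x y + qform B x y'.
Proof. by rewrite /qform linearD mulmxDr mxE. Qed.

Lemma qformZl B a x y : qform B (a *: x) y = a * qform B x y.
Proof. by rewrite /qform -!scalemxAl mxE. Qed.

Lemma qformZr B a x y : qform B x (a *: y) = a * qform B x y.
Proof. by rewrite /qform linearZ /= -scalemxAr mxE. Qed.

Lemma qformDm B B' x y : qform (B + B') x y = qform B x y + qform B' x y.
Proof. by rewrite /qform mulmxDr mulmxDl mxE. Qed.

Lemma qformZm a B x y : qform (a *: B) x y = a * qform B x y.
Proof. by rewrite /qform -scalemxAr -scalemxAl mxE. Qed.

Lemma qformC B x y : B^T = B -> qform B x y = qform B y x.
Proof.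
move=> sB; rewrite /qform -[LHS](mxE trmx_key (fun i j => (x *m B *m y^T) j i)).
by rewrite -/(trmx _) !trmx_mul trmxK sB mulmxA.
Qed.

Variable Sigma : 'M[R]_d.
Hypothesis Spd : symposdef Sigma.

Let B := invmx Sigma.

Lemma symposdef_det_neq0 S : symposdef S -> \det S != 0.
Proof.
move=> [_ pS]; apply/negP => /det0P[v v0 vS].
by have := pS v v0; rewrite vS mul0mx mxE ltxx.
Qed.

Lemma symposdef_unitmx : Sigma \in unitmx.
Proof. by rewrite unitmxE unitfE symposdef_det_neq0. Qed.

Lemma symposdef1_gt0 x : x != 0 -> 0 < qform 1%:M x x.
Proof.
move=> x0; rewrite /qform mulmx1 mxE.
have [i xi] : exists i, x ord0 i != 0.
  apply/existsP; apply: contraNT x0; rewrite negb_exists => /forallP x0.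
  by apply/eqP/rowP => i; rewrite mxE; apply/eqP; move: (x0 i); rewrite negbK.
rewrite (bigD1 i)//= !mxE ltr_wpDr//.
  by apply: sumr_ge0 => j _; rewrite mxE -expr2 sqr_ge0.
by rewrite -expr2 exprn_even_gt0.
Qed.

(* The segment from the identity to [Sigma] consists of invertible matrices, so
   the determinant keeps its sign along it. *)
Lemma symposdef_det_gt0 : 0 < \det Sigma.
Proof.
rewrite lt_def symposdef_det_neq0//=; apply: contraT; rewrite -ltNge => D0.
(* The determinant along the segment is a polynomial in the parameter, so that the intermediate
   value theorem for polynomials applies. *)
pose M : 'M[{poly R}]_d :=
  \matrix_(i, j) ('X * ((i == j)%:R)%:P + (1 - 'X) * (Sigma i j)%:P).
have ME t : (\det M).[t] = \det (t%:M + (1 - t) *: Sigma).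
  rewrite -[LHS]/(horner_eval t (\det M)) -det_map_mx.
  congr (\det _); apply/matrixP => i j.
  rewrite !mxE -[LHS]/(('X * ((i == j)%:R)%:P + (1 - 'X) * (Sigma i j)%:P).[t]).
  by rewrite !hornerE /= mulr_natr.
have [|t /andP[t0 t1]] := @poly_ivt R (\det M) 0 1 ler01.
  rewrite !ME subr0 scale1r raddf0 add0r (ltW D0).
  by rewrite subrr scale0r addr0 det1 ler01.
rewrite /root ME => /det0P[v v0 vM].
have : qform (t%:M + (1 - t) *: Sigma) v v = 0 by rewrite /qform vM mul0mx mxE.
have -> : qform (t%:M + (1 - t) *: Sigma) v v
    = t * qform 1%:M v v + (1 - t) * qform Sigma v v.
  by rewrite qformDm -(scalemx1 _ t) !qformZm.
have p1 := symposdef1_gt0 v0.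
have p2 : 0 < qform Sigma v v := Spd.2 v v0.
have [->|tn1] := eqVneq t 1; first by rewrite subrr mul0r addr0 mul1r; lra.
have t1' : 0 < 1 - t by rewrite subr_gt0 lt_neqAle tn1.
have := mulr_gt0 t1' p2; have := mulr_ge0 t0 (ltW p1); lra.
Qed.

Lemma invmx_sym : B^T = B.
Proof. by rewrite /B trmx_inv Spd.1. Qed.

Lemma qform_inv x : qform B x x = qform Sigma (x *m B) (x *m B).
Proof.
rewrite /qform trmx_mul invmx_sym -(mulmxA x B Sigma) (mulVmx symposdef_unitmx).
by rewrite mulmx1 mulmxA.
Qed.

Lemma qform_inv_ge0 x : 0 <= qform B x x.
Proof.
rewrite qform_inv; have [->|/Spd.2/ltW//] := eqVneq (x *m B) 0.
by rewrite /qform !mul0mx mxE.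
Qed.

(* Cauchy-Schwarz for the form [B], as [x i = qform B x (row i Sigma)]. *)
Lemma coord_sqr_le x i : x ord0 i ^+ 2 <= Sigma i i * qform B x x.
Proof.
pose e : 'rV[R]_d := delta_mx ord0 i.
have eS : e *m Sigma = row i Sigma by rewrite /e -rowE.
have xE : qform B x (e *m Sigma) = x ord0 i.
  rewrite /qform trmx_mul Spd.1 mulmxA -(mulmxA x B Sigma).
  rewrite (mulVmx symposdef_unitmx).
  rewrite mulmx1 mxE (bigD1 i)//= big1 ?addr0 ?mxE ?eqxx ?mulr1//.
  by move=> j ji; rewrite !mxE eqxx (negbTE ji) mulr0.
have eE : qform B (e *m Sigma) (e *m Sigma) = Sigma i i.
  rewrite /qform -(mulmxA e Sigma B) (mulmxV symposdef_unitmx) mulmx1 eS.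
  rewrite mxE (bigD1 i)//= big1 ?addr0 ?mxE ?eqxx ?mul1r//.
  by move=> j ji; rewrite !mxE eqxx (negbTE ji) mul0r.
have Sii : 0 < Sigma i i.
  have e0 : e != 0.
    by apply/eqP => /rowP/(_ i)/eqP; rewrite !mxE !eqxx oner_eq0.
  have := Spd.2 e e0; rewrite eS mxE (bigD1 i)//= big1 ?addr0 ?mxE ?eqxx ?mulr1//.
  by move=> j ji; rewrite !mxE eqxx (negbTE ji) mulr0.
(* The argument is [Sigma i i] times the component of [x] orthogonal to [row i Sigma] for the form
   [B]. *)
have := qform_inv_ge0 (Sigma i i *: x - x ord0 i *: (e *m Sigma)).
rewrite -scaleNr !qformDl !qformDr !qformZl !qformZr.
rewrite (qformC _ x invmx_sym) xE eE.
move: (qform B x x) => q; set s := Sigma i i; set z := x ord0 i => H.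
have : 0 <= s * (s * q - z ^+ 2).
  by apply: le_trans H _; apply: eq_ler; ring.
by rewrite pmulr_rge0// subr_ge0.
Qed.

(** The trace of [Sigma] dominates its eigenvalues. The summand 1 makes the constant positive in
    every dimension, since it ends up in a denominator. *)
Lemma sum_sqr_le x :
  \sum_i x ord0 i ^+ 2 <= (1 + \sum_i Sigma i i) * qform B x x.
Proof.
rewrite mulrDl mul1r; apply: ler_wpDl; first exact: qform_inv_ge0.
by rewrite mulr_suml; apply: ler_sum => i _; exact: coord_sqr_le.
Qed.

Lemma sum_diag_ge0 : 0 <= \sum_i Sigma i i.
Proof.
apply: sumr_ge0 => i _.
pose e : 'rV[R]_d := delta_mx ord0 i.
have e0 : e != 0.
  by apply/eqP => /rowP/(_ i)/eqP; rewrite !mxE !eqxx oner_eq0.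
have := Spd.2 e e0; rewrite -rowE mxE (bigD1 i)//= big1 ?addr0 ?mxE ?eqxx ?mulr1//.
  exact: ltW.
by move=> j ji; rewrite !mxE eqxx (negbTE ji) mulr0.
Qed.

(* Log-likelihood ratio of [N(theta, Sigma)] against [N(0, Sigma)]. *)
Definition llr x theta : R := qform B x theta - 2^-1 * qform B theta theta.

(** Factoring out one fixed Gaussian makes every mixture a finite sum of exponentials of polynomials
    in the atoms, integrated against a common reference. *)
Lemma gauss_pdf_llr theta x :
  gauss_pdf Sigma theta x = gauss_pdf Sigma 0 x * expR (llr x theta).
Proof.
rewrite /gauss_pdf -mulrA -expRD; congr (_ * expR _).
rewrite -!/(qform _ _ _) subr0 /llr -/B -(scaleN1r theta).
rewrite !qformDl !qformDr !qformZl !qformZr (qformC theta x invmx_sym).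
by field.
Qed.

Lemma gauss_peak_gt0 : 0 < (Num.sqrt ((2 * pi) ^+ d * \det Sigma))^-1 :> R.
Proof.
rewrite invr_gt0 sqrtr_gt0 mulr_gt0 ?symposdef_det_gt0//.
by rewrite exprn_gt0// mulr_gt0// pi_gt0.
Qed.

Lemma gauss_pdf_gt0 theta x : 0 < gauss_pdf Sigma theta x.
Proof. by rewrite mulr_gt0 ?gauss_peak_gt0// expR_gt0. Qed.

Lemma measurable_qforml A y : measurable_fun setT (fun x => qform A x y).
Proof.
rewrite (_ : (fun _ => _) =
    fun x => \sum_j (\sum_i x ord0 i * A i j) * y ord0 j); last first.
  by apply/funext => x; rewrite qformE.
apply: measurable_sum => j; apply: measurable_funM => //.
apply: measurable_sum => i; apply: measurable_funM => //.
exact: measurable_coord.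
Qed.

Lemma measurable_qform A : measurable_fun setT (fun x => qform A x x).
Proof.
rewrite (_ : (fun _ => _) =
    fun x => \sum_j (\sum_i x ord0 i * A i j) * x ord0 j); last first.
  by apply/funext => x; rewrite qformE.
apply: measurable_sum => j; apply: measurable_funM; last exact: measurable_coord.
apply: measurable_sum => i; apply: measurable_funM => //.
exact: measurable_coord.
Qed.

Lemma measurable_llr theta : measurable_fun setT (fun x => llr x theta).
Proof. by apply: measurable_funB => //; exact: measurable_qforml. Qed.

Lemma measurable_gauss_pdf0 : measurable_fun setT (gauss_pdf Sigma 0).
Proof.
rewrite (_ : gauss_pdf Sigma 0 = fun x =>
    (Num.sqrt ((2 * pi) ^+ d * \det Sigma))^-1 * expR (- 2^-1 * qform B x x)).
  apply: measurable_funM => //; apply: measurableT_comp => //.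
  by apply: measurable_funM => //; exact: measurable_qform.
by apply/funext => x; rewrite /gauss_pdf subr0.
Qed.

End quadratic_form.

(** * Functions of at most exponential growth *)

Section exponential_growth.
Context {R : realType} {d : nat}.
Implicit Types (x y theta : 'rV[R]_d) (h g : 'rV[R]_d -> R).

Definition l1norm x : R := \sum_i `|x ord0 i|.

Lemma l1norm_ge0 x : 0 <= l1norm x.
Proof. exact: sumr_ge0. Qed.

Lemma coord_le_l1norm x i : `|x ord0 i| <= l1norm x.
Proof. by rewrite /l1norm (bigD1 i)//= lerDl sumr_ge0. Qed.

Lemma coord_le_enorm x i : `|x ord0 i| <= enorm x.
Proof.
rewrite /enorm -sqrtr_sqr ler_wsqrtr// (bigD1 i)//= lerDl.
by apply: sumr_ge0 => j _; exact: sqr_ge0.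
Qed.

Lemma measurable_l1norm : measurable_fun setT l1norm.
Proof.
apply: measurable_sum => i; apply: measurableT_comp => //.
exact: measurable_coord.
Qed.

(** A class stable under sums, products and square roots, through which integrability against the
    Gaussian is obtained. The l1 norm is chosen because its exponential is a product over the
    coordinates. *)
Definition expgrowth h := measurable_fun setT h /\
  exists C a : R, [/\ 0 <= C, 0 <= a & forall x, `|h x| <= C * expR (a * l1norm x)].

Lemma expgrowth_cst c : expgrowth (cst c).
Proof.
split => //; exists `|c|, 0; split => // x.
by rewrite mul0r expR0 mulr1.
Qed.

Lemma expgrowth_le h g : measurable_fun setT h -> expgrowth g ->
  (forall x, `|h x| <= `|g x|) -> expgrowth h.
Proof.
move=> mh [_ [C [a [C0 a0 gC]]]] hg; split => //; exists C, a; split => // x.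
exact: le_trans (hg x) (gC x).
Qed.

Lemma expgrowthD h g : expgrowth h -> expgrowth g ->
  expgrowth (fun x => h x + g x).
Proof.
move=> [mh [C [a [C0 a0 hC]]]] [mg [C' [a' [C'0 a'0 gC]]]]; split.
  exact: measurable_funD.
exists (C + C'), (a + a'); split; rewrite ?addr_ge0// => x.
have l0 := l1norm_ge0 x.
apply: le_trans (ler_normD _ _) _; rewrite mulrDl; apply: lerD.
- apply: le_trans (hC x) _; apply: ler_wpM2l => //.
  by rewrite ler_expR ler_wpM2r// lerDl.
- apply: le_trans (gC x) _; apply: ler_wpM2l => //.
  by rewrite ler_expR ler_wpM2r// lerDr.
Qed.

Lemma expgrowthM h g : expgrowth h -> expgrowth g ->
  expgrowth (fun x => h x * g x).
Proof.
move=> [mh [C [a [C0 a0 hC]]]] [mg [C' [a' [C'0 a'0 gC]]]]; split.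
  exact: measurable_funM.
exists (C * C'), (a + a'); split; rewrite ?addr_ge0 ?mulr_ge0// => x.
by rewrite normrM mulrDl expRD mulrACA ler_pM.
Qed.

Lemma expgrowthZ c h : expgrowth h -> expgrowth (fun x => c * h x).
Proof. exact/expgrowthM/expgrowth_cst. Qed.

Lemma expgrowthB h g : expgrowth h -> expgrowth g ->
  expgrowth (fun x => h x - g x).
Proof.
move=> eh eg; have := expgrowthD eh (expgrowthZ (-1) eg).
by congr expgrowth; apply/funext => x; rewrite mulN1r.
Qed.

Lemma expgrowth_sum I (r : seq I) (F : I -> 'rV[R]_d -> R) :
  (forall i, expgrowth (F i)) -> expgrowth (fun x => \sum_(i <- r) F i x).
Proof.
move=> eF; elim: r => [|i r IH].
  have := expgrowth_cst 0; congr expgrowth.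
  by apply/funext => x; rewrite big_nil.
have := expgrowthD (eF i) IH; congr expgrowth.
by apply/funext => x; rewrite big_cons.
Qed.

Lemma expgrowth_prod I (r : seq I) (F : I -> 'rV[R]_d -> R) :
  (forall i, expgrowth (F i)) -> expgrowth (fun x => \prod_(i <- r) F i x).
Proof.
move=> eF; elim: r => [|i r IH].
  have := expgrowth_cst 1; congr expgrowth.
  by apply/funext => x; rewrite big_nil.
have := expgrowthM (eF i) IH; congr expgrowth.
by apply/funext => x; rewrite big_cons.
Qed.

Lemma expgrowth_expR a : 0 <= a -> expgrowth (fun x => expR (a * l1norm x)).
Proof.
move=> a0; split.
  apply: measurableT_comp => //; apply: measurable_funM => //.
  exact: measurable_l1norm.
by exists 1, a; split => // x; rewrite mul1r ger0_norm// expR_ge0.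
Qed.

Lemma expgrowth_coord i : expgrowth (fun x => x ord0 i).
Proof.
apply: expgrowth_le (@expgrowth_expR 1 ler01) _.
  exact: measurable_coord.
move=> x; rewrite mul1r (ger0_norm (expR_ge0 _)).
apply: le_trans (coord_le_l1norm x i) _.
by apply: le_trans (expR_ge1Dx _); rewrite lerDr.
Qed.

Lemma expgrowth_norm h : expgrowth h -> expgrowth (fun x => `|h x|).
Proof.
move=> eh; apply: expgrowth_le (eh) _.
  by apply: measurableT_comp => //; exact: eh.1.
by move=> x; rewrite normr_id.
Qed.

Lemma expgrowth_sqrt h : expgrowth h -> expgrowth (fun x => Num.sqrt (h x)).
Proof.
move=> eh; apply: expgrowth_le (expgrowthD (expgrowth_cst 1) (expgrowth_norm eh)) _.
  apply: (measurableT_comp (continuous_measurable_fun (@sqrt_continuous R))).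
  exact: eh.1.
move=> x /=; rewrite ger0_norm ?sqrtr_ge0// ger0_norm ?addr_ge0//.
have [h0|h0] := lerP (h x) 0; first by rewrite ler0_sqrtr// addr_ge0.
rewrite -(@ler_pXn2r _ 2)// ?nnegrE ?sqrtr_ge0 ?addr_ge0// sqr_sqrtr ?(ltW h0)//.
by rewrite gtr0_norm//; nra.
Qed.

Lemma expgrowth_indic (A : set 'rV[R]_d) : measurable A ->
  expgrowth (fun x => \1_A x).
Proof.
move=> mA; split; first exact: measurable_indic.
exists 1, 0; split => // x; rewrite mul0r expR0 mulr1 indicE.
by case: (_ \in _); rewrite ?normr1 ?normr0.
Qed.

End exponential_growth.

(** * Integration against the reference Gaussian *)

Section gaussian_integral.
Context {R : realType} {d : nat}.
Variable Sigma : 'M[R]_d.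
Hypothesis Spd : symposdef Sigma.
Implicit Types (x y theta : 'rV[R]_d) (h g : 'rV[R]_d -> R).

Let f0 := gauss_pdf Sigma 0.
Let mu := @lebesgue_rV R d.

(** Half of the quadratic term absorbs the linear one, by completing the square; the other half is a
    normal density of variance [s]. *)
Lemma integral_gauss_tail_lty (a s : R) : 0 <= a -> 0 < s ->
  (\int[lebesgue_measure]_t (expR (a * `|t| - t ^+ 2 / s))%:E < +oo)%E.
Proof.
move=> a0 s0; pose sg := Num.sqrt s.
have sg0 : sg != 0 by rewrite gt_eqF// sqrtr_gt0.
have sgE : sg ^+ 2 = s by rewrite sqr_sqrtr// ltW.
pose c := expR (a ^+ 2 * s) / normal_peak sg.
have pk : 0 < normal_peak sg by exact: normal_peak_gt0.
have mnp := @measurable_normal_pdf R 0 sg.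
apply: (@le_lt_trans _ _
    (\int[lebesgue_measure]_t (c * normal_pdf 0 sg t)%:E)%E).
  apply: ge0_le_integral => //=.
  - apply/measurable_EFinP; apply: measurableT_comp => //.
    by apply: measurable_funB; apply: measurable_funM => //.
  - by apply/measurable_EFinP; apply: measurable_funM.
  move=> t _; rewrite lee_fin /normal_pdf (negbTE sg0) /normal_fun /c.
  rewrite mulrA divfK ?gt_eqF// -expRD ler_expR sgE subr0.
  have -> : - t ^+ 2 / (s *+ 2) = - (t ^+ 2 / s) / 2.
    by rewrite -mulr_natr; field; rewrite gt_eqF.
  have : 0 <= a ^+ 2 * s by rewrite mulr_ge0 ?sqr_ge0// ltW.
  have : 0 <= (a * s - `|t|) ^+ 2 / s by rewrite divr_ge0 ?sqr_ge0// ltW.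
  have -> : (a * s - `|t|) ^+ 2 / s = a ^+ 2 * s - 2 * a * `|t| + t ^+ 2 / s.
    by rewrite -(real_normK (num_real t)); field; rewrite gt_eqF.
  lra.
under eq_integral do rewrite EFinM.
rewrite ge0_integralZl//=.
- by rewrite integral_normal_pdf mule1 ltry.
- by apply/measurable_EFinP.
- by move=> t _; rewrite lee_fin normal_pdf_ge0.
- by rewrite lee_fin divr_ge0 ?expR_ge0 ?ltW.
Qed.

Lemma measurable_gauss : measurable_fun setT f0.
Proof. exact: measurable_gauss_pdf0. Qed.

Lemma integral_expR_gauss_lty a : 0 <= a ->
  (\int[mu]_x (expR (a * l1norm x) * f0 x)%:E < +oo)%E.
Proof.
move=> a0.
(* By [sum_sqr_le], the sum of the [x_i ^+ 2 / s] is at most half the quadratic form in the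
   exponent, so the integrand is below a product over the coordinates. *)
pose s := 2 * (1 + \sum_i Sigma i i).
have s0 : 0 < s by rewrite mulr_gt0// ltr_pwDl// sum_diag_ge0.
pose phi (t : R) := expR (a * `|t| - t ^+ 2 / s).
pose k := (Num.sqrt ((2 * pi) ^+ d * \det Sigma))^-1.
have k0 : 0 < k := gauss_peak_gt0 Spd.
have mphi : measurable_fun setT phi.
  apply: measurableT_comp => //.
  by apply: measurable_funB; apply: measurable_funM.
have mprod : measurable_fun setT (fun x : 'rV[R]_d => \prod_(i < d) phi (x ord0 i)).
  apply: measurable_prod => i _.
  by apply: measurableT_comp => //; exact: measurable_coord.
have P0 x : 0 <= \prod_(i < d) phi (x ord0 i).
  by apply: prodr_ge0 => i _; exact: expR_ge0.
apply: (@le_lt_trans _ _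
    (\int[mu]_x (k * \prod_(i < d) phi (x ord0 i))%:E)%E).
  apply: ge0_le_integral => //=.
  - by move=> x _; rewrite lee_fin mulr_ge0 ?expR_ge0// ltW// gauss_pdf_gt0.
  - apply/measurable_EFinP; apply: measurable_funM; last exact: measurable_gauss.
    by have [] := expgrowth_expR (d := d) a0.
  - by apply/measurable_EFinP; apply: measurable_funM.
  move=> x _; rewrite lee_fin /f0 /gauss_pdf -/k mulrCA ler_pM2l//.
  rewrite subr0 -/(qform _ _ _) -expRD -expR_sum ler_expR big_split/=.
  rewrite /l1norm mulr_sumr lerD2l sumrN -mulr_suml mulNr lerN2.
  rewrite ler_pdivrMr//; apply: le_trans (sum_sqr_le Spd x) _.
  by rewrite /s; apply: eq_ler; field.
under eq_integral do rewrite EFinM.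
rewrite ge0_integralZl//=.
- by apply: lte_mul_pinfty => //; [rewrite lee_fin ltW|exact: integral_prod_lty
    mphi (fun _ => expR_ge0 _) (integral_gauss_tail_lty a0 s0)].
- by apply/measurable_EFinP.
- by move=> x _; rewrite lee_fin.
- by rewrite lee_fin ltW.
Qed.

Lemma expgrowth_integrable h : expgrowth h ->
  mu.-integrable setT (EFin \o (fun x => h x * f0 x)).
Proof.
move=> [mh [C [a [C0 a0 hC]]]].
have mhf : measurable_fun setT (fun x => h x * f0 x).
  by apply: measurable_funM => //; exact: measurable_gauss.
apply/integrableP; split; first exact/measurable_EFinP.
have me : measurable_fun setT (fun x : 'rV[R]_d => expR (a * l1norm x) * f0 x).
  apply: measurable_funM; last exact: measurable_gauss.
  by have [] := expgrowth_expR (d := d) a0.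
have g0 x : 0 <= expR (a * l1norm x) * f0 x.
  by rewrite mulr_ge0 ?expR_ge0// ltW// gauss_pdf_gt0.
apply: (@le_lt_trans _ _
    (\int[mu]_x (C * (expR (a * l1norm x) * f0 x))%:E)%E).
  apply: ge0_le_integral => //=.
  - by do 2 apply: measurableT_comp => //.
  - by apply/measurable_EFinP; apply: measurable_funM.
  move=> x _; rewrite lee_fin normrM mulrA.
  by rewrite (gtr0_norm (gauss_pdf_gt0 Spd 0 x)) ler_wpM2r// ltW// gauss_pdf_gt0.
under eq_integral do rewrite EFinM.
rewrite ge0_integralZl//=.
- by apply: lte_mul_pinfty => //; exact: integral_expR_gauss_lty.
- by apply/measurable_EFinP.
- by move=> x _; rewrite lee_fin.
Qed.

(** The total mass [gint (cst 1)] is never computed: its positivity is enough for the moments, and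
    mass one of a mixture is read off the law of a sample point in [expect1]. *)
Definition gint h : R := \int[mu]_x (h x * f0 x).

Lemma gintD h g : expgrowth h -> expgrowth g ->
  gint (fun x => h x + g x) = gint h + gint g.
Proof.
move=> eh eg; rewrite /gint -RintegralD//; last 2 first.
- exact: expgrowth_integrable.
- exact: expgrowth_integrable.
by apply: eq_Rintegral => x _; rewrite mulrDl.
Qed.

Lemma gintZ c h : expgrowth h -> gint (fun x => c * h x) = c * gint h.
Proof.
move=> eh; rewrite /gint -RintegralZl//; last exact: expgrowth_integrable.
by apply: eq_Rintegral => x _; rewrite mulrA.
Qed.

Lemma gintB h g : expgrowth h -> expgrowth g ->
  gint (fun x => h x - g x) = gint h - gint g.
Proof.
move=> eh eg; rewrite /gint -RintegralB//; last 2 first.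
- exact: expgrowth_integrable.
- exact: expgrowth_integrable.
by apply: eq_Rintegral => x _; rewrite mulrBl.
Qed.

Lemma gint_sum I (r : seq I) (F : I -> 'rV[R]_d -> R) :
  (forall i, expgrowth (F i)) ->
  gint (fun x => \sum_(i <- r) F i x) = \sum_(i <- r) gint (F i).
Proof.
move=> eF; elim: r => [|i r IH].
  rewrite big_nil -[RHS](mul0r (gint (cst 0))) -gintZ; last exact: expgrowth_cst.
  by congr gint; apply/funext => x; rewrite big_nil mul0r.
rewrite big_cons -IH -gintD//; last exact: expgrowth_sum.
by congr gint; apply/funext => x; rewrite big_cons.
Qed.

Lemma gint_le h g : expgrowth h -> expgrowth g -> (forall x, h x <= g x) ->
  gint h <= gint g.
Proof.
move=> eh eg hg; apply: le_Rintegral => //; try exact: expgrowth_integrable.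
by move=> x _; rewrite ler_wpM2r// ltW// gauss_pdf_gt0.
Qed.

Lemma gint_ge0 h : (forall x, 0 <= h x) -> 0 <= gint h.
Proof.
by move=> h0; apply: Rintegral_ge0 => x _; rewrite mulr_ge0// ltW// gauss_pdf_gt0.
Qed.

Lemma gint_norm h : expgrowth h -> `|gint h| <= gint (fun x => `|h x|).
Proof.
move=> eh; apply: le_trans (le_normr_Rintegral _ (expgrowth_integrable eh)) _ => //.
apply: eq_ler; apply: eq_Rintegral => x _.
by rewrite normrM (gtr0_norm (gauss_pdf_gt0 Spd 0 x)).
Qed.

Lemma gint_indicE h (A : set 'rV[R]_d) : expgrowth h -> measurable A ->
  (gint (fun x => \1_A x * h x))%:E = (\int[mu]_(x in A) (h x * f0 x)%:E)%E.
Proof.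
move=> eh mA; rewrite /gint /Rintegral fineK; last first.
  apply: integrable_fin_num => //.
  by apply: expgrowth_integrable; apply: expgrowthM eh; exact: expgrowth_indic.
rewrite [RHS]integral_mkcond; apply: eq_integral => x _.
by rewrite /patch indicE; case: (x \in A); rewrite ?mul1r ?mul0r.
Qed.

(** The reference density is bounded below on the unit cube, of volume one. *)
Lemma gint1_gt0 : 0 < gint (cst 1).
Proof.
pose A (i : 'I_d) : set (measurableTypeR R) := `[0, 1]%classic.
pose D : set 'rV[R]_d := [set x | forall i, A i (x ord0 i)].
have muD : mu D = 1%E.
  rewrite /mu lebesgue_rV_box; last by move=> i; exact: measurable_itv.
  apply: big1 => i _.
  have := @lebesgue_measure_itv R `[0, 1]; rewrite /= lte_fin ltr01 => ->.
  by rewrite -EFinB subr0.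
have mD : measurable D.
  rewrite (_ : D = \big[setI/setT]_(i < d)
      ((fun x : 'rV[R]_d => x ord0 i) @^-1` A i)).
    apply: bigsetI_measurable => i _; rewrite -[X in measurable X]setTI.
    exact: (@measurable_coord _ R d i measurableT _ (measurable_itv `[0, 1])).
  rewrite -bigcap_seq; apply/seteqP; split=> x /= Bx i.
    by move=> _; exact: (Bx i).
  by apply: (Bx i); rewrite /= mem_index_enum.
pose b := \sum_i \sum_j `|invmx Sigma i j|.
pose k := (Num.sqrt ((2 * pi) ^+ d * \det Sigma))^-1.
have k0 : 0 < k := gauss_peak_gt0 Spd.
have f0D x : D x -> k * expR (- b) <= f0 x.
  move=> Dx; rewrite /f0 /gauss_pdf -/k ler_pM2l// ler_expR subr0 mulNr lerN2.
  have x1 i : `|x ord0 i| <= 1.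
    by have := Dx i; rewrite /A /= in_itv /= => /andP[? ?]; rewrite ger0_norm.
  apply: (@le_trans _ _ (qform (invmx Sigma) x x)).
    rewrite -[leRHS]mul1r; apply: ler_wpM2r; last by rewrite invf_le1// ler1n.
    exact: qform_inv_ge0.
  rewrite qformE; apply: le_trans (ler_norm _) _.
  apply: le_trans (ler_norm_sum _ _ _) _; rewrite /b exchange_big /=.
  apply: ler_sum => j _; rewrite normrM -[leRHS]mulr1; apply: ler_pM => //.
  apply: le_trans (ler_norm_sum _ _ _) _; apply: ler_sum => i _.
  by rewrite normrM -[leRHS]mul1r ler_wpM2r.
apply: (@lt_le_trans _ _ (k * expR (- b))); first by rewrite mulr_gt0// expR_gt0.
have e1 : expgrowth (cst 1 : 'rV[R]_d -> R) by exact: expgrowth_cst.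
apply: (@le_trans _ _ (gint (fun x => \1_D x * cst 1 x))); last first.
  apply: gint_le => //; first by apply: expgrowthM => //; exact: expgrowth_indic.
  by move=> x; rewrite mulr1 indicE; case: (_ \in _).
rewrite -lee_fin gint_indicE//.
apply: (@le_trans _ _ (\int[mu]_(x in D) (k * expR (- b))%:E)%E).
  by rewrite integral_cst// [X in (_ * X)%E]muD mule1.
apply: ge0_le_integral => //.
- by move=> x _; rewrite lee_fin mulr_ge0 ?expR_ge0// ltW.
- apply/measurable_EFinP; apply: measurable_funS (measurableT) _ _ => //.
  by apply: measurable_funM => //; exact: measurable_gauss.
- by move=> x Dx; rewrite lee_fin mul1r; exact: f0D.
Qed.

(** The factor [expR (llr Sigma x theta)] moves the centre of the reference density to [theta], and
    a translation moves it back. *)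
Lemma gint_shift h theta : measurable_fun setT h ->
  gint (fun x => h x * expR (llr Sigma x theta)) = gint (fun x => h (x + theta)).
Proof.
move=> mh; rewrite /gint.
rewrite -[LHS](Rintegral_shiftV theta); last first.
  apply: measurable_funM; last exact: measurable_gauss.
  apply: measurable_funM => //; apply: measurableT_comp => //.
  exact: measurable_llr.
apply: eq_Rintegral => x _; rewrite -mulrA (mulrC (expR _)).
by rewrite -gauss_pdf_llr// /f0 /gauss_pdf addrK subr0.
Qed.

End gaussian_integral.

(** * Moments and the Hellinger distance *)

Section word_polynomials.
Context {R : realType} {d : nat}.
Implicit Types (x theta : 'rV[R]_d) (g : 'rV[R]_d -> R).

(* Monomials are words in the coordinates, so that the product of two monomials
   is their concatenation. *)
Definition wordv (w : seq 'I_d) theta : R := \prod_(i <- w) theta ord0 i.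

Lemma wordv_nil theta : wordv [::] theta = 1.
Proof. by rewrite /wordv big_nil. Qed.

Lemma wordv_cons i w theta : wordv (i :: w) theta = theta ord0 i * wordv w theta.
Proof. by rewrite /wordv big_cons. Qed.

Definition peval (p : seq (R * seq 'I_d)) theta : R :=
  \sum_(m <- p) m.1 * wordv m.2 theta.

(** Degree at most [n] and coefficients of l1 norm at most [C]. Only the existence of an expansion
    is recorded, so the polynomials below need explicit bounds but no explicit coefficients. *)
Definition polyb (n : nat) (C : R) g := exists p : seq (R * seq 'I_d),
  [/\ forall theta, g theta = peval p theta,
      \sum_(m <- p) `|m.1| <= C & all (fun m => size m.2 <= n)%N p].

Lemma polyb_le n n' C C' g : (n <= n')%N -> C <= C' -> polyb n C g -> polyb n' C' g.
Proof.
move=> nn' CC' [p [gp pC pn]]; exists p; split => //; first exact: le_trans CC'.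
by apply: sub_all pn => m /leq_trans; exact.
Qed.

Lemma eq_polyb n C g h : g =1 h -> polyb n C g -> polyb n C h.
Proof. by move=> gh [p [gp pC pn]]; exists p; split => // theta; rewrite -gh. Qed.

Lemma polyb_cst n c : polyb n `|c| (cst c).
Proof.
exists [:: (c, [::])]; split; rewrite /= ?big_seq1//.
by move=> theta; rewrite /peval big_seq1 /wordv big_nil mulr1.
Qed.

Lemma polyb_coord i : polyb 1 1 (fun theta => theta ord0 i).
Proof.
exists [:: (1, [:: i])]; split; rewrite /= ?big_seq1/= ?normr1//.
by move=> theta; rewrite /peval !big_seq1/= /wordv big_seq1 mul1r.
Qed.

Lemma polybD n C C' g h : polyb n C g -> polyb n C' h ->
  polyb n (C + C') (fun theta => g theta + h theta).
Proof.
move=> [p [gp pC pn]] [q [hq qC qn]]; exists (p ++ q); split.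
- by move=> theta; rewrite gp hq /peval big_cat.
- by rewrite big_cat lerD.
- by rewrite all_cat pn.
Qed.

Lemma polybM n n' C C' g h : polyb n C g -> polyb n' C' h ->
  polyb (n + n') (C * C') (fun theta => g theta * h theta).
Proof.
move=> [p [gp pC pn]] [q [hq qC qn]].
exists [seq (m.1 * m'.1, m.2 ++ m'.2) | m <- p, m' <- q]; split.
- move=> theta; rewrite gp hq /peval big_allpairs_dep mulr_suml.
  apply: eq_bigr => m _; rewrite mulr_sumr; apply: eq_bigr => m' _ /=.
  by rewrite /wordv big_cat /= mulrACA.
- rewrite big_allpairs_dep; apply: (@le_trans _ _
    ((\sum_(m <- p) `|m.1|) * (\sum_(m <- q) `|m.1|))).
    rewrite mulr_suml; apply: ler_sum => m _; rewrite mulr_sumr.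
    by apply: ler_sum => m' _ /=; rewrite normrM.
  by apply: ler_pM => //; exact: sumr_ge0.
- apply/allP => _ /allpairsP[[m m'] /= [mp mq ->]] /=.
  by rewrite size_cat leq_add// ((allP pn) _ mp, (allP qn) _ mq).
Qed.

Lemma polybZ n C c g : polyb n C g ->
  polyb n (`|c| * C) (fun theta => c * g theta).
Proof. by move=> pg; have := polybM (polyb_cst 0 c) pg. Qed.

Lemma polybN n C g : polyb n C g -> polyb n C (fun theta => - g theta).
Proof.
move=> /(polybZ (-1)); rewrite normrN1 mul1r; apply: eq_polyb => theta.
by rewrite mulN1r.
Qed.

Lemma polybB n C C' g h : polyb n C g -> polyb n C' h ->
  polyb n (C + C') (fun theta => g theta - h theta).
Proof. by move=> pg /polybN ph; exact: polybD. Qed.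

Lemma polyb_sum I (r : seq I) n (C : I -> R) (F : I -> 'rV[R]_d -> R) :
  (forall i, polyb n (C i) (F i)) ->
  polyb n (\sum_(i <- r) C i) (fun theta => \sum_(i <- r) F i theta).
Proof.
move=> pF; elim: r => [|i r IH].
  rewrite big_nil -[X in polyb _ X](normr0 R); apply: eq_polyb (polyb_cst n 0) => theta.
  by rewrite big_nil.
rewrite big_cons; apply: eq_polyb (polybD (pF i) IH) => theta.
by rewrite big_cons.
Qed.

Lemma polyb_prod I (r : seq I) (P : pred I) n (C : I -> R)
    (F : I -> 'rV[R]_d -> R) : (forall i, polyb n (C i) (F i)) ->
  polyb (n * count P r) (\prod_(i <- r | P i) C i)
    (fun theta => \prod_(i <- r | P i) F i theta).
Proof.
move=> pF; elim: r => [|i r IH].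
  rewrite big_nil -[X in polyb _ X](normr1 R); apply: eq_polyb (polyb_cst _ 1) => theta.
  by rewrite big_nil.
rewrite big_cons /=; case: ifPn => Pi.
  rewrite add1n mulnS; apply: eq_polyb (polybM (pF i) IH) => theta.
  by rewrite big_cons Pi.
by rewrite add0n; apply: eq_polyb IH => theta; rewrite big_cons (negbTE Pi).
Qed.

Lemma wordv_bound (r : R) w theta : 0 <= r ->
  (forall i, `|theta ord0 i| <= r) -> `|wordv w theta| <= r ^+ size w.
Proof.
move=> r0 tr; elim: w => [|i w IH]; first by rewrite /wordv big_nil normr1 expr0.
by rewrite /wordv big_cons normrM exprS ler_pM.
Qed.

Lemma polyb_bound (r : R) n C g theta : 1 <= r ->
  (forall i, `|theta ord0 i| <= r) -> polyb n C g -> `|g theta| <= C * r ^+ n.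
Proof.
move=> r1 tr [p [gp pC pn]]; rewrite gp.
have r0 : 0 <= r by exact: le_trans r1.
apply: le_trans (ler_norm_sum _ _ _) _.
apply: (@le_trans _ _ ((\sum_(m <- p) `|m.1|) * r ^+ n)); last first.
  by rewrite ler_wpM2r// exprn_ge0.
rewrite mulr_suml big_seq [leRHS]big_seq; apply: ler_sum => m mp.
rewrite normrM ler_wpM2l//; apply: le_trans (wordv_bound _ r0 tr) _.
exact: ler_weXn2l r1 _ _ ((allP pn) _ mp).
Qed.

Lemma wordv_lip (r e : R) w x theta : 1 <= r -> 0 <= e ->
  (forall i, `|x ord0 i| <= r) -> (forall i, `|theta ord0 i| <= r) ->
  (forall i, `|x ord0 i - theta ord0 i| <= e) ->
  `|wordv w x - wordv w theta| <= (size w)%:R * r ^+ size w * e.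
Proof.
move=> r1 e0 xr tr xt; have r0 : 0 <= r by exact: le_trans r1.
elim: w => [|i w IH]; first by rewrite /wordv !big_nil subrr normr0 mul0r mul0r.
rewrite /wordv !big_cons -/(wordv w x) -/(wordv w theta).
have -> : x ord0 i * wordv w x - theta ord0 i * wordv w theta =
    x ord0 i * (wordv w x - wordv w theta)
    + (x ord0 i - theta ord0 i) * wordv w theta by ring.
apply: le_trans (ler_normD _ _) _; rewrite !normrM /= -natr1 exprS.
have H1 : `|x ord0 i| * `|wordv w x - wordv w theta| <=
    r * ((size w)%:R * r ^+ size w * e) by exact: ler_pM.
have H2 : `|x ord0 i - theta ord0 i| * `|wordv w theta| <= e * (r * r ^+ size w).
  apply: ler_pM => //; apply: le_trans (wordv_bound w r0 tr) _.
  by rewrite ler_peMl// exprn_ge0.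
by apply: le_trans (lerD H1 H2) _; apply: eq_ler; ring.
Qed.

Lemma polyb_lip (r e : R) n C g x theta : 1 <= r -> 0 <= e ->
  (forall i, `|x ord0 i| <= r) -> (forall i, `|theta ord0 i| <= r) ->
  (forall i, `|x ord0 i - theta ord0 i| <= e) -> polyb n C g ->
  `|g x - g theta| <= C * (n%:R * r ^+ n) * e.
Proof.
move=> r1 e0 xr tr xt [p [gp pC pn]]; rewrite !gp /peval -sumrB.
have r0 : 0 <= r by exact: le_trans r1.
apply: le_trans (ler_norm_sum _ _ _) _.
apply: (@le_trans _ _ ((\sum_(m <- p) `|m.1|) * (n%:R * r ^+ n * e))); last first.
  by rewrite -[leRHS]mulrA ler_wpM2r// !mulr_ge0// exprn_ge0.
rewrite mulr_suml big_seq [leRHS]big_seq; apply: ler_sum => m mp.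
rewrite -mulrBr normrM ler_wpM2l//.
apply: le_trans (wordv_lip _ r1 e0 xr tr xt) _; rewrite ler_wpM2r//.
have mn := (allP pn) _ mp.
by rewrite ler_pM ?ler_nat ?exprn_ge0//; exact: ler_weXn2l r1 _ _ mn.
Qed.

(** The bridge from moments to test polynomials: a bound on the monomials passes to all polynomials,
    whatever the functional. *)
Lemma polyb_linear_bound (L : ('rV[R]_d -> R) -> R) n C (A : R) g : 0 <= A ->
  (forall p, L (peval p) = \sum_(m <- p) m.1 * L (wordv m.2)) ->
  (forall w, (size w <= n)%N -> `|L (wordv w)| <= A) ->
  polyb n C g -> `|L g| <= C * A.
Proof.
move=> A0 linL LA [p [gp pC pn]]; rewrite (_ : g = peval p); last exact/funext.
rewrite linL; apply: le_trans (ler_norm_sum _ _ _) _.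
apply: (@le_trans _ _ ((\sum_(m <- p) `|m.1|) * A)); last by rewrite ler_wpM2r.
rewrite mulr_suml big_seq [leRHS]big_seq; apply: ler_sum => m mp.
by rewrite normrM ler_wpM2l// LA// ((allP pn) _ mp).
Qed.

(** Binomial expansion with the leading monomial in [theta] set apart. The other terms have strictly
    smaller degree in [theta], as the induction on moments requires. *)
Lemma wordv_translate w : exists L : seq (seq 'I_d * seq 'I_d),
  [/\ forall x theta, wordv w (x + theta) =
        wordv w theta + \sum_(m <- L) wordv m.1 theta * wordv m.2 x,
      all (fun m => (size m.1 < size w)%N && (size m.2 <= size w)%N) L
    & (size L < 2 ^ size w)%N].
Proof.
elim: w => [|i w [L [LE Ls Ln]]].
  by exists [::]; split => // x theta; rewrite big_nil /wordv !big_nil addr0.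
exists ((w, [:: i]) :: ([seq (i :: m.1, m.2) | m <- L] ++
                        [seq (m.1, i :: m.2) | m <- L])); split.
- move=> x theta; rewrite !wordv_cons LE big_cons big_cat !big_map /= mxE.
  rewrite wordv_cons wordv_nil mulr1.
  have -> : \sum_(m <- L) wordv (i :: m.1) theta * wordv m.2 x =
      theta ord0 i * \sum_(m <- L) wordv m.1 theta * wordv m.2 x.
    rewrite mulr_sumr; apply: eq_bigr => m _.
    by rewrite wordv_cons mulrA.
  have -> : \sum_(m <- L) wordv m.1 theta * wordv (i :: m.2) x =
      x ord0 i * \sum_(m <- L) wordv m.1 theta * wordv m.2 x.
    rewrite mulr_sumr; apply: eq_bigr => m _.
    by rewrite wordv_cons mulrCA.
  ring.
- rewrite /= ltnS leqnn/= all_cat; apply/andP; split; apply/allP => m.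
    move=> /mapP[m' /(allP Ls)/andP[m1 m2] ->] /=.
    by rewrite ltnS m1 (leq_trans m2).
  move=> /mapP[m' /(allP Ls)/andP[m1 m2] ->] /=.
  by rewrite !ltnS m2 andbT ltnW.
- rewrite /= size_cat !size_map expnS mul2n -addnn.
  by rewrite -addnS -addSn leq_add.
Qed.

End word_polynomials.

Section mixtures.
Context {R : realType} {d : nat}.
Implicit Types (G H : mixing R d) (x theta : 'rV[R]_d) (g h : 'rV[R]_d -> R).

Definition mint G g : R := \sum_(i < ncomp G) weight i * g (atom i).

Lemma mintD G g h : mint G (fun t => g t + h t) = mint G g + mint G h.
Proof. by rewrite /mint -big_split; apply: eq_bigr => i _; rewrite mulrDr. Qed.

Lemma mintZ G c g : mint G (fun t => c * g t) = c * mint G g.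
Proof. by rewrite /mint mulr_sumr; apply: eq_bigr => i _; rewrite mulrCA. Qed.

Lemma mint_sum G I (r : seq I) (F : I -> 'rV[R]_d -> R) :
  mint G (fun t => \sum_(i <- r) F i t) = \sum_(i <- r) mint G (F i).
Proof.
by rewrite /mint exchange_big; apply: eq_bigr => j _; rewrite mulr_sumr.
Qed.

Definition dint G H g : R := mint G g - mint H g.

Lemma dintD G H g h : dint G H (fun t => g t + h t) = dint G H g + dint G H h.
Proof. by rewrite /dint !mintD; ring. Qed.

Lemma dintZ G H c g : dint G H (fun t => c * g t) = c * dint G H g.
Proof. by rewrite /dint !mintZ mulrBr. Qed.

Lemma dint_sum G H I (r : seq I) (F : I -> 'rV[R]_d -> R) :
  dint G H (fun t => \sum_(i <- r) F i t) = \sum_(i <- r) dint G H (F i).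
Proof. by rewrite /dint !mint_sum sumrB. Qed.

Lemma dint_peval G H (p : seq (R * seq 'I_d)) :
  dint G H (peval p) = \sum_(m <- p) m.1 * dint G H (wordv m.2).
Proof.
rewrite (_ : peval p = fun t => \sum_(m <- p) (fun m t => m.1 * wordv m.2 t) m t)//.
by rewrite dint_sum; apply: eq_bigr => m _; rewrite dintZ.
Qed.

(** What the true and the fitted mixing measures have in common. It bounds neither the number of
    atoms nor their separation, so constants uniform over it depend on [rad] only. *)
Definition ballmix (rad : R) G := [/\ forall i : 'I_(ncomp G), 0 <= weight i,
  \sum_(i < ncomp G) weight i = 1 & forall i : 'I_(ncomp G), enorm (atom i) <= rad].

Lemma mint_le rad G g h : ballmix rad G ->
  (forall t, enorm t <= rad -> g t <= h t) -> mint G g <= mint G h.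
Proof.
move=> [w0 w1 wr] gh; apply: ler_sum => i _.
by rewrite ler_wpM2l// gh.
Qed.

Lemma mint_cst rad G c : ballmix rad G -> mint G (cst c) = c.
Proof. by move=> [_ w1 _]; rewrite /mint -mulr_suml w1 mul1r. Qed.

End mixtures.

(** * Moment gaps controlled by the Hellinger distance *)

Section moments.
Context {R : realType} {d : nat}.
Variable Sigma : 'M[R]_d.
Hypothesis Spd : symposdef Sigma.
Implicit Types (G H : mixing R d) (x theta : 'rV[R]_d) (g h : 'rV[R]_d -> R).

Local Notation gint := (gint Sigma).
Local Notation llr := (llr Sigma).
Local Notation hell G H :=
  (hellinger (mixture_pdf Sigma G) (mixture_pdf Sigma H)).

Definition invmx_l1 : R := \sum_i \sum_j `|invmx Sigma i j|.

Lemma invmx_l1_ge0 : 0 <= invmx_l1.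
Proof. by apply: sumr_ge0 => i _; exact: sumr_ge0. Qed.

(** Quadratic in the location, with coefficients growing linearly in [x]: this is why all later
    bounds are exponentials of [l1norm x]. *)
Lemma llr_polyb x : polyb 2 (invmx_l1 * (1 + l1norm x)) (llr x).
Proof.
pose B := invmx Sigma.
have p1 : polyb 2 (invmx_l1 * l1norm x) (qform B x).
  apply: (@eq_polyb _ _ _ _
      (fun t => \sum_j (\sum_i x ord0 i * B i j) * t ord0 j)).
    by move=> t; rewrite qformE.
  apply: (@polyb_le _ _ 2 2 (\sum_j (\sum_i `|x ord0 i| * `|B i j|) * 1)) => //.
    rewrite /invmx_l1 exchange_big /= mulr_suml; apply: ler_sum => j _.
    rewrite mulr1 mulr_suml; apply: ler_sum => i _.
    by rewrite mulrC ler_wpM2l// coord_le_l1norm.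
  apply: polyb_sum => j; apply: (@polyb_le _ _ 1) => //.
  apply: (@polybM _ _ 0 1); last exact: polyb_coord.
  apply: polyb_le (polyb_cst 0 _) => //.
  by apply: le_trans (ler_norm_sum _ _ _) _; apply: ler_sum => i _; rewrite normrM.
have p2 : polyb 2 invmx_l1 (fun t => 2^-1 * qform B t t).
  apply: (@polyb_le _ _ 2 2 (`|2^-1| * invmx_l1)) => //.
    rewrite ger0_norm// -[leRHS]mul1r ler_wpM2r ?invmx_l1_ge0//.
    by rewrite invf_le1// ler1n.
  apply: polybZ; apply: (@eq_polyb _ _ _ _
      (fun t => \sum_j (\sum_i t ord0 i * B i j) * t ord0 j)).
    by move=> t; rewrite qformE.
  rewrite /invmx_l1 exchange_big /=.
  apply: polyb_sum => j; rewrite -[X in polyb _ X]mulr1.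
  apply: (@polybM _ _ 1 1); last exact: polyb_coord.
  apply: polyb_sum => i; rewrite -[X in polyb _ X]mul1r.
  by apply: (@polybM _ _ 1 0); [exact: polyb_coord|exact: polyb_cst].
by rewrite mulrDr mulr1 addrC; exact: polybB.
Qed.

Lemma llr_bound rad x theta : 0 <= rad -> enorm theta <= rad ->
  `|llr x theta| <= invmx_l1 * (1 + rad) ^+ 2 * (1 + l1norm x).
Proof.
move=> r0 tr; rewrite mulrAC; apply: polyb_bound (llr_polyb x).
  by rewrite lerDl.
move=> i; apply: le_trans (coord_le_enorm theta i) _.
by apply: le_trans tr _; rewrite lerDr.
Qed.

Lemma expgrowth_expllr theta : expgrowth (fun x => expR (llr x theta)).
Proof.
pose rad := enorm theta; have r0 : 0 <= rad by exact: sqrtr_ge0.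
pose c := invmx_l1 * (1 + rad) ^+ 2.
have c0 : 0 <= c by rewrite mulr_ge0 ?invmx_l1_ge0 ?sqr_ge0.
split; first by apply: measurableT_comp => //; exact: measurable_llr.
exists (expR c), c; split; rewrite ?expR_ge0// => x.
rewrite ger0_norm ?expR_ge0// -expRD ler_expR.
apply: le_trans (ler_norm _) _; apply: le_trans (llr_bound x r0 (lexx rad)) _.
by rewrite -/c mulrDr mulr1.
Qed.

(** The density of the mixture relative to the Gaussian centred at 0. *)
Definition mratio G x : R := mint G (fun t => expR (llr x t)).

Lemma mixture_pdfE G x : mixture_pdf Sigma G x = mratio G x * gauss_pdf Sigma 0 x.
Proof.
rewrite /mixture_pdf /mratio /mint mulr_suml; apply: eq_bigr => i _.
by rewrite gauss_pdf_llr//; ring.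
Qed.

Lemma expgrowth_mratio G : expgrowth (mratio G).
Proof. by apply: expgrowth_sum => i; apply: expgrowthZ; exact: expgrowth_expllr. Qed.

Definition llrc (rad : R) := invmx_l1 * (1 + rad) ^+ 2.

Lemma llrc_ge0 rad : 0 <= llrc rad.
Proof. by rewrite mulr_ge0 ?invmx_l1_ge0 ?sqr_ge0. Qed.

Lemma mratio_le rad G x : 0 <= rad -> ballmix rad G ->
  mratio G x <= expR (llrc rad * (1 + l1norm x)).
Proof.
move=> r0 bG; rewrite -[leRHS](mint_cst _ bG); apply: mint_le bG _ => t tr.
by rewrite ler_expR; apply: le_trans (ler_norm _) _; exact: llr_bound.
Qed.

Lemma mratio_ge rad G x : 0 <= rad -> ballmix rad G ->
  expR (- (llrc rad * (1 + l1norm x))) <= mratio G x.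
Proof.
move=> r0 bG; rewrite -[leLHS](mint_cst _ bG); apply: mint_le bG _ => t tr.
by rewrite ler_expR lerNl; apply: le_trans (ler_norm _) _; rewrite normrN; exact: llr_bound.
Qed.

Lemma mratio_gt0 rad G x : 0 <= rad -> ballmix rad G -> 0 < mratio G x.
Proof. by move=> r0 bG; apply: lt_le_trans (mratio_ge x r0 bG); exact: expR_gt0. Qed.

Lemma gint_expR_mratio rad a : 0 <= rad -> 0 <= a ->
  exists2 K : R, 0 < K & forall G, ballmix rad G ->
    gint (fun x => expR (a * l1norm x) * mratio G x) <= K.
Proof.
move=> r0 a0; pose c := llrc rad; have c0 : 0 <= c := llrc_ge0 rad.
have ac0 : 0 <= a + c by rewrite addr_ge0.
exists (1 + expR c * gint (fun x => expR ((a + c) * l1norm x))).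
  rewrite ltr_pwDl// mulr_ge0 ?expR_ge0// gint_ge0// => x; exact: expR_ge0.
move=> G bG; rewrite -gintZ//; last exact: expgrowth_expR.
apply: ler_wpDl => //; apply: gint_le => //.
- by apply: expgrowthM; [exact: expgrowth_expR|exact: expgrowth_mratio].
- by apply: expgrowthZ; exact: expgrowth_expR.
move=> x; apply: le_trans (ler_wpM2l (expR_ge0 _) (mratio_le x r0 bG)) _.
rewrite -!expRD ler_expR; apply: eq_ler.
by rewrite -/c; ring.
Qed.

Definition hgap G H x := (Num.sqrt (mratio G x) - Num.sqrt (mratio H x)) ^+ 2.

Lemma expgrowth_hgap G H : expgrowth (hgap G H).
Proof.
have e : expgrowth (fun x => Num.sqrt (mratio G x) - Num.sqrt (mratio H x)).
  by apply: expgrowthB; apply: expgrowth_sqrt; exact: expgrowth_mratio.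
by have := expgrowthM e e; congr expgrowth; apply/funext => x; rewrite /hgap expr2.
Qed.

Lemma hellinger_sqr rad G H : 0 <= rad -> ballmix rad G -> ballmix rad H ->
  hell G H ^+ 2 = 2^-1 * gint (hgap G H).
Proof.
move=> r0 bG bH; rewrite /hellinger sqr_sqrtr; last first.
  by rewrite mulr_ge0// Rintegral_ge0// => x _; exact: sqr_ge0.
congr (_ * _); apply: eq_Rintegral => x _; rewrite !mixture_pdfE /hgap.
rewrite (sqrtrM _ (ltW (mratio_gt0 x r0 bG))) (sqrtrM _ (ltW (mratio_gt0 x r0 bH))).
rewrite -mulrBl exprMn.
by rewrite sqr_sqrtr// ltW// gauss_pdf_gt0.
Qed.

(** Factoring [p_G - p_H] through the square roots leaves one factor whose [L2] size is the
    Hellinger distance up to a constant and one whose [L2] size, even against [h], is bounded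
    uniformly over the ball. *)
Lemma gint_test_le rad a : 0 <= rad -> 0 <= a -> exists2 A : R, 0 < A &
  forall G H, ballmix rad G -> ballmix rad H ->
  forall h, measurable_fun setT h -> (forall x, `|h x| <= expR (a * l1norm x)) ->
    `|gint (fun x => h x * (mratio G x - mratio H x))| <= A * hell G H.
Proof.
move=> r0 a0; have [K K0 KG] := gint_expR_mratio r0 (mulr_ge0 (ler0n R 2) a0).
exists (1 + 2 * K); first by rewrite addr_gt0// mulr_gt0.
move=> G H bG bH h mh ha.
have eh : expgrowth h by split => //; exists 1, a; split => // x; rewrite mul1r.
have eG := expgrowth_mratio G; have eH := expgrowth_mratio H.
set eta := hell G H; have eta0 : 0 <= eta by exact: sqrtr_ge0.
have ediff : expgrowth (fun x => h x * (mratio G x - mratio H x)).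
  by apply: expgrowthM => //; exact: expgrowthB.
pose k x := expR (2 * a * l1norm x).
have ek : expgrowth k by apply: expgrowth_expR; rewrite mulr_ge0.
have ekG : expgrowth (fun x => k x * mratio G x) by exact: expgrowthM.
have ekH : expgrowth (fun x => k x * mratio H x) by exact: expgrowthM.
(* AM-GM with a free parameter [l], to be taken equal to [eta] *)
have main l : 0 < l ->
    `|gint (fun x => h x * (mratio G x - mratio H x))| <= l^-1 * eta ^+ 2 + l * (2 * K).
  move=> l0; apply: le_trans (gint_norm _ ediff) _ => //.
  apply: (@le_trans _ _ (gint (fun x => l^-1 * 2^-1 * hgap G H x +
      l * (k x * mratio G x + k x * mratio H x)))).
    apply: gint_le => //.
    - exact: expgrowth_norm.
    - apply: expgrowthD; first by apply: expgrowthZ; exact: expgrowth_hgap.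
      by apply: expgrowthZ; exact: expgrowthD.
    move=> x; rewrite normrM.
    have G0 := ltW (mratio_gt0 x r0 bG); have H0 := ltW (mratio_gt0 x r0 bH).
    have -> : mratio G x - mratio H x =
        (Num.sqrt (mratio G x) - Num.sqrt (mratio H x)) *
        (Num.sqrt (mratio G x) + Num.sqrt (mratio H x)).
      by rewrite -subr_sqr !sqr_sqrtr.
    rewrite /hgap normrM -[in leRHS](sqr_sqrtr G0) -[in leRHS](sqr_sqrtr H0).
    rewrite [Num.sqrt (Num.sqrt _ ^+ 2)]sqrtr_sqr [X in (X - _) ^+ 2]ger0_norm ?sqrtr_ge0//.
    rewrite [Num.sqrt (Num.sqrt _ ^+ 2)]sqrtr_sqr [X in (_ - X) ^+ 2]ger0_norm ?sqrtr_ge0//.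
    have : 0 <= Num.sqrt (mratio G x) by exact: sqrtr_ge0.
    have : 0 <= Num.sqrt (mratio H x) by exact: sqrtr_ge0.
    move: (Num.sqrt (mratio G x)) (Num.sqrt (mratio H x)) => s t t0 s0.
    rewrite [X in _ * (_ * X)]ger0_norm ?addr_ge0//.
    have -> : k x = expR (a * l1norm x) ^+ 2.
      by rewrite /k expr2 -expRD; congr expR; ring.
    have := ha x; move: (expR _) `|h x| (normr_ge0 (h x)) => e u u0 ue.
    rewrite -(real_normK (num_real (s - t))).
    have := normr_ge0 (s - t); move: `|s - t| => v v0.
    apply: (@le_trans _ _ (e * (v * (s + t)))).
      by rewrite ler_wpM2r// mulr_ge0// addr_ge0.
    rewrite -(ler_pM2l (mulr_gt0 (ltr0n R 2) l0)).
    have -> : 2 * l * (l^-1 * 2^-1 * v ^+ 2 + l * (e ^+ 2 * s ^+ 2 + e ^+ 2 * t ^+ 2))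
      = v ^+ 2 + (l * e) ^+ 2 * (2 * (s ^+ 2 + t ^+ 2)) by field; rewrite gt_eqF.
    have -> : 2 * l * (e * (v * (s + t))) = 2 * v * ((l * e) * (s + t)) by ring.
    move: (l * e) => w.
    rewrite -subr_ge0 (_ : _ - _ = (v - w * (s + t)) ^+ 2 + (w * (s - t)) ^+ 2).
      by rewrite addr_ge0// sqr_ge0.
    by ring.
  rewrite gintD; [|by []| |].
  - rewrite !gintZ; [|by []| |by []|]; last 2 first.
    + exact: expgrowthD.
    + exact: expgrowth_hgap.
    rewrite gintD// -mulrA -(hellinger_sqr r0 bG bH) -/eta lerD2l (ler_wpM2l (ltW l0))//.
    by rewrite mulr_natl mulr2n; apply: lerD; [exact: KG bG|exact: KG bH].
  - by apply: expgrowthZ; exact: expgrowth_hgap.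
  - by apply: expgrowthZ; exact: expgrowthD.
(* The choice [l = eta] is not allowed for [eta = 0]; there [l] tends to 0 instead. *)
have [e0|e0] := eqVneq eta 0; last first.
  have ep : 0 < eta by rewrite lt_def e0.
  apply: le_trans (main _ ep) _; apply: eq_ler.
  by field.
rewrite e0 mulr0; apply/ler_addgt0Pr => e ep; rewrite add0r.
have lp : 0 < e / (2 * K) by rewrite divr_gt0// mulr_gt0.
apply: le_trans (main _ lp) _; rewrite e0 expr0n mulr0 add0r divfK//.
by rewrite gt_eqF// mulr_gt0.
Qed.

Lemma wordv_expR (w : seq 'I_d) x : `|wordv w x| <= expR ((size w)%:R * l1norm x).
Proof.
elim: w => [|i w IH]; first by rewrite wordv_nil normr1 mul0r expR0.
rewrite wordv_cons normrM /= -natr1 mulrDl mul1r addrC expRD ler_pM//.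
apply: le_trans (coord_le_l1norm x i) _.
by apply: le_trans (expR_ge1Dx _); rewrite lerDr.
Qed.

Lemma expgrowth_wordv (w : seq 'I_d) : expgrowth (wordv w : 'rV[R]_d -> R).
Proof. by apply: expgrowth_prod => i; exact: expgrowth_coord. Qed.

Lemma gint_wordv_mratio (w : seq 'I_d) G :
  gint (fun x => wordv w x * mratio G x) =
  mint G (fun t => gint (fun x => wordv w (x + t))).
Proof.
have e t : expgrowth (fun x => wordv w x * expR (llr x t)).
  by apply: expgrowthM; [exact: expgrowth_wordv|exact: expgrowth_expllr].
transitivity (\sum_(i < ncomp G) gint (fun x =>
    weight i * (wordv w x * expR (llr x (atom i))))); last first.
  apply: eq_bigr => i _; rewrite gintZ// gint_shift//.
  by have [] := expgrowth_wordv w.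
rewrite -gint_sum//; last by move=> i; exact: expgrowthZ.
congr gint; apply/funext => x; rewrite /mratio /mint mulr_sumr.
by apply: eq_bigr => i _; rewrite mulrCA.
Qed.

(* The Gaussian average of [wordv w (x + t)] is [wordv w t] up to a positive factor
   and words of smaller size, so moments reduce to Hellinger-bounded test functions
   by induction. *)
Lemma moment_gap_le rad n : 0 <= rad -> exists2 A : R, 0 < A &
  forall G H, ballmix rad G -> ballmix rad H ->
  forall w : seq 'I_d, (size w <= n)%N -> `|dint G H (wordv w)| <= A * hell G H.
Proof.
move=> r0; elim: n => [|n [A A0 IH]].
  exists 1 => // G H bG bH [|//] _.
  rewrite (_ : wordv [::] = cst 1); last by apply/funext => t; rewrite wordv_nil.
  by rewrite /dint (mint_cst _ bG) (mint_cst _ bH) subrr normr0 mul1r sqrtr_ge0.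
pose M0 := gint (cst 1); have M0p : 0 < M0 by exact: gint1_gt0.
have [A' A'0 HA'] := gint_test_le r0 (ler0n R n.+1).
pose K := gint (fun x => expR (n.+1%:R * l1norm x)).
have K0 : 0 <= K by apply: gint_ge0 => // x; exact: expR_ge0.
have T0 : 0 <= M0^-1 * (A' + (2 ^ n.+1)%:R * (A * K)).
  rewrite mulr_ge0 ?invr_ge0 ?(ltW M0p)// addr_ge0 ?(ltW A'0)//.
  by rewrite mulr_ge0// mulr_ge0// ltW.
exists (A + M0^-1 * (A' + (2 ^ n.+1)%:R * (A * K))); first by rewrite ltr_pwDl.
move=> G H bG bH w; have hell0 : 0 <= hell G H by exact: sqrtr_ge0.
rewrite leq_eqVlt ltnS => /orP[/eqP wn|/IH wH]; last first.
  by apply: le_trans (wH G H bG bH) _; rewrite mulrDl lerDl mulr_ge0.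
have [L [LE Ls Ln]] := @wordv_translate R d w.
have E t : gint (fun x => wordv w (x + t)) =
    M0 * wordv w t + \sum_(m <- L) gint (wordv m.2) * wordv m.1 t.
  rewrite (_ : (fun x => wordv w (x + t)) = fun x => wordv w t * cst 1 x +
      \sum_(m <- L) (fun m x => wordv m.1 t * wordv m.2 x) m x); last first.
    by apply/funext => x; rewrite LE mulr1.
  have e1 : expgrowth (fun x : 'rV[R]_d => wordv w t * cst 1 x).
    by apply: expgrowthZ; exact: expgrowth_cst.
  have e2 (m : seq 'I_d * seq 'I_d) : expgrowth (fun x => wordv m.1 t * wordv m.2 x).
    by apply: expgrowthZ; exact: expgrowth_wordv.
  rewrite gintD//; last exact: expgrowth_sum.
  rewrite gintZ//; last exact: expgrowth_cst.
  rewrite gint_sum// mulrC; congr (_ + _); apply: eq_bigr => m _.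
  by rewrite gintZ//; [exact: mulrC|exact: expgrowth_wordv].
have D : dint G H (fun t => gint (fun x => wordv w (x + t))) =
    gint (fun x => wordv w x * (mratio G x - mratio H x)).
  rewrite /dint -!gint_wordv_mratio -gintB//.
  - by congr gint; apply/funext => x; rewrite mulrBr.
  - by apply: expgrowthM; [exact: expgrowth_wordv|exact: expgrowth_mratio].
  - by apply: expgrowthM; [exact: expgrowth_wordv|exact: expgrowth_mratio].
have D' : dint G H (fun t => gint (fun x => wordv w (x + t))) =
    M0 * dint G H (wordv w) +
    \sum_(m <- L) gint (wordv m.2) * dint G H (wordv m.1).
  rewrite (_ : (fun t => gint (fun x => wordv w (x + t))) = fun t =>
      M0 * wordv w t + \sum_(m <- L) (fun m t => gint (wordv m.2) * wordv m.1 t) m t).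
    rewrite dintD dintZ dint_sum; congr (_ + _).
    by apply: eq_bigr => m _; rewrite dintZ.
  exact/funext.
(* The expansion is solved for the leading moment; [M0] is invertible by [gint1_gt0]. *)
have -> : dint G H (wordv w) =
    M0^-1 * (gint (fun x => wordv w x * (mratio G x - mratio H x)) -
      \sum_(m <- L) gint (wordv m.2) * dint G H (wordv m.1)).
  by rewrite -D D' addrK mulKf// gt_eqF.
rewrite normrM gtr0_norm ?invr_gt0//.
apply: (@le_trans _ _ (M0^-1 * (A' + (2 ^ n.+1)%:R * (A * K)) * hell G H)); last first.
  by rewrite ler_wpM2r// lerDr ltW.
rewrite -mulrA ler_wpM2l ?invr_ge0 ?(ltW M0p)//.
apply: le_trans (ler_normB _ _) _; rewrite mulrDl; apply: lerD.
  apply: HA' => //; first by have [] := expgrowth_wordv w.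
  by move=> x; rewrite -wn; exact: wordv_expR.
apply: le_trans (ler_norm_sum _ _ _) _.
apply: (@le_trans _ _ (\sum_(m <- L) K * (A * hell G H))).
  rewrite big_seq [leRHS]big_seq; apply: ler_sum => m /(allP Ls)/andP[m1 m2].
  rewrite normrM; apply: ler_pM => //; last by apply: IH => //; rewrite -ltnS -wn.
  apply: le_trans (gint_norm _ (expgrowth_wordv _)) _ => //.
  apply: gint_le => //.
  - exact/expgrowth_norm/expgrowth_wordv.
  - exact: expgrowth_expR.
  move=> x; apply: le_trans (wordv_expR _ _) _.
  by rewrite ler_expR ler_wpM2r ?l1norm_ge0// ler_nat -wn.
rewrite big_const_seq iter_addr_0 count_predT -[leLHS]mulr_natl.
have -> : (2 ^ n.+1)%:R * (A * K) * hell G H = (2 ^ n.+1)%:R * (K * (A * hell G H)).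
  by ring.
rewrite ler_wpM2r ?mulr_ge0 ?(ltW A0)//.
by rewrite ler_nat ltnW// -wn.
Qed.

End moments.

(** * Transport to the nearest atoms *)

Section wasserstein.
Context {R : realType}.

(** Supplies finite couplings as measures, together with their integral formula; [i0] is the default
    value of [nth] in the enumeration of [I]. *)
Lemma atomic_measure_exists dsp (T : measurableType dsp) (I : finType) (i0 : I)
    (c : I -> R) (pt : I -> T) : (forall i, 0 <= c i) ->
  exists mu : {measure set T -> \bar R},
    (forall A, measurable A -> mu A = (\sum_i (c i)%:E * \d_(pt i) A)%E) /\
    (forall f : T -> \bar R, measurable_fun setT f -> (forall x, (0 <= f x)%E) ->
      (\int[mu]_x f x = \sum_i (c i)%:E * f (pt i))%E).
Proof.
move=> c0.
pose m_ (k : nat) : {measure set T -> \bar R} :=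
  mscale (NngNum (c0 (nth i0 (enum I) k))) (dirac (pt (nth i0 (enum I) k))).
have sumE (F : I -> \bar R) : (\sum_i F i = \sum_(k < #|I|) F (nth i0 (enum I) k))%E.
  by rewrite -big_enum (big_nth i0) big_mkord -cardE.
exists (msum m_ #|I|); split=> [A mA|f mf f0]; first by rewrite sumE.
rewrite ge0_integral_measure_sum// sumE; apply: eq_bigr => k _.
by rewrite ge0_integral_mscale//= integral_dirac// diracT mul1e.
Qed.

Context {d : nat}.
Implicit Types (G H : mixing R d) (x y : 'rV[R]_d).

Lemma measurable_enorm_sub :
  measurable_fun setT (fun z : 'rV[R]_d * 'rV[R]_d => (enorm (z.1 - z.2) ^+ 2)%:E).
Proof.
apply/measurable_EFinP; apply: measurable_funX.
apply: (measurableT_comp (continuous_measurable_fun (@sqrt_continuous R))).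
apply: measurable_sum => i; apply: measurable_funX.
rewrite (_ : (fun _ => _) = fun z : 'rV[R]_d * 'rV[R]_d => z.1 ord0 i - z.2 ord0 i).
  apply: measurable_funB.
    by apply: (measurableT_comp (@measurable_coord _ R d i)).
  by apply: (measurableT_comp (@measurable_coord _ R d i)).
by apply/funext => z; rewrite !mxE.
Qed.

(** A nonnegative matrix with the right marginals is a coupling. Its finite cost also shows that
    [fine] does not alter the infimum. *)
Lemma W2_sqr_le G H (g : 'I_(ncomp G) -> 'I_(ncomp H) -> R)
    (i0 : 'I_(ncomp G)) (j0 : 'I_(ncomp H)) :
  (forall i j, 0 <= g i j) -> (forall i, \sum_j g i j = weight i) ->
  (forall j, \sum_i g i j = weight j) ->
  W2 G H ^+ 2 <= \sum_i \sum_j g i j * enorm (atom i - atom j) ^+ 2.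
Proof.
move=> g0 gi gj.
have [mu [muA muf]] := atomic_measure_exists (i0, j0)
  (fun ij : 'I_(ncomp G) * 'I_(ncomp H) => (atom ij.1, atom ij.2))
  (c := fun ij => g ij.1 ij.2) (fun ij => g0 _ _).
have cpl : coupling (mixing_measure G) (mixing_measure H) mu.
  split=> A mA.
  - rewrite muA; last exact: measurableX.
    rewrite -(pair_bigA _ (fun i j => (g i j)%:E * \d_(atom i, atom j) (A `*` setT)))%E /=.
    apply: eq_bigr => i _; rewrite -gi -sumEFin ge0_sume_distrl; last first.
      by move=> j _; rewrite lee_fin.
    by apply: eq_bigr => j _; rewrite !diracE in_setX /= in_setT andbT.
  - rewrite muA; last exact: measurableX.
    rewrite -(pair_bigA _ (fun i j => (g i j)%:E * \d_(atom i, atom j) (setT `*` A)))%E /=.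
    rewrite exchange_big /=; apply: eq_bigr => j _.
    rewrite -gj -sumEFin ge0_sume_distrl; last by move=> i _; rewrite lee_fin.
    by apply: eq_bigr => i _; rewrite !diracE in_setX /= in_setT.
pose S := [set (\int[nu]_z (enorm (z.1 - z.2) ^+ 2)%:E)%E | nu in
  coupling (mixing_measure G) (mixing_measure H)].
pose c := \sum_i \sum_j g i j * enorm (atom i - atom j) ^+ 2.
have Sc : (ereal_inf S <= c%:E)%E.
  apply: ereal_inf_lbound; exists mu => //; rewrite muf.
  - rewrite -(pair_bigA _ (fun i j =>
      (g i j)%:E * (enorm (atom i - atom j) ^+ 2)%:E))%E /= /c -sumEFin.
    by apply: eq_bigr => i _; rewrite -sumEFin.
  - exact: measurable_enorm_sub.
  - by move=> z; rewrite lee_fin sqr_ge0.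
have S0 : (0 <= ereal_inf S)%E.
  apply: le_ereal_inf_tmp => _ [nu _ <-]; apply: integral_ge0 => z _.
  by rewrite lee_fin sqr_ge0.
rewrite /W2 -/S sqr_sqrtr ?fine_ge0// -lee_fin fineK//.
by rewrite ge0_fin_numE// (le_lt_trans Sc) ?ltry.
Qed.

End wasserstein.

(** * Test polynomials for separated atoms *)

Section nearest_atom_polynomials.
Context {R : realType} {d : nat}.
Implicit Types (x y t : 'rV[R]_d).

Definition ip x y : R := \sum_i x ord0 i * y ord0 i.

Definition sqdist x y : R := \sum_i (x ord0 i - y ord0 i) ^+ 2.

Lemma sqdist_ge0 x y : 0 <= sqdist x y.
Proof. by apply: sumr_ge0 => i _; exact: sqr_ge0. Qed.

Lemma sqdistC x y : sqdist x y = sqdist y x.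
Proof. by apply: eq_bigr => i _; rewrite -opprB sqrrN. Qed.

Lemma enorm_sqr x y : enorm (x - y) ^+ 2 = sqdist x y.
Proof.
rewrite /enorm sqr_sqrtr; last by apply: sumr_ge0 => i _; exact: sqr_ge0.
by apply: eq_bigr => i _; rewrite !mxE.
Qed.

Lemma sqdist_triangle x y z : sqdist x z <= 2 * sqdist x y + 2 * sqdist y z.
Proof.
rewrite /sqdist !mulr_sumr -big_split; apply: ler_sum => i _ /=.
move: (x ord0 i) (y ord0 i) (z ord0 i) => a b c.
rewrite -subr_ge0 (_ : _ - _ = (a - b - (b - c)) ^+ 2); first exact: sqr_ge0.
ring.
Qed.

Lemma ip_sqr_le x y : ip x y ^+ 2 <= ip x x * ip y y.
Proof.
pose s := ip y y; pose c := ip x y.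
have s0 : 0 <= s by apply: sumr_ge0 => i _; rewrite -expr2 sqr_ge0.
have H : 0 <= s * (s * ip x x - c ^+ 2).
  rewrite (_ : s * _ = \sum_i (s * x ord0 i - c * y ord0 i) ^+ 2).
    by apply: sumr_ge0 => i _; exact: sqr_ge0.
  transitivity (s ^+ 2 * ip x x - 2 * s * c * ip x y + c ^+ 2 * ip y y).
    by rewrite -/s -/c; ring.
  by move: s c {s0} => s c; rewrite /ip !mulr_sumr -sumrB -big_split;
    apply: eq_bigr => i _ /=; ring.
have [s00|sn0] := eqVneq s 0; last first.
  have sp : 0 < s by rewrite lt_def sn0.
  by move: H; rewrite pmulr_rge0// subr_ge0 mulrC.
have y0 i : y ord0 i = 0.
  apply/eqP; rewrite -sqrf_eq0 eq_le sqr_ge0 andbT -s00 /s /ip (bigD1 i)//= expr2 lerDl.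
  by apply: sumr_ge0 => j _; rewrite -expr2 sqr_ge0.
rewrite -/s s00 mulr0 (_ : ip x y = 0) ?expr0n//.
by rewrite /ip big1// => i _; rewrite y0 mulr0.
Qed.

(* The linear terms cancel in [prod (1 + a + b) * (1 - sum a)]. *)
Lemma prod_second_order (I : Type) (r : seq I) (P : pred I) (a b : I -> R) (x : R) :
  0 <= x <= 1 -> (forall i, P i -> `|a i| <= 2 * x) ->
  (forall i, P i -> 0 <= b i <= x ^+ 2) ->
  `|\prod_(i <- r | P i) (1 + a i + b i) - 1 - \sum_(i <- r | P i) a i|
    <= (16 ^ size r)%:R * x ^+ 2.
Proof.
move=> /andP[x0 x1] ax bx.
have sa r' : `|\sum_(i <- r' | P i) a i| <= (2 * size r')%:R * x.
  elim: r' => [|i r' IH]; first by rewrite big_nil normr0 mul0r.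
  rewrite big_cons /= mulnS natrD mulrDl; case: ifPn => Pi.
    by apply: le_trans (ler_normD _ _) _; rewrite lerD// ax.
  by apply: le_trans IH _; rewrite lerDr mulr_ge0.
elim: r => [|i r IH].
  by rewrite !big_nil subrr subrr normr0 mulr_ge0// sqr_ge0.
have x2 : 0 <= x ^+ 2 by exact: sqr_ge0.
rewrite !big_cons /= expnS natrM; case: ifPn => Pi; last first.
  by apply: le_trans IH _; rewrite ler_wpM2r// ler_peMl// ler1n.
set p := \prod_(_ <- _ | _) _ in IH *; set s := \sum_(_ <- _ | _) _ in IH *.
have -> : (1 + a i + b i) * p - 1 - (a i + s) =
  (p - 1 - s) * (1 + a i + b i) + (b i + s * a i + s * b i) by ring.
have /andP[b0 b1] := bx i Pi; have a1 := ax i Pi; have s1 := sa r; rewrite -/s in s1.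
have E1 : `|1 + a i + b i| <= 4.
  apply: le_trans (ler_normD _ _) _; rewrite (ger0_norm b0).
  have := ler_normD 1 (a i); rewrite normr1.
  have : x ^+ 2 <= 1 by rewrite expr_le1.
  lra.
have E2 : `|s * a i| <= (2 * size r)%:R * 2 * x ^+ 2.
  rewrite normrM expr2; apply: le_trans (ler_pM _ _ s1 a1) _ => //.
  by apply: eq_ler; ring.
have E3 : `|s * b i| <= (2 * size r)%:R * x ^+ 2.
  rewrite normrM (ger0_norm b0); apply: ler_pM => //.
  by apply: le_trans s1 _; rewrite ler_piMr.
(* One more factor multiplies the old error by at most 4 and adds [6 * size r + 1] times [x ^+ 2];
   the base 16 leaves room for 12 times the old power. *)
have E4 : (2 * size r)%:R * 3 + 1 <= 12 * (16 ^ size r)%:R :> R.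
  have : ((2 * size r) * 3 + 1 <= 12 * 16 ^ size r)%N.
    have := ltn_expl (size r) (isT : 1 < 16)%N.
    by move: (size r) (16 ^ size r)%N => m k mk; lia.
  by rewrite -(ler_nat R) natrD (natrM _ (2 * size r)%N 3) (natrM _ 12).
apply: le_trans (ler_normD _ _) _; rewrite normrM.
apply: (@le_trans _ _ ((16 ^ size r)%:R * x ^+ 2 * 4 +
    (x ^+ 2 + (2 * size r)%:R * 2 * x ^+ 2 + (2 * size r)%:R * x ^+ 2))).
  apply: lerD; first by apply: ler_pM.
  apply: le_trans (ler_normD _ _) _; apply: lerD => //.
  by apply: le_trans (ler_normD _ _) _; apply: lerD => //; rewrite ger0_norm.
have := ler_wpM2r x2 E4.
move: (2 * size r)%:R (16 ^ size r)%:R => u v; lra.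
Qed.

End nearest_atom_polynomials.

Section separated_atoms.
Context {R : realType} {d m : nat}.
Variables (a : 'I_m -> 'rV[R]_d) (D : R).
Hypothesis D0 : 0 < D.
Hypothesis aD : forall j l, j != l -> D ^+ 2 <= sqdist (a j) (a l).
Implicit Types (j l : 'I_m) (t : 'rV[R]_d).

Definition atoms_poly t : R := \prod_l sqdist t (a l).

Lemma atoms_poly_ge0 t : 0 <= atoms_poly t.
Proof. by apply: prodr_ge0 => l _; exact: sqdist_ge0. Qed.

Let slope j l t : R := 2 * ip (a j - a l) (t - a j) / sqdist (a j) (a l).
Let ratio j l t : R := sqdist t (a l) / sqdist (a j) (a l).

(** The product equals 1 at [a j] and has a double zero at every other atom. The affine factor
    cancels its gradient at [a j]. *)
Definition hermite_poly j t : R :=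
  (\prod_(l | l != j) (sqdist t (a l) / sqdist (a j) (a l))) *
  (1 - \sum_(l | l != j) 2 * ip (a j - a l) (t - a j) / sqdist (a j) (a l)).

Let D2 : 0 < D ^+ 2. Proof. by rewrite exprn_gt0. Qed.

Let sq0 j l : l != j -> 0 < sqdist (a j) (a l).
Proof. by rewrite eq_sym => /aD; exact: lt_le_trans. Qed.

Lemma sqdistE t j l : sqdist t (a l) =
  sqdist (a j) (a l) + 2 * ip (a j - a l) (t - a j) + sqdist t (a j).
Proof.
rewrite /sqdist /ip mulr_sumr -!big_split; apply: eq_bigr => i _ /=.
rewrite !mxE; ring.
Qed.

Let ratioE j l t : l != j ->
  ratio j l t = 1 + slope j l t + sqdist t (a j) / sqdist (a j) (a l).
Proof.
move=> lj; rewrite /ratio /slope (sqdistE t j l).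
by field; rewrite gt_eqF// sq0.
Qed.

Lemma ip_sub (x y : 'rV[R]_d) : ip (x - y) (x - y) = sqdist x y.
Proof. by apply: eq_bigr => i _; rewrite !mxE expr2. Qed.

Let gap j t := Num.sqrt (sqdist t (a j)) / D.

Let gap_ge0 j t : 0 <= gap j t.
Proof. by rewrite divr_ge0 ?sqrtr_ge0// ltW. Qed.

Let gap_sqr j t : gap j t ^+ 2 = sqdist t (a j) / D ^+ 2.
Proof. by rewrite expr_div_n sqr_sqrtr// sqdist_ge0. Qed.

Let offset_bound j l t : l != j ->
  0 <= sqdist t (a j) / sqdist (a j) (a l) <= gap j t ^+ 2.
Proof.
move=> lj; rewrite divr_ge0 ?sqdist_ge0//= gap_sqr ler_wpM2l ?sqdist_ge0//.
by rewrite lef_pV2 ?posrE ?sq0// aD// eq_sym.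
Qed.

Let slope_bound j l t : l != j -> `|slope j l t| <= 2 * gap j t.
Proof.
move=> lj; have s0 := sq0 lj.
suff : `|slope j l t| ^+ 2 <= (2 * gap j t) ^+ 2.
  by rewrite ler_pXn2r// nnegrE// mulr_ge0// gap_ge0.
rewrite real_normK ?num_real//.
rewrite [leRHS]exprMn gap_sqr /slope expr_div_n exprMn.
have := ip_sqr_le (a j - a l) (t - a j); rewrite !ip_sub => H.
have [_ H2] := andP (offset_bound t lj); rewrite gap_sqr in H2.
rewrite -mulrA ler_wpM2l ?sqr_ge0//; apply: le_trans H2.
rewrite ler_pdivrMr ?exprn_gt0// (_ : _ / _ * _ = sqdist t (a j) * sqdist (a j) (a l)).
  by rewrite mulrC.
by field; rewrite gt_eqF.
Qed.

Let ratio_ge0 j l t : 0 <= ratio j l t.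
Proof. by rewrite divr_ge0 ?sqdist_ge0. Qed.

Let card_neq j : #|(fun l => l != j)| = m.-1.
Proof. by have := cardC1 j; rewrite card_ord. Qed.

(** Bounds the product by the normalized [atoms_poly] except where [gap] is small, that is near
    [a j]; there the second-order expansion takes over. *)
Let prod_ratio_le j t :
  gap j t ^+ 2 * \prod_(l | l != j) ratio j l t <= atoms_poly t / D ^+ (2 * m).
Proof.
rewrite ler_pdivlMr ?exprn_gt0// /atoms_poly gap_sqr.
rewrite [leRHS](bigD1 j)//=.
have -> : D ^+ (2 * m) = D ^+ 2 * \prod_(l | l != j) D ^+ 2.
  rewrite prodr_const exprM -exprS card_neq; congr (_ ^+ _).
  by rewrite prednK// (leq_ltn_trans _ (ltn_ord j)).
rewrite [leLHS](_ : _ =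
    sqdist t (a j) * (\prod_(l | l != j) ratio j l t * \prod_(l | l != j) D ^+ 2)).
  rewrite ler_wpM2l ?sqdist_ge0// -big_split; apply: ler_prod => l lj.
  rewrite mulr_ge0 ?ratio_ge0 ?(ltW D2)//= /ratio mulrAC ler_pdivrMr ?sq0//.
  by rewrite ler_wpM2l ?sqdist_ge0// aD// eq_sym.
by move: (\prod_(_ | _) ratio _ _ _) (\prod_(_ | _) _) => u v; field; rewrite gt_eqF.
Qed.

Let sum_slope_bound j t : `|\sum_(l | l != j) slope j l t| <= 2 * m%:R * gap j t.
Proof.
apply: le_trans (ler_norm_sum _ _ _) _.
apply: (@le_trans _ _ (\sum_(l < m) 2 * gap j t)).
  rewrite [leRHS](bigID (fun l => l != j))/= -[leLHS]addr0 lerD//.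
    by apply: ler_sum => l lj; exact: slope_bound.
  by apply: sumr_ge0 => l _; rewrite mulr_ge0.
by rewrite sumr_const card_ord -[leLHS]mulr_natr; apply: eq_ler; ring.
Qed.

Variables (t : 'rV[R]_d) (jj : 'I_m).
Hypothesis jjP : forall l, sqdist t (a jj) <= sqdist t (a l).

Lemma far_sqdist l : l != jj -> D ^+ 2 / 4 <= sqdist t (a l).
Proof.
move=> lj; have := aD (_ : jj != l); rewrite eq_sym => /(_ lj) H.
have := sqdist_triangle (a jj) t (a l); rewrite (sqdistC (a jj) t).
have := jjP l; lra.
Qed.

Lemma atoms_poly_ge : sqdist t (a jj) * (D ^+ 2 / 4) ^+ m.-1 <= atoms_poly t.
Proof.
rewrite /atoms_poly (bigD1 jj)//= ler_wpM2l ?sqdist_ge0//.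
have -> : (D ^+ 2 / 4) ^+ m.-1 = \prod_(l | l != jj) (D ^+ 2 / 4).
  by rewrite prodr_const card_neq.
apply: ler_prod => l lj; rewrite far_sqdist// andbT.
by rewrite divr_ge0// ltW.
Qed.

(** A sum of what the three cases of [hermite_poly_bound] require. *)
Definition hermite_cst : R :=
  4 ^+ m * ((16 ^ m)%:R * (1 + 2 * m%:R) + 4 * m%:R ^+ 2 + 1) + 5 + 4 * m%:R.

Lemma hermite_cst_ge0 : 0 <= hermite_cst.
Proof. by rewrite /hermite_cst !(addr_ge0, mulr_ge0, exprn_ge0). Qed.

(** Three cases. If [a j] is not the nearest atom, then [gap] is at least 1/2 and [prod_ratio_le]
    suffices; it also does if [a j] is nearest and [gap] exceeds 1. Otherwise the error is of order
    [gap ^+ 2], which [atoms_poly] dominates because its other factors are at least [D ^+ 2 / 4]. *)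
Lemma hermite_poly_bound j :
  `|hermite_poly j t - (j == jj)%:R| <= hermite_cst * (atoms_poly t / D ^+ (2 * m)).
Proof.
set p := atoms_poly t / _.
have p0 : 0 <= p.
  by rewrite divr_ge0 ?exprn_ge0 ?(ltW D0)// atoms_poly_ge0.
rewrite /hermite_poly -/(slope _ _ _).
set Y := \prod_(l | l != j) _; set A := \sum_(l | l != j) _.
have Y0 : 0 <= Y by apply: prodr_ge0 => l _; exact: ratio_ge0.
set x := gap j t; have x0 : 0 <= x by exact: gap_ge0.
have Yp : x ^+ 2 * Y <= p by exact: prod_ratio_le.
have Ax : `|A| <= 2 * m%:R * x by exact: sum_slope_bound.
have YA : `|Y * (1 - A)| <= Y * (1 + 2 * m%:R * x).
  rewrite normrM (ger0_norm Y0) ler_wpM2l//; apply: le_trans (ler_normB _ _) _.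
  by rewrite normr1 lerD2l.
have N4 : 0 <= 4 ^+ m * ((16 ^ m)%:R * (1 + 2 * m%:R) + 4 * m%:R ^+ 2) * p.
  by rewrite mulr_ge0// !(addr_ge0, mulr_ge0, exprn_ge0).
have N1 : 0 <= 4 ^+ m * p by rewrite mulr_ge0// exprn_ge0.
have Np : 0 <= m%:R * p by rewrite mulr_ge0.
have E : hermite_cst * p =
  4 ^+ m * ((16 ^ m)%:R * (1 + 2 * m%:R) + 4 * m%:R ^+ 2) * p + 4 ^+ m * p
    + 5 * p + 4 * (m%:R * p).
  by rewrite /hermite_cst; ring.
have [jE|jN] := eqVneq j jj; last first.
  rewrite subr0; apply: le_trans YA _; rewrite E.
  have x2 : 1 <= 4 * x ^+ 2.
    by rewrite gap_sqr mulrA ler_pdivlMr// mul1r -ler_pdivrMl// mulrC far_sqdist.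
  have xx : x <= 2 * x ^+ 2 by nra.
  have : Y * (1 + 2 * m%:R * x) <= (4 + 4 * m%:R) * (x ^+ 2 * Y).
    rewrite [leRHS](_ : _ = Y * (4 * x ^+ 2 + 2 * m%:R * (2 * x ^+ 2))); last by ring.
    by rewrite ler_wpM2l// lerD// ler_wpM2l// mulr_ge0.
  have : (4 + 4 * m%:R) * (x ^+ 2 * Y) <= (4 + 4 * m%:R) * p.
    by rewrite ler_wpM2l// addr_ge0// mulr_ge0.
  lra.
have xp : x ^+ 2 <= 4 ^+ m * p.
  rewrite gap_sqr jE ler_pdivrMr//.
  have := atoms_poly_ge; rewrite expr_div_n.
  have -> : 4 ^+ m * p * D ^+ 2 = (4 * 4 ^+ m.-1) * (atoms_poly t / (D ^+ 2) ^+ m.-1).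
    have mE : m = m.-1.+1 by rewrite prednK// (leq_ltn_trans _ (ltn_ord j)).
    rewrite /p exprM {1 2}mE (exprS 4) (exprS (D ^+ 2)); field.
    by rewrite !expf_neq0 ?gt_eqF.
  rewrite [in X in X -> _]mulrA ler_pdivrMr ?exprn_gt0// => H.
  have H' : sqdist t (a jj) <= 4 ^+ m.-1 * (atoms_poly t / (D ^+ 2) ^+ m.-1).
    by rewrite mulrA ler_pdivlMr ?exprn_gt0// (mulrC (4 ^+ _)).
  apply: le_trans H' _; rewrite -mulrA ler_peMl//; last by lra.
  apply: mulr_ge0; first exact: exprn_ge0.
  by apply: divr_ge0; rewrite ?atoms_poly_ge0 ?exprn_ge0 ?(ltW D0).
rewrite E.
have [x1|x1] := lerP x 1; last first.
  apply: le_trans (ler_normB _ _) _; rewrite normr1.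
  have xx : 1 <= x ^+ 2 by rewrite expr_ge1// ltW.
  have x3 : x <= x ^+ 2 by rewrite expr2 ler_peMr// ltW.
  have : Y * (1 + 2 * m%:R * x) <= (1 + 2 * m%:R) * (x ^+ 2 * Y).
    rewrite [leRHS](_ : _ = Y * (x ^+ 2 + 2 * m%:R * x ^+ 2)); last by ring.
    by rewrite ler_wpM2l// lerD// ler_wpM2l// mulr_ge0.
  have : (1 + 2 * m%:R) * (x ^+ 2 * Y) <= (1 + 2 * m%:R) * p.
    by rewrite ler_wpM2l// addr_ge0// mulr_ge0.
  lra.
have YE : `|Y - 1 - A| <= (16 ^ m)%:R * x ^+ 2.
  have -> : Y = \prod_(l | l != j) (1 + slope j l t + sqdist t (a j) / sqdist (a j) (a l)).
    by apply: eq_bigr => l lj; rewrite -ratioE.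
  have := @prod_second_order R 'I_m (index_enum 'I_m) (fun l => l != j)
    (fun l => slope j l t) (fun l => sqdist t (a j) / sqdist (a j) (a l)) x.
  rewrite (_ : size _ = m); last by rewrite /index_enum -enumT size_enum_ord.
  apply; rewrite ?x0//.
    by move=> l lj; exact: slope_bound.
  by move=> l lj; exact: offset_bound.
(* The term linear in [A] cancels: both remaining terms are of second order. *)
have -> : Y * (1 - A) - 1 = (Y - 1 - A) * (1 - A) - A ^+ 2 by ring.
have A1 : `|1 - A| <= 1 + 2 * m%:R.
  apply: le_trans (ler_normB _ _) _; rewrite normr1 lerD2l.
  by apply: le_trans Ax _; rewrite ler_piMr// mulr_ge0.
have A2 : `|A ^+ 2| <= 4 * m%:R ^+ 2 * x ^+ 2.
  rewrite normrX (_ : 4 * _ * _ = (2 * m%:R * x) ^+ 2); last by ring.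
  by rewrite ler_pXn2r// nnegrE mulr_ge0// mulr_ge0.
apply: le_trans (ler_normB _ _) _; rewrite normrM.
apply: (@le_trans _ _ (((16 ^ m)%:R * (1 + 2 * m%:R) + 4 * m%:R ^+ 2) * x ^+ 2)).
  rewrite mulrDl lerD// mulrAC; apply: ler_pM => //.
have : ((16 ^ m)%:R * (1 + 2 * m%:R) + 4 * m%:R ^+ 2) * x ^+ 2 <=
    ((16 ^ m)%:R * (1 + 2 * m%:R) + 4 * m%:R ^+ 2) * (4 ^+ m * p).
  by rewrite ler_wpM2l// !(addr_ge0, mulr_ge0, exprn_ge0).
move=> /le_trans; apply; rewrite mulrA (mulrC _ (4 ^+ m)).
by lra.
Qed.

End separated_atoms.

Section transport_to_nearest.
Context {R : realType} {d : nat}.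
Implicit Types (G H : mixing R d).

Lemma ballmix_inhabited (rad : R) G : ballmix rad G -> inhabited 'I_(ncomp G).
Proof.
move=> [_ w1 _]; move: w1; case: (ncomp G) (@weight _ _ G) => [|n] w; last first.
  by move=> _; exact: (inhabits ord0).
by rewrite big_ord0 => /eqP; rewrite eq_sym oner_eq0.
Qed.

(* Keep as much of each cell's mass as its atom can absorb, and spread the
   excess proportionally over the deficits. *)
Lemma W2_sqr_le_nearest (rad M : R) G H (J : 'I_(ncomp G) -> 'I_(ncomp H)) :
  ballmix rad G -> ballmix rad H -> 0 <= M ->
  (forall j l : 'I_(ncomp H), sqdist (atom j) (atom l) <= M) ->
  W2 G H ^+ 2 <= 3 * (\sum_i weight i * sqdist (atom i) (atom (J i))) +
    2 * M * \sum_j `|\sum_(i | J i == j) weight i - weight j|.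
Proof.
move=> bG bH M0 HM; have [i0] := ballmix_inhabited bG.
have [p0 p1 _] := bG; have [q0 q1 _] := bH.
pose c (j : 'I_(ncomp H)) : R := \sum_(i | J i == j) weight i.
have c0 j : 0 <= c j by apply: sumr_ge0 => i _; exact: p0.
(* The share of cell [j] that its atom absorbs. For a cell of mass 0 the quotient is 0 by
   convention, which is harmless since there is nothing to keep. *)
pose s j : R := Num.min 1 (weight j / c j).
have s0 j : 0 <= s j by rewrite le_min ler01 divr_ge0.
have s1 j : s j <= 1 by rewrite ge_min lexx.
have cs j : c j * s j = Num.min (c j) (weight j).
  have [cj|cj] := eqVneq (c j) 0.
    by rewrite cj mul0r; apply/esym/min_idPl.
  by rewrite /s minr_pMr// mulr1 mulrCA divff// mulr1.
pose rho i : R := weight i * (1 - s (J i)).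
pose sg j : R := weight j - c j * s j.
have rho0 i : 0 <= rho i by rewrite mulr_ge0// subr_ge0.
have sg0 j : 0 <= sg j by rewrite subr_ge0 cs ge_min lexx orbT.
have rhop i : rho i <= weight i by rewrite ler_piMr// gerBl.
have swapE (F : 'I_(ncomp H) -> R) : \sum_i weight i * F (J i) = \sum_j c j * F j.
  rewrite (partition_big J predT)//=; apply: eq_bigr => j _.
  by rewrite /c mulr_suml; apply: eq_bigr => i /eqP ->.
pose T := \sum_i rho i.
have TE : T = \sum_j sg j.
  rewrite /T /rho /sg sumrB q1.
  under eq_bigr do rewrite mulrBr mulr1.
  by rewrite sumrB p1 swapE.
have T0 : 0 <= T by apply: sumr_ge0.
(* Without excess mass [T / T] is 0 rather than 1, but then every [rho i] vanishes. *)
have rhoT i : rho i * (T / T) = rho i.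
  have [TT|TT] := eqVneq T 0; last by rewrite divff// mulr1.
  rewrite TT mul0r mulr0; apply/esym/eqP; rewrite eq_le rho0 andbT -TT.
  by rewrite /T (bigD1 i)//= lerDl sumr_ge0.
have sgT j : sg j * (T / T) = sg j.
  have [TT|TT] := eqVneq T 0; last by rewrite divff// mulr1.
  rewrite TT mul0r mulr0; apply/esym/eqP; rewrite eq_le sg0 andbT -TT TE.
  by rewrite (bigD1 j)//= lerDl sumr_ge0.
pose g i j : R := (J i == j)%:R * (weight i * s j) + rho i * sg j / T.
have sum1 i (F : 'I_(ncomp H) -> R) : \sum_j (J i == j)%:R * F j = F (J i).
  rewrite (bigD1 (J i))//= eqxx mul1r big1 ?addr0// => j ji.
  by rewrite eq_sym (negbTE ji) mul0r.
apply: le_trans (W2_sqr_le (g := g) i0 (J i0) _ _ _) _.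
- move=> i j; apply: addr_ge0; first by apply: mulr_ge0 => //; exact: mulr_ge0.
  by apply: divr_ge0 => //; exact: mulr_ge0.
- move=> i; rewrite /g big_split /= sum1.
  have -> : \sum_j rho i * sg j / T = rho i * (T / T).
    transitivity (rho i * ((\sum_j sg j) / T)); last by rewrite -TE.
    by rewrite mulr_suml mulr_sumr; apply: eq_bigr => j _; rewrite mulrA.
  by rewrite rhoT /rho; ring.
- move=> j; rewrite /g big_split /=.
  have -> : \sum_i (J i == j)%:R * (weight i * s j) = c j * s j.
    rewrite /c mulr_suml [RHS]big_mkcond; apply: eq_bigr => i _.
    by case: eqP => _; rewrite ?mul1r ?mul0r.
  have -> : \sum_i rho i * sg j / T = sg j * (T / T).
    transitivity ((\sum_i rho i) * (sg j / T)); last by rewrite -/T mulrCA.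
    by rewrite mulr_suml; apply: eq_bigr => i _; rewrite mulrA.
  by rewrite sgT /sg; ring.
pose dl i := sqdist (atom i) (atom (J i)).
have dl0 i : 0 <= dl i by exact: sqdist_ge0.
have TM : 2 * M * T <= 2 * M * \sum_j `|c j - weight j|.
  rewrite ler_wpM2l ?mulr_ge0// TE; apply: ler_sum => j _.
  by rewrite /sg cs distrC; have [//|cw] := lerP (c j) (weight j);
    rewrite subrr subr_ge0 ltW.
apply: le_trans (lerD (lexx _) TM).
(* Excess mass passes through its nearest atom, at squared cost at most [2 * dl i + 2 * M]; with the
   mass kept in place this gives the factor [1 + 2 = 3]. *)
apply: (@le_trans _ _ (\sum_i (weight i * dl i + (2 * (rho i * dl i) + 2 * M * rho i)))).
  apply: ler_sum => i _.
  have gE j : g i j * enorm (atom i - atom j) ^+ 2 <=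
      (J i == j)%:R * (weight i * dl i) + (2 * (rho i * dl i) + 2 * M * rho i) * (sg j / T).
    rewrite enorm_sqr /g mulrDl; apply: lerD.
      case: eqP => [<-|_]; last by rewrite !mul0r.
      rewrite !mul1r ler_wpM2r ?sqdist_ge0// ler_piMr//.
    rewrite [leLHS](_ : _ = rho i * (sg j / T) * sqdist (atom i) (atom j)); last by ring.
    rewrite [leRHS](_ : _ = rho i * (sg j / T) * (2 * dl i + 2 * M)); last by ring.
    apply: ler_wpM2l; first by apply: mulr_ge0 => //; exact: divr_ge0.
    apply: le_trans (sqdist_triangle _ (atom (J i)) _) _.
    by rewrite lerD2l ler_wpM2l.
  apply: le_trans (ler_sum _ (fun j _ => gE j)) _.
  rewrite big_split /= sum1 -mulr_sumr -mulr_suml -TE lerD2l.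
  rewrite [leLHS](_ : _ = (2 * dl i + 2 * M) * (rho i * (T / T))); last by ring.
  by rewrite rhoT; apply: eq_ler; ring.
rewrite big_split /= big_split /= -!mulr_sumr -/T addrA lerD2r.
have : \sum_i rho i * dl i <= \sum_i weight i * dl i.
  by apply: ler_sum => i _; rewrite ler_wpM2r.
lra.
Qed.

End transport_to_nearest.

(** * The lower bound on the Hellinger distance *)

Section hellinger_lower_bound.
Context {R : realType} {d : nat}.
Variable Sigma : 'M[R]_d.
Hypothesis Spd : symposdef Sigma.
Implicit Types (G H : mixing R d) (x t b : 'rV[R]_d).

Lemma sqdist_polyb (rad : R) b : (forall i, `|b ord0 i| <= rad) ->
  polyb 2 (d%:R * (1 + rad) ^+ 2) (fun t => sqdist t b).
Proof.
move=> br.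
have -> : d%:R * (1 + rad) ^+ 2 = \sum_(i < d) (1 + rad) ^+ 2.
  by rewrite sumr_const card_ord mulr_natl.
apply: polyb_sum => i.
have p1 : polyb 1 (1 + rad) (fun t : 'rV[R]_d => t ord0 i - b ord0 i).
  apply: polyb_le (polybB (polyb_coord i) (polyb_cst 1 (b ord0 i))) => //.
  by rewrite lerD2l.
exact: (polybM p1 p1).
Qed.

Lemma ip_polyb (rad : R) (e b : 'rV[R]_d) :
  (forall i, `|e ord0 i| <= 2 * (1 + rad)) -> (forall i, `|b ord0 i| <= rad) ->
  polyb 1 (2 * (d%:R * (1 + rad) ^+ 2)) (fun t => ip e (t - b)).
Proof.
move=> er br.
have -> : 2 * (d%:R * (1 + rad) ^+ 2) = \sum_(i < d) 2 * (1 + rad) ^+ 2.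
  by rewrite sumr_const card_ord -[RHS]mulr_natl mulrCA.
apply: polyb_sum => i.
have p1 : polyb 1 (1 + rad) (fun t : 'rV[R]_d => (t - b) ord0 i).
  apply: eq_polyb (polyb_le _ _ (polybB (polyb_coord i) (polyb_cst 1 (b ord0 i)))) => //.
    by move=> t; rewrite !mxE.
  by rewrite lerD2l.
have rad0 : 0 <= 1 + rad by rewrite addr_ge0// (le_trans _ (br i)).
apply: polyb_le (polybZ (e ord0 i) p1) => //.
by rewrite expr2 mulrA ler_wpM2r.
Qed.

Lemma atoms_poly_polyb (rad : R) m (a : 'I_m -> 'rV[R]_d) :
  (forall j i, `|a j ord0 i| <= rad) ->
  polyb (2 * m) ((d%:R * (1 + rad) ^+ 2) ^+ m) (atoms_poly a).
Proof.
move=> ar.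
have := polyb_prod (index_enum 'I_m) predT (fun j => sqdist_polyb (ar j)).
rewrite prodr_const count_predT (_ : size _ = m).
  by rewrite card_ord.
by rewrite /index_enum -enumT size_enum_ord.
Qed.

(** A second atom [l0] in the same box forces [1 <= 4 * (B / D ^+ 2)]. This absorbs the constant
    term of the affine factor and makes the bound homogeneous in [D]. *)
Lemma hermite_poly_polyb (rad D : R) m (a : 'I_m -> 'rV[R]_d) j l0 :
  0 < D -> (forall j l, j != l -> D ^+ 2 <= sqdist (a j) (a l)) ->
  (forall j i, `|a j ord0 i| <= rad) -> l0 != j ->
  polyb (2 * m) ((4 + 4 * m%:R) * (d%:R * (1 + rad) ^+ 2 / D ^+ 2) ^+ m)
    (hermite_poly a j).
Proof.
move=> D0 aD ar l0j; set B := d%:R * _.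
have D2 : 0 < D ^+ 2 by rewrite exprn_gt0.
have B0 : 0 <= B by rewrite mulr_ge0// sqr_ge0.
have BD0 : 0 <= B / D ^+ 2 by rewrite divr_ge0// ltW.
have inv l : `|(sqdist (a j) (a l))^-1| <= (D ^+ 2)^-1.
  have [<-|jl] := eqVneq j l.
    rewrite (_ : sqdist _ _ = 0) ?invr0 ?normr0 ?invr_ge0 ?ltW//.
    by rewrite /sqdist big1// => i _; rewrite subrr expr0n.
  have s0 := lt_le_trans D2 (aD _ _ jl).
  by rewrite ger0_norm ?invr_ge0 ?(ltW s0)// lef_pV2 ?posrE// aD.
have adiff l i : `|(a j - a l) ord0 i| <= 2 * (1 + rad).
  rewrite !mxE; apply: le_trans (ler_normB _ _) _.
  by have := ar j i; have := ar l i; lra.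
have p1 l : polyb 2 (B / D ^+ 2) (fun t => sqdist t (a l) / sqdist (a j) (a l)).
  apply: eq_polyb (polyb_le (leqnn 2) _
    (polybZ (sqdist (a j) (a l))^-1 (sqdist_polyb (ar l)))).
    by move=> t; rewrite mulrC.
  by rewrite mulrC; apply: ler_wpM2l => //; exact: inv.
have p2 l : polyb 1 (4 * (B / D ^+ 2))
    (fun t => 2 * ip (a j - a l) (t - a j) / sqdist (a j) (a l)).
  apply: eq_polyb (polyb_le (leqnn 1) _ (polybZ (sqdist (a j) (a l))^-1
    (polybZ 2 (ip_polyb (adiff l) (ar j))))).
    by move=> t; rewrite mulrC.
  rewrite -/B (ger0_norm (ler0n _ 2)) (_ : 4 * _ = (D ^+ 2)^-1 * (2 * (2 * B))).
    by apply: (ler_wpM2r _ (inv l)); apply: mulr_ge0 => //; exact: mulr_ge0.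
  by ring.
have p3 : polyb 1 (4 * m%:R * (B / D ^+ 2)) (fun t =>
    \sum_(l | l != j) 2 * ip (a j - a l) (t - a j) / sqdist (a j) (a l)).
  have -> : 4 * m%:R * (B / D ^+ 2) = \sum_(l < m) 4 * (B / D ^+ 2).
    by rewrite sumr_const card_ord -[RHS]mulr_natl; ring.
  apply: (@eq_polyb _ _ _ _ (fun t => \sum_l if l != j then
      2 * ip (a j - a l) (t - a j) / sqdist (a j) (a l) else 0)).
    by move=> t; rewrite [RHS]big_mkcond.
  apply: polyb_sum => l; case: (l != j) => //.
  by apply: polyb_le (polyb_cst 1 0) => //; rewrite normr0 mulr_ge0.
have BD1 : 1 <= 4 * (B / D ^+ 2).
  rewrite mulrA ler_pdivlMr// mul1r; rewrite eq_sym in l0j.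
  apply: le_trans (aD _ _ l0j) _.
  rewrite /B /sqdist mulrA (_ : 4 * d%:R * _ = \sum_(i < d) (2 * (1 + rad)) ^+ 2).
    apply: ler_sum => i _; have := adiff l0 i; rewrite !mxE => H.
    by rewrite -(real_normK (num_real (_ - _))) ler_pXn2r// ?nnegrE// (le_trans _ H).
  by rewrite sumr_const card_ord -[RHS]mulr_natl; ring.
have p4 := polybB (polyb_cst 1 1) p3.
have p5 := polyb_prod (index_enum 'I_m) (fun l => l != j) p1.
have cardm : count (fun l => l != j) (index_enum 'I_m) = m.-1.
  by have := cardC1 j; rewrite card_ord cardE size_filter.
have m1 : m.-1.+1 = m by rewrite prednK// (leq_ltn_trans _ (ltn_ord j)).
have := polybM p5 p4; apply: polyb_le.
  by rewrite cardm; move: m1; lia.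
rewrite big_const_seq cardm iter_mulr_1 normr1.
have -> : (B / D ^+ 2) ^+ m = (B / D ^+ 2) ^+ m.-1 * (B / D ^+ 2).
  by rewrite -exprSr m1.
rewrite [leRHS]mulrCA ler_wpM2l ?exprn_ge0//.
move: BD1; lra.
Qed.

Lemma sep_le G (j l : 'I_(ncomp G)) : j != l -> sep G <= enorm (atom j - atom l).
Proof.
move=> jl; apply: ge_inf; last by exists (j, l).
by exists 0 => _ [jl' _ <-]; exact: sqrtr_ge0.
Qed.

Lemma hellinger_W2_lower_bound (rad C0 : R) kstar :
  0 <= rad -> 0 <= C0 -> (2 <= kstar)%N -> exists2 C : R, 0 < C &
  forall G H, ballmix rad G -> ballmix rad H -> ncomp H = kstar -> 0 < sep H ->
    one_cluster C0 H ->
    C * sep H ^+ (2 * kstar - 2) * W2 G H ^+ 2 <=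
      hellinger (mixture_pdf Sigma G) (mixture_pdf Sigma H).
Proof.
move=> r0 C00 k2; have [A A0 HA] := moment_gap_le Spd (2 * kstar) r0.
pose B : R := d%:R * (1 + rad) ^+ 2.
have B0 : 0 <= B by rewrite mulr_ge0// sqr_ge0.
pose m := kstar.
(* Here [hermite_cst] accounts for replacing the indicator of a cell by the interpolation
   polynomial, and [4 + 4 * m] for the coefficients of that polynomial. *)
pose E := (@hermite_cst R m + 4 + 4 * m%:R) * B ^+ m * A : R.
have hc0 := @hermite_cst_ge0 R m.
have E0 : 0 <= E.
  rewrite /E mulr_ge0 ?(ltW A0)// mulr_ge0 ?exprn_ge0//.
  by rewrite addr_ge0 ?mulr_ge0// addr_ge0.
(* The first term is the cost inside the cells, the second that of moving the errors of the [m] cell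
   masses over the diameter. *)
pose C := 3 * (4 ^+ m.-1 * B ^+ m * A) + 2 * C0 ^+ 2 * m%:R * E.
have Cge0 : 0 <= C.
  rewrite /C addr_ge0//.
    by rewrite mulr_ge0// mulr_ge0 ?(ltW A0)// mulr_ge0// exprn_ge0.
  by rewrite mulr_ge0// mulr_ge0// mulr_ge0// sqr_ge0.
exists (1 + C)^-1; first by rewrite invr_gt0 ltr_pwDl.
move=> G H bG bH Hk D0 cl.
set eta := hellinger _ _; have eta0 : 0 <= eta by exact: sqrtr_ge0.
have {}HA n' C' g : (n' <= 2 * m)%N -> polyb n' C' g -> `|dint G H g| <= C' * (A * eta).
  move=> n'm pg; apply: polyb_linear_bound pg.
  - by rewrite mulr_ge0// ltW.
  - exact: dint_peval.
  - by move=> w wn; apply: HA => //; exact: leq_trans n'm.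
pose a (j : 'I_(ncomp H)) := atom j.
set D := sep H in D0 cl *.
have aD j l : j != l -> D ^+ 2 <= sqdist (a j) (a l).
  move=> jl; rewrite -enorm_sqr ler_pXn2r ?nnegrE ?(ltW D0) ?sqrtr_ge0//.
  exact: sep_le.
have ar j i : `|a j ord0 i| <= rad.
  by apply: le_trans (coord_le_enorm _ _) _; have [_ _] := bH; exact.
have [p0 p1 pr] := bG; have [q0 q1 qr] := bH.
have other (j : 'I_(ncomp H)) : exists l0, l0 != j.
  have h2 : (1 < ncomp H)%N by rewrite Hk.
  have h0 : (0 < ncomp H)%N by exact: ltn_trans h2.
  have [j0|j0] := eqVneq (j : nat) 0%N.
    by exists (Ordinal h2); rewrite -val_eqE /= j0.
  by exists (Ordinal h0); rewrite -val_eqE /= eq_sym.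
pose J (i : 'I_(ncomp G)) : 'I_(ncomp H) :=
  [arg min_(l < Ordinal (ltn_trans (ltn0Sn 0) (etrans (congr1 (leq 2) Hk) k2)))
     sqdist (atom i) (a l)]%O.
have JP i l : sqdist (atom i) (a (J i)) <= sqdist (atom i) (a l).
  by rewrite /J; case: Order.TotalTheory.arg_minP => // j _; apply.
have Pa l : atoms_poly a (a l) = 0.
  rewrite /atoms_poly (bigD1 l)//= (_ : sqdist _ _ = 0) ?mul0r//.
  by rewrite /sqdist big1// => i _; rewrite subrr expr0n.
have mP : mint G (atoms_poly a) <= B ^+ m * (A * eta).
  have -> : mint G (atoms_poly a) = dint G H (atoms_poly a).
    rewrite /dint [mint H _]big1 ?subr0// => j _.
    by rewrite Pa mulr0.
  apply: le_trans (ler_norm _) _; apply: (HA (2 * ncomp H)%N); first by rewrite Hk.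
  by rewrite /m -Hk; exact: atoms_poly_polyb.
have QE j l : hermite_poly a j (a l) = (l == j)%:R.
  have [->|lj] := eqVneq l j.
    rewrite /hermite_poly big1 ?mul1r ?big1 ?subr0//.
      move=> i _; rewrite subrr /ip big1 ?mulr0 ?mul0r// => ? _.
      by rewrite [X in _ * X]mxE mulr0.
    move=> i ij; rewrite divff// gt_eqF//.
    by apply: lt_le_trans (aD _ _ _); rewrite ?exprn_gt0// eq_sym.
  rewrite /hermite_poly (bigD1 l)//= (_ : sqdist (a l) (a l) = 0) ?mul0r//.
  by rewrite /sqdist big1// => i _; rewrite subrr expr0n.
have mQ j : `|mint G (hermite_poly a j) - weight j| <=
    (4 + 4 * m%:R) * (B / D ^+ 2) ^+ m * (A * eta).
  have -> : weight j = mint H (hermite_poly a j).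
    rewrite /mint (bigD1 j)//= QE eqxx mulr1 big1 ?addr0// => l lj.
    by rewrite QE (negbTE lj) mulr0.
  have [l0 l0j] := other j; apply: (HA (2 * ncomp H)%N); first by rewrite Hk.
  by rewrite /m -Hk; exact: hermite_poly_polyb D0 aD ar l0j.
have hcE : @hermite_cst R (ncomp H) = @hermite_cst R m by rewrite Hk.
have mE : (2 * m = 2 * ncomp H)%N by rewrite Hk.
have m1E : (ncomp H).-1 = m.-1 by rewrite Hk.
have D2m : 0 < D ^+ (2 * m) by rewrite exprn_gt0.
have mass j : `|\sum_(i | J i == j) weight i - weight j| <= E * eta / D ^+ (2 * m).
  have H1 : `|\sum_(i | J i == j) weight i - mint G (hermite_poly a j)| <=
      @hermite_cst R m * (mint G (atoms_poly a) / D ^+ (2 * m)).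
    rewrite big_mkcond /mint -sumrB; apply: le_trans (ler_norm_sum _ _ _) _.
    rewrite mulr_suml mulr_sumr; apply: ler_sum => i _.
    have -> : (if J i == j then weight i else 0) - weight i * hermite_poly a j (atom i)
       = - (weight i * (hermite_poly a j (atom i) - (j == J i)%:R)).
      by rewrite eq_sym; case: eqP => _ /=; ring.
    rewrite normrN normrM (ger0_norm (p0 i)).
    rewrite [leRHS](_ : _ = weight i *
      (@hermite_cst R m * (atoms_poly a (atom i) / D ^+ (2 * m)))); last by ring.
    rewrite ler_wpM2l//; have := hermite_poly_bound D0 aD (JP i) j.
    by rewrite hcE -mE.
  have -> : \sum_(i | J i == j) weight i - weight j =
    (\sum_(i | J i == j) weight i - mint G (hermite_poly a j)) +
    (mint G (hermite_poly a j) - weight j) by ring.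
  apply: le_trans (ler_normD _ _) _; apply: le_trans (lerD H1 (mQ j)) _.
  apply: (@le_trans _ _ (@hermite_cst R m * (B ^+ m * (A * eta) / D ^+ (2 * m)) +
      (4 + 4 * m%:R) * (B / D ^+ 2) ^+ m * (A * eta))).
    by rewrite lerD2r ler_wpM2l// ler_wpM2r// invr_ge0 ltW.
  rewrite expr_div_n -exprM; apply: eq_ler; rewrite /E; field.
  by rewrite gt_eqF.
have HM j l : sqdist (a j) (a l) <= (C0 * D) ^+ 2.
  have CD0 : 0 <= C0 * D by apply: mulr_ge0 => //; exact: ltW.
  by rewrite -enorm_sqr ler_pXn2r ?nnegrE ?sqrtr_ge0//; exact: cl.
have := W2_sqr_le_nearest J bG bH (sqr_ge0 _) HM.
have S1 : \sum_i weight i * sqdist (atom i) (atom (J i)) <=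
    4 ^+ m.-1 * (B ^+ m * (A * eta)) / (D ^+ 2) ^+ m.-1.
  apply: (@le_trans _ _ (4 ^+ m.-1 * mint G (atoms_poly a) / (D ^+ 2) ^+ m.-1)).
    rewrite /mint mulr_sumr mulr_suml; apply: ler_sum => i _.
    rewrite [leRHS](_ : _ = weight i *
      (4 ^+ m.-1 * atoms_poly a (atom i) / (D ^+ 2) ^+ m.-1)); last by ring.
    rewrite ler_wpM2l// ler_pdivlMr ?exprn_gt0//.
    have := atoms_poly_ge D0 aD (JP i); rewrite m1E expr_div_n.
    by rewrite [in X in X -> _]mulrA ler_pdivrMr ?exprn_gt0// (mulrC (4 ^+ _)).
  rewrite ler_wpM2r ?invr_ge0 ?exprn_ge0 ?(ltW D0)// ler_wpM2l// exprn_ge0//.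
have S2 : \sum_j `|\sum_(i | J i == j) weight i - weight j| <=
    m%:R * (E * eta / D ^+ (2 * m)).
  apply: le_trans (ler_sum _ (fun j _ => mass j)) _.
  by rewrite sumr_const card_ord Hk mulr_natl.
move=> W.
have m1 : m = m.-1.+1 by rewrite prednK// (leq_trans _ k2).
have W' : W2 G H ^+ 2 <= C * eta / (D ^+ 2) ^+ m.-1.
  apply: le_trans W _; apply: le_trans (lerD (ler_wpM2l _ S1) (ler_wpM2l _ S2)) _ => //.
    by rewrite mulr_ge0// sqr_ge0.
  have -> : D ^+ (2 * m) = D ^+ 2 * (D ^+ 2) ^+ m.-1 by rewrite exprM {1}m1 exprS.
  have DN : (D ^+ 2) ^+ m.-1 != 0 by rewrite !expf_neq0// gt_eqF.
  apply: eq_ler; rewrite /C exprMn; move: ((D ^+ 2) ^+ m.-1) DN => v v0.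
  generalize (4 ^+ m.-1 : R) (B ^+ m) E (m%:R : R) => u1 u2 u3 u4; field.
  by rewrite v0 gt_eqF.
have -> : (2 * kstar - 2)%N = (2 * m.-1)%N.
  by rewrite -[X in (_ - X)%N](muln1 2) -mulnBr subn1.
rewrite exprM -mulrA ler_pdivrMl; last by rewrite ltr_pwDl.
apply: (@le_trans _ _ (C * eta)).
  by rewrite mulrC -ler_pdivlMr// ?exprn_gt0.
by rewrite ler_wpM2r// lerDr.
Qed.

End hellinger_lower_bound.

(** * Normalized scores *)

Section newton_recursion.
Context {R : realType}.
Implicit Types (u : nat -> nat -> R) (s : nat -> R) (S A e : R).

(* [u a j] stands for a functional applied to [l ^+ j] times the Newton product
   of the first [a] nodes [s]. *)
Lemma newton_bound u s S A : 0 <= S ->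
  (forall a j, u a j.+1 = s a * u a j + u a.+1 j) -> (forall a, `|s a| <= S) ->
  (forall a, `|u a 0%N| <= A * S ^+ a) ->
  forall j a, `|u a j| <= A * (2 * S) ^+ j * S ^+ a.
Proof.
move=> S0 ur sS u0; elim=> [|j IH] a; first by rewrite expr0 mulr1.
rewrite ur; apply: le_trans (ler_normD _ _) _; rewrite normrM.
apply: le_trans (lerD (ler_pM _ _ (sS a) (IH a)) (IH a.+1)) _ => //.
by apply: eq_ler; rewrite !exprS; ring.
Qed.

(** The differences obey the same recursion with a source term of growth [2 * S]; bounding it by the
    growth [3 * S] gives three equal terms at each step. *)
Lemma newton_lip u u' s s' S A e : 0 <= S -> 0 <= A -> 0 <= e ->
  (forall a j, u a j.+1 = s a * u a j + u a.+1 j) ->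
  (forall a j, u' a j.+1 = s' a * u' a j + u' a.+1 j) ->
  (forall a, `|s a| <= S) -> (forall a, `|s' a| <= S) ->
  (forall a, `|s a - s' a| <= e * S) ->
  (forall a, `|u' a 0%N| <= A * S ^+ a) ->
  (forall a, `|u a 0%N - u' a 0%N| <= A * e * S ^+ a) ->
  forall j a, `|u a j - u' a j| <= A * e * (3 * S) ^+ j * S ^+ a.
Proof.
move=> S0 A0 e0 ur u'r sS s'S ss' u'0 uu'; elim=> [|j IH] a.
  by rewrite expr0 mulr1.
have -> : u a j.+1 - u' a j.+1 =
    s a * (u a j - u' a j) + ((s a - s' a) * u' a j + (u a.+1 j - u' a.+1 j)).
  by rewrite ur u'r; ring.
apply: le_trans (ler_normD _ _) _; apply: le_trans (lerD (lexx _) (ler_normD _ _)) _.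
rewrite !normrM.
have B2 := newton_bound S0 u'r s'S u'0 j a.
have B1 := ler_pM (normr_ge0 _) (normr_ge0 _) (sS a) (IH a).
have B3 := ler_pM (normr_ge0 _) (normr_ge0 _) (ss' a) B2.
apply: le_trans (lerD B1 (lerD B3 (IH a.+1))) _.
have p23 : A * e * ((2 * S) ^+ j * (S * S ^+ a)) <= A * e * ((3 * S) ^+ j * (S * S ^+ a)).
  rewrite ler_wpM2l ?mulr_ge0// ler_wpM2r ?mulr_ge0 ?exprn_ge0//.
  by rewrite lerXn2r ?nnegrE ?mulr_ge0// ler_wpM2r// ler_nat.
rewrite !exprS.
have -> : e * S * (A * (2 * S) ^+ j * S ^+ a) = A * e * ((2 * S) ^+ j * (S * S ^+ a)).
  by ring.
apply: le_trans (lerD (lexx _) (lerD p23 (lexx _))) _.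
by apply: eq_ler; ring.
Qed.

End newton_recursion.

Section finite_functionals.
Context {R : realType} {d : nat}.
Implicit Types (L : ('rV[R]_d -> R) -> R) (g l : 'rV[R]_d -> R).

(** Finite combinations of evaluations: such functionals are linear and commute with pointwise
    limits, hence with the exponential series. *)
Definition finrep L := exists r : seq (R * 'rV[R]_d),
  forall g, L g = \sum_(p <- r) p.1 * g p.2.

Lemma finrepD L g h : finrep L -> L (fun t => g t + h t) = L g + L h.
Proof.
move=> [r Lr]; rewrite !Lr -big_split; apply: eq_bigr => p _.
by rewrite mulrDr.
Qed.

Lemma finrepZ L c g : finrep L -> L (fun t => c * g t) = c * L g.
Proof. by move=> [r Lr]; rewrite !Lr mulr_sumr; apply: eq_bigr => p _; rewrite mulrCA. Qed.

Lemma finrep_peval L p : finrep L ->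
  L (peval p) = \sum_(m <- p) m.1 * L (wordv m.2).
Proof.
move=> [r Lr]; rewrite Lr /peval; under eq_bigr do rewrite mulr_sumr.
rewrite exchange_big /=; apply: eq_bigr => m _; rewrite Lr mulr_sumr.
by apply: eq_bigr => q _; rewrite mulrCA.
Qed.

Lemma finrep_mint G : finrep (mint G).
Proof.
exists [seq (weight i, atom i) | i <- enum 'I_(ncomp G)] => g.
by rewrite big_map big_enum.
Qed.

Lemma finrep_scale c L : finrep L -> finrep (fun g => c * L g).
Proof.
move=> [r Lr]; exists [seq (c * p.1, p.2) | p <- r] => g.
by rewrite Lr big_map mulr_sumr; apply: eq_bigr => p _; rewrite mulrA.
Qed.

Lemma finrep_sub L L' : finrep L -> finrep L' -> finrep (fun g => L g - L' g).
Proof.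
move=> [r Lr] [r' Lr']; exists (r ++ [seq (- p.1, p.2) | p <- r']) => g.
rewrite Lr Lr' big_cat big_map /=; congr (_ + _).
by rewrite -sumrN; apply: eq_bigr => p _; rewrite mulNr.
Qed.

(** The series is summed term by term. The bound sees the functional only through its values on
    powers, not through the size of its coefficients. *)
Lemma finrep_expR L l (M C : R) : finrep L ->
  (forall j, `|L (fun t => l t ^+ j)| <= M * C ^+ j) ->
  `|L (fun t => expR (l t))| <= M * expR C.
Proof.
move=> fL LM.
have cL : (fun n => L (fun t => series (exp_coeff (l t)) n)) @ \oo -->
    L (fun t => expR (l t)).
  have [r Lr] := fL; rewrite Lr.
  rewrite (_ : (fun n => _) = fun n =>
      \sum_(p <- r) p.1 * series (exp_coeff (l p.2)) n); last first.
    by apply/funext => n; rewrite Lr.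
  have : (fun n => \sum_(p <- r) p.1 * series (exp_coeff (l p.2)) n) @ \oo -->
      \sum_(p <- r) p.1 * expR (l p.2).
    elim: r {Lr} => [|p r IH].
      rewrite big_nil (_ : (fun n => _) = cst 0); first exact: cvg_cst.
      by apply/funext => n; rewrite big_nil.
    rewrite big_cons (_ : (fun n => _) = (fun n =>
        p.1 * series (exp_coeff (l p.2)) n) \+ (fun n =>
        \sum_(p <- r) p.1 * series (exp_coeff (l p.2)) n)); last first.
      by apply/funext => n; rewrite big_cons.
    by apply: cvgD IH; apply: cvgMr; exact: is_cvg_series_exp_coeff.
  by [].
have cM : (fun n => M * series (exp_coeff C) n) @ \oo --> M * expR C.
  by apply: cvgMr; exact: is_cvg_series_exp_coeff.
apply: (ler_cvg_to (cvg_norm cL) cM); apply: nearW => n.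
have -> : L (fun t => series (exp_coeff (l t)) n) =
    \sum_(0 <= j < n) (j`!%:R)^-1 * L (fun t => l t ^+ j).
  rewrite /series /exp_coeff /=; elim: n => [|n IH].
    rewrite big_nil -[RHS](mul0r (L (cst 0))) -(finrepZ _ _ fL); congr L.
    by apply/funext => t; rewrite big_nil mul0r.
  rewrite big_nat_recr//= -IH -(finrepZ _ _ fL) -(finrepD _ _ fL); congr L.
  by apply/funext => t; rewrite big_nat_recr//= [in RHS]mulrC.
rewrite /series /exp_coeff /= mulr_sumr; apply: le_trans (ler_norm_sum _ _ _) _.
apply: ler_sum => j _; rewrite normrM ger0_norm ?invr_ge0//.
by rewrite mulrA [leRHS]mulrC ler_wpM2l ?invr_ge0.
Qed.

End finite_functionals.

(** * Dependence of the scores on finitely many parameters *)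

Section normalized_scores.
Context {R : realType} {d : nat}.
Variable Sigma : 'M[R]_d.
Hypothesis Spd : symposdef Sigma.
Variables (rad : R) (k kstar : nat).
Hypothesis rad0 : 0 <= rad.
Implicit Types (G H : mixing R d) (x t : 'rV[R]_d).

Local Notation llr := (llr Sigma).
Local Notation mratio := (mratio Sigma).
Local Notation hell G H :=
  (hellinger (mixture_pdf Sigma G) (mixture_pdf Sigma H)).

(** Padding by 0 gives all mixtures with at most [k] atoms the same number of nodes, so that their
    parameters live in one space. *)
Definition atom_nth G (b : nat) : 'rV[R]_d := oapp (@atom _ _ G) 0 (insub b).

(* The first [k] nodes carry the atoms of [G], the next ones those of [H]. *)
Definition node G H (b : nat) : 'rV[R]_d :=
  if (b < k)%N then atom_nth G b else atom_nth H (b - k).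

Definition ngap G H (g : 'rV[R]_d -> R) : R := (hell G H)^-1 * dint G H g.

Definition hscore G H x : R :=
  (Num.sqrt (mratio G x / mratio H x) - 1) / hell G H.

(** By the Newton expansion these finitely many numbers control the score at every [x]. Words of
    length [2 * (k + kstar)] suffice since each of the [k + kstar] Newton factors is quadratic in
    the location. *)
Definition close_params (e : R) G G' H := [/\
  forall b i, `|node G H b ord0 i - node G' H b ord0 i| <= e,
  forall w : seq 'I_d, (size w <= 2 * (k + kstar))%N ->
    `|ngap G H (wordv w) - ngap G' H (wordv w)| <= e &
  `|hell G H - hell G' H| <= e].

(** Makes [S x] at least 1 and at least four times the bound of [llr x] over the ball. *)
Definition growthc : R := 1 + 4 * llrc Sigma rad.

Let S x : R := growthc * (1 + l1norm x).

Let S1 x : 1 <= S x.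
Proof.
have c0 := llrc_ge0 Sigma rad; have l0 := l1norm_ge0 x.
rewrite /S /growthc; nra.
Qed.

Let S0 x : 0 <= S x. Proof. exact: le_trans (S1 x). Qed.

Let llrcS x : 4 * (llrc Sigma rad * (1 + l1norm x)) <= S x.
Proof.
have c0 := llrc_ge0 Sigma rad; have l0 := l1norm_ge0 x.
rewrite /S (_ : growthc * _ = (1 + l1norm x) +
  4 * (llrc Sigma rad * (1 + l1norm x))); last by rewrite /growthc; ring.
by rewrite lerDr addr_ge0.
Qed.

Let invmxS x : invmx_l1 Sigma * (1 + l1norm x) <= llrc Sigma rad * (1 + l1norm x).
Proof.
have l0 := l1norm_ge0 x.
rewrite ler_wpM2r ?addr_ge0// /llrc ler_peMr ?invmx_l1_ge0// expr_ge1// ?lerDl//.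
by rewrite addr_ge0.
Qed.

Let invmx_ge0 x : 0 <= invmx_l1 Sigma * (1 + l1norm x).
Proof. by rewrite mulr_ge0 ?invmx_l1_ge0// addr_ge0// l1norm_ge0. Qed.

Lemma atom_nth_bound G b : ballmix rad G -> enorm (atom_nth G b) <= rad.
Proof.
move=> [_ _ Gr]; rewrite /atom_nth; case: insubP => [i _ _|_] /=; first exact: Gr.
rewrite /enorm big1 ?sqrtr0// => i _; by rewrite mxE expr0n.
Qed.

Lemma node_bound G H b : ballmix rad G -> ballmix rad H -> enorm (node G H b) <= rad.
Proof. by move=> bG bH; rewrite /node; case: ifP => _; exact: atom_nth_bound. Qed.

(** The Newton basis in the scalar variable [llr x t]. The recursion below never divides by a
    difference of nodes, so atoms may merge. *)
Let newton_prod G H x a t : R := \prod_(b < a) (llr x t - llr x (node G H b)).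

Let newton_prod_recr G H x a t : newton_prod G H x a.+1 t =
  newton_prod G H x a t * (llr x t - llr x (node G H a)).
Proof. by rewrite /newton_prod big_ord_recr. Qed.

Let node_llr G H b x : ballmix rad G -> ballmix rad H ->
  `|llr x (node G H b)| <= llrc Sigma rad * (1 + l1norm x).
Proof. by move=> bG bH; apply: llr_bound => //; exact: node_bound. Qed.

Let factor_polyb G H b x : ballmix rad G -> ballmix rad H ->
  polyb 2 (S x) (fun t => llr x t - llr x (node G H b)).
Proof.
move=> bG bH.
apply: polyb_le (polybB (llr_polyb _ x) (polyb_cst 2 (llr x (node G H b)))) => //.
have := node_llr b x bG bH; have := invmxS x; have := llrcS x; have := invmx_ge0 x.
by move: (llr x _) (S x) => a s; lra.
Qed.

Let newton_prod_polyb G H a x : ballmix rad G -> ballmix rad H ->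
  polyb (2 * a) (S x ^+ a) (newton_prod G H x a).
Proof.
move=> bG bH; elim: a => [|a IH].
  rewrite expr0 -[X in polyb _ X](normr1 R); apply: eq_polyb (polyb_cst _ 1) => t.
  by rewrite /newton_prod big_ord0.
rewrite mulnS addnC exprSr; apply: eq_polyb (polybM IH (factor_polyb a x bG bH)).
by move=> t; rewrite newton_prod_recr.
Qed.

Let node_llr_lip e G G' H b x : ballmix rad G -> ballmix rad G' -> ballmix rad H ->
  0 <= e -> (forall b i, `|node G H b ord0 i - node G' H b ord0 i| <= e) ->
  `|llr x (node G H b) - llr x (node G' H b)| <= e * S x.
Proof.
move=> bG bG' bH e0 GG'.
have r1 : 1 <= 1 + rad by rewrite lerDl.
have crd K t : ballmix rad K -> t = node K H b -> forall i, `|t ord0 i| <= 1 + rad.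
  move=> bK -> i; apply: le_trans (coord_le_enorm _ _) _.
  by apply: le_trans (node_bound b bK bH) _; rewrite lerDr.
apply: le_trans (polyb_lip r1 e0 (crd _ _ bG erefl) (crd _ _ bG' erefl) (GG' b)
  (llr_polyb Sigma x)) _ => //.
rewrite mulrC ler_wpM2l//.
have -> : invmx_l1 Sigma * (1 + l1norm x) * (2 * (1 + rad) ^+ 2) =
    2 * (llrc Sigma rad * (1 + l1norm x)) by rewrite /llrc; ring.
have := llrcS x; have : 0 <= llrc Sigma rad * (1 + l1norm x).
  by apply: le_trans (invmxS x); exact: invmx_ge0.
by move: (S x) => s; lra.
Qed.

Let newton_prod_diff e G G' H a x : ballmix rad G -> ballmix rad G' -> ballmix rad H ->
  0 <= e -> (forall b i, `|node G H b ord0 i - node G' H b ord0 i| <= e) ->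
  polyb (2 * a) (a%:R * e * S x ^+ a)
    (fun t => newton_prod G H x a t - newton_prod G' H x a t).
Proof.
move=> bG bG' bH e0 GG'; elim: a => [|a IH].
  rewrite !mul0r -[X in polyb _ X](normr0 R); apply: eq_polyb (polyb_cst _ 0) => t.
  by rewrite /newton_prod !big_ord0 subrr.
rewrite mulnS addnC.
have p1 := polybM IH (factor_polyb a x bG bH).
have p2 := polybM (newton_prod_polyb a x bG' bH)
  (polyb_cst 2 (llr x (node G' H a) - llr x (node G H a))).
apply: eq_polyb (polyb_le (leqnn _) _ (polybD p1 p2)).
  by move=> t; rewrite !newton_prod_recr /=; ring.
have h := node_llr_lip a x bG' bG bH e0 _.
have {}h : `|llr x (node G' H a) - llr x (node G H a)| <= e * S x.
  by apply: h => b i; rewrite distrC.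
apply: (@le_trans _ _ (a%:R * e * S x ^+ a * S x + S x ^+ a * (e * S x))).
  by rewrite lerD2l ler_wpM2l// exprn_ge0.
by apply: eq_ler; rewrite -natr1 exprS; ring.
Qed.

(** Every atom of [G] and of [H] is a node, so the Newton expansion stops after [k + kstar]
    terms. *)
Let newton_prod_vanish G H a x : ballmix rad G -> ballmix rad H ->
  (ncomp G <= k)%N -> ncomp H = kstar -> (k + kstar <= a)%N ->
  forall g, dint G H (fun t => g t * newton_prod G H x a t) = 0.
Proof.
move=> bG bH Gk Hk am g.
have van t b : (b < a)%N -> t = node G H b -> newton_prod G H x a t = 0.
  by move=> ba ->; rewrite /newton_prod (bigD1 (Ordinal ba))//= subrr mul0r.
rewrite /dint /mint big1 ?big1 ?subr0//= => i _.
- rewrite (van _ (k + i)%N) ?mulr0//.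
    by apply: leq_trans am; rewrite ltn_add2l -Hk.
  by rewrite /node ltnNge leq_addr/= addKn /atom_nth valK.
- have ik : (i < k)%N by exact: leq_trans (ltn_ord i) Gk.
  rewrite (van _ i) ?mulr0//; first by rewrite (leq_trans ik)// (leq_trans _ am)// leq_addr.
  by rewrite /node ik /atom_nth valK.
Qed.

Let newton_value G H x a j : R :=
  ngap G H (fun t => llr x t ^+ j * newton_prod G H x a t).

Let finrep_ngap G H : finrep (ngap G H).
Proof. by apply: finrep_scale; apply: finrep_sub; exact: finrep_mint. Qed.

Let newton_value_rec G H x a j : newton_value G H x a j.+1 =
  llr x (node G H a) * newton_value G H x a j + newton_value G H x a.+1 j.
Proof.
rewrite /newton_value -(finrepZ _ _ (finrep_ngap G H)) -(finrepD _ _ (finrep_ngap G H)).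
by congr (ngap G H); apply/funext => t; rewrite newton_prod_recr exprS; ring.
Qed.

Variable A : R.
Hypothesis A0 : 0 < A.
Hypothesis HA : forall G H, ballmix rad G -> ballmix rad H ->
  forall w : seq 'I_d, (size w <= 2 * (k + kstar))%N ->
    `|dint G H (wordv w)| <= A * hell G H.

Lemma ngap_word_bound G H (w : seq 'I_d) : ballmix rad G -> ballmix rad H ->
  0 < hell G H -> (size w <= 2 * (k + kstar))%N -> `|ngap G H (wordv w)| <= A.
Proof.
move=> bG bH h0 wn; rewrite /ngap normrM gtr0_norm ?invr_gt0//.
by rewrite mulrC ler_pdivrMr//; exact: HA.
Qed.

Definition admissible G H := [/\ ballmix rad G, (ncomp G <= k)%N & 0 < hell G H].

(** Either the Newton product already vanishes at all atoms, or its degree [2 * a] is within the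
    range of the moment hypothesis [HA]. *)
Let newton_value0 G H x a : admissible G H -> ballmix rad H -> ncomp H = kstar ->
  `|newton_value G H x a 0%N| <= A * S x ^+ a.
Proof.
move=> [bG Gk h0] bH Hk.
have [am|ma] := leqP (k + kstar) a.
  rewrite /newton_value /ngap newton_prod_vanish// mulr0 normr0.
  by rewrite mulr_ge0 ?exprn_ge0// ltW.
rewrite mulrC /newton_value (_ : (fun t => _) = newton_prod G H x a); last first.
  by apply/funext => t; rewrite expr0 mul1r.
apply: polyb_linear_bound (newton_prod_polyb a x bG bH) => //.
- exact: ltW.
- by move=> p; exact: finrep_peval.
- move=> w wa; apply: ngap_word_bound => //; apply: leq_trans wa _.
  by rewrite leq_mul2l ltnW.
Qed.

Let newton_value_bound G H x a j : admissible G H -> ballmix rad H -> ncomp H = kstar ->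
  `|newton_value G H x a j| <= A * (2 * S x) ^+ j * S x ^+ a.
Proof.
move=> aG bH Hk; have [bG _ _] := aG.
apply: (newton_bound (s := fun a => llr x (node G H a))).
- exact: S0.
- by move=> a' j'; exact: newton_value_rec.
- move=> a'; apply: le_trans (node_llr a' x bG bH) _.
  have := llrcS x; have := le_trans (invmx_ge0 x) (invmxS x); lra.
- by move=> a'; exact: newton_value0.
Qed.

(** The summand 1 stands for the change of the normalized moments, and [a * A] with [a < k + kstar]
    for that of the nodes; one more [A] makes [lipc] dominate [A]. *)
Definition lipc : R := 1 + (k + kstar).+1%:R * A.

Let lipc_ge : A <= lipc.
Proof.
by rewrite /lipc -natr1 mulrDl mul1r addrA lerDr addr_ge0// mulr_ge0// ltW.
Qed.

Let newton_value_diff0 e G G' H x a : admissible G H -> admissible G' H ->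
  ballmix rad H -> ncomp H = kstar -> 0 <= e -> close_params e G G' H ->
  `|newton_value G H x a 0%N - newton_value G' H x a 0%N| <= lipc * e * S x ^+ a.
Proof.
move=> [bG Gk h0] [bG' G'k h0'] bH Hk e0 [cN cW cH].
have L0 : 0 <= lipc by apply: le_trans lipc_ge; exact: ltW.
have [am|ma] := leqP (k + kstar) a.
  rewrite /newton_value /ngap !newton_prod_vanish// !mulr0 subrr normr0.
  by rewrite !mulr_ge0 ?exprn_ge0.
have E K : newton_value K H x a 0%N = ngap K H (newton_prod K H x a).
  by congr (ngap K H); apply/funext => t; rewrite expr0 mul1r.
have fK K : finrep (ngap K H) by exact: finrep_ngap.
have szw (w : seq 'I_d) : (size w <= 2 * a)%N -> (size w <= 2 * (k + kstar))%N.
  by move=> wa; apply: leq_trans wa _; rewrite leq_mul2l ltnW.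
have H1 : `|ngap G H (newton_prod G H x a) - ngap G' H (newton_prod G H x a)|
    <= S x ^+ a * e.
  apply: (polyb_linear_bound (L := fun g => ngap G H g - ngap G' H g) e0 _ _
    (newton_prod_polyb a x bG bH)).
  - by move=> p; exact: (finrep_peval p (finrep_sub (fK G) (fK G'))).
  - by move=> w /szw; exact: cW.
have H2 : `|ngap G' H (fun t => newton_prod G H x a t - newton_prod G' H x a t)|
    <= (a%:R * e * S x ^+ a) * A.
  apply: polyb_linear_bound (newton_prod_diff a x bG bG' bH e0 cN) => //.
  - exact: ltW.
  - by move=> p; exact: finrep_peval.
  - by move=> w /szw; exact: ngap_word_bound.
have E2 : ngap G' H (fun t => newton_prod G H x a t - newton_prod G' H x a t) =
    ngap G' H (newton_prod G H x a) - ngap G' H (newton_prod G' H x a).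
  have [r Lr] := fK G'; rewrite !Lr -sumrB; apply: eq_bigr => p _.
  by rewrite mulrBr.
rewrite !E (_ : _ - _ =
  (ngap G H (newton_prod G H x a) - ngap G' H (newton_prod G H x a)) +
  (ngap G' H (newton_prod G H x a) - ngap G' H (newton_prod G' H x a))); last by ring.
rewrite -E2; apply: le_trans (ler_normD _ _) _; apply: le_trans (lerD H1 H2) _.
rewrite [leLHS](_ : _ = (1 + a%:R * A) * e * S x ^+ a); last by ring.
rewrite ler_wpM2r ?exprn_ge0// ler_wpM2r// lerD2l ler_wpM2r ?(ltW A0)// ler_nat.
exact: leq_trans (ltnW ma) (leqnSn _).
Qed.

Let newton_value_lip e G G' H x a j : admissible G H -> admissible G' H ->
  ballmix rad H -> ncomp H = kstar -> 0 <= e -> close_params e G G' H ->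
  `|newton_value G H x a j - newton_value G' H x a j|
    <= lipc * e * (3 * S x) ^+ j * S x ^+ a.
Proof.
move=> aG aG' bH Hk e0 cGG'.
have [bG _ _] := aG; have [bG' _ _] := aG'; have [cN _ _] := cGG'.
have L0 : 0 <= lipc by apply: le_trans lipc_ge; exact: ltW.
have nS K b : ballmix rad K -> `|llr x (node K H b)| <= S x.
  move=> bK; apply: le_trans (node_llr b x bK bH) _.
  have := llrcS x; have := le_trans (invmx_ge0 x) (invmxS x); lra.
apply: (newton_lip (s := fun a => llr x (node G H a))
    (s' := fun a => llr x (node G' H a))).
- exact: S0.
- exact: L0.
- exact: e0.
- by move=> a' j'; exact: newton_value_rec.
- by move=> a' j'; exact: newton_value_rec.
- by move=> a'; exact: nS.
- by move=> a'; exact: nS.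
- by move=> a'; exact: node_llr_lip.
- move=> a'; apply: le_trans (newton_value0 x a' aG' bH Hk) _.
  by rewrite ler_wpM2r// exprn_ge0.
- by move=> a'; exact: newton_value_diff0.
Qed.

Let score G H x : R := ngap G H (fun t => expR (llr x t)).

Let scoreE G H x : score G H x = (mratio G x - mratio H x) / hell G H.
Proof. by rewrite /score /ngap mulrC. Qed.

(** At [a = 0] the Newton product is empty, so [newton_value_bound] concerns the plain powers of
    [llr x], as [finrep_expR] expects. *)
Let score_bound G H x : admissible G H -> ballmix rad H -> ncomp H = kstar ->
  `|score G H x| <= A * expR (2 * S x).
Proof.
move=> aG bH Hk; apply: finrep_expR; first exact: finrep_ngap.
move=> j; have := newton_value_bound x 0 j aG bH Hk.
rewrite expr0 mulr1 /newton_value; congr (`|ngap G H _| <= _).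
by apply/funext => t; rewrite /newton_prod big_ord0 mulr1.
Qed.

Let score_lip e G G' H x : admissible G H -> admissible G' H ->
  ballmix rad H -> ncomp H = kstar -> 0 <= e -> close_params e G G' H ->
  `|score G H x - score G' H x| <= lipc * e * expR (3 * S x).
Proof.
move=> aG aG' bH Hk e0 c.
apply: (finrep_expR (L := fun g => ngap G H g - ngap G' H g)).
  by apply: finrep_sub; exact: finrep_ngap.
move=> j; have := newton_value_lip x 0 j aG aG' bH Hk e0 c.
rewrite expr0 mulr1 /newton_value.
have E K : (fun t => llr x t ^+ j * newton_prod K H x 0 t) = (fun t => llr x t ^+ j).
  by apply/funext => t; rewrite /newton_prod big_ord0 mulr1.
by rewrite !E.
Qed.

Let rscore G H x : R := score G H x / mratio H x.

Let mratioV_le H x : ballmix rad H -> (mratio H x)^-1 <= expR (S x).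
Proof.
move=> bH; have r0 := mratio_gt0 Sigma x rad0 bH.
rewrite -[leRHS]invrK lef_pV2 ?posrE ?invr_gt0 ?expR_gt0//.
rewrite -expRN; apply: le_trans (mratio_ge Sigma x rad0 bH).
rewrite ler_expR lerN2; apply: le_trans (llrcS x).
have := le_trans (invmx_ge0 x) (invmxS x); lra.
Qed.

Let rscore_bound G H x : admissible G H -> ballmix rad H -> ncomp H = kstar ->
  `|rscore G H x| <= A * expR (3 * S x).
Proof.
move=> aG bH Hk; have r0 := mratio_gt0 Sigma x rad0 bH.
rewrite /rscore normrM (@ger0_norm _ (mratio H x)^-1) ?invr_ge0 ?(ltW r0)//.
apply: le_trans (ler_pM _ _ (score_bound x aG bH Hk) (mratioV_le x bH)) _ => //.
  by rewrite invr_ge0 ltW.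
by rewrite -[leLHS]mulrA -expRD; apply: eq_ler; congr (_ * expR _); ring.
Qed.

Let rscore_lip e G G' H x : admissible G H -> admissible G' H ->
  ballmix rad H -> ncomp H = kstar -> 0 <= e -> close_params e G G' H ->
  `|rscore G H x - rscore G' H x| <= lipc * e * expR (4 * S x).
Proof.
move=> aG aG' bH Hk e0 c; have r0 := mratio_gt0 Sigma x rad0 bH.
rewrite /rscore -mulrBl normrM (@ger0_norm _ (mratio H x)^-1) ?invr_ge0 ?(ltW r0)//.
apply: le_trans (ler_pM _ _ (score_lip x aG aG' bH Hk e0 c) (mratioV_le x bH)) _ => //.
  by rewrite invr_ge0 ltW.
by rewrite -[leLHS]mulrA -expRD; apply: eq_ler; congr (_ * expR _); ring.
Qed.

Let root G H x : R := Num.sqrt (mratio G x / mratio H x).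

Let root_sqr G H x : admissible G H -> ballmix rad H ->
  root G H x ^+ 2 = 1 + hell G H * rscore G H x.
Proof.
move=> [bG _ h0] bH.
have rG := mratio_gt0 Sigma x rad0 bG; have rH := mratio_gt0 Sigma x rad0 bH.
rewrite /root sqr_sqrtr ?divr_ge0 ?ltW// /rscore scoreE.
by move: (hell G H) h0 (mratio G x) (mratio H x) rH => h h0 p q q0;
  field; rewrite !gt_eqF.
Qed.

(** Rationalizing the difference of the square root and 1 moves the division by the Hellinger
    distance into [rscore], which stays bounded. *)
Let hscoreE G H x : admissible G H -> ballmix rad H ->
  hscore G H x = rscore G H x / (1 + root G H x).
Proof.
move=> aG bH; have := root_sqr x aG bH; have [_ _ h0] := aG.
have w0 : 0 <= root G H x by exact: sqrtr_ge0.
rewrite /hscore -/(root G H x).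
move: (root G H x) w0 (hell G H) h0 (rscore G H x) => w w0 h h0 s E.
have w1 : 1 + w != 0 by rewrite gt_eqF// ltr_pwDl.
have h1 : h != 0 by rewrite gt_eqF.
apply/eqP; rewrite eqr_div//; apply/eqP.
by transitivity (w ^+ 2 - 1); [ring|rewrite E; ring].
Qed.

Let invr1D_le1 (w : R) : 0 <= w -> (1 + w)^-1 <= 1.
Proof. by move=> w0; rewrite invf_le1 ?lerDl// ltr_pwDl. Qed.

Lemma hscore_bound G H x : admissible G H -> ballmix rad H -> ncomp H = kstar ->
  `|hscore G H x| <= A * expR (3 * S x).
Proof.
move=> aG bH Hk; rewrite hscoreE// normrM.
have w0 : 0 <= root G H x by exact: sqrtr_ge0.
rewrite (@ger0_norm _ (_^-1)) ?invr_ge0 ?addr_ge0//.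
apply: le_trans (rscore_bound x aG bH Hk).
by rewrite ler_piMr// invr1D_le1.
Qed.

(* This square root costs a factor in the continuity modulus: parameters must be
   [e ^+ 2]-close for scores to be [e]-close. *)
Let sqrt_holder (p q : R) : 0 <= p -> 0 <= q -> `|p - q| <= Num.sqrt `|p ^+ 2 - q ^+ 2|.
Proof.
move=> p0 q0; rewrite -[leLHS]sqrtr_sqr ?normr_id ler_wsqrtr//.
rewrite subr_sqr normrM -(real_normK (num_real (p - q))) expr2 ler_wpM2l//.
rewrite (ger0_norm (addr_ge0 p0 q0)); apply: le_trans (ler_normB _ _) _.
by rewrite !ger0_norm.
Qed.

Variable B : R.
Hypothesis HB : forall G H, ballmix rad G -> ballmix rad H -> hell G H <= B.

(** Up to exponentials, [lipc] bounds the change of [rscore], [A] bounds [rscore] itself, and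
    [1 + A + B * lipc] bounds the change of [root]. *)
Definition envc : R := lipc + A * (1 + A + B * lipc).

Lemma hscore_lip e G G' H x : admissible G H -> admissible G' H ->
  ballmix rad H -> ncomp H = kstar -> 0 <= e <= 1 -> close_params (e ^+ 2) G G' H ->
  `|hscore G H x - hscore G' H x| <= e * (envc * expR (7 * S x)).
Proof.
move=> aG aG' bH Hk /andP[e0 e1] c.
have e20 : 0 <= e ^+ 2 by exact: sqr_ge0.
have [bG _ h0] := aG; have [bG' _ h0'] := aG'; have [_ _ cH] := c.
have L0 : 0 <= lipc by apply: le_trans lipc_ge; exact: ltW.
have hB : hell G' H <= B by exact: HB.
have R1 := rscore_bound x aG bH Hk; have R2 := rscore_bound x aG' bH Hk.
have R3 := rscore_lip x aG aG' bH Hk e20 c.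
have w0 : 0 <= root G H x by exact: sqrtr_ge0.
have w0' : 0 <= root G' H x by exact: sqrtr_ge0.
have W := sqrt_holder w0 w0'.
rewrite !root_sqr// in W.
rewrite !hscoreE//.
have e34 : expR (3 * S x) <= expR (4 * S x).
  by rewrite ler_expR ler_wpM2r// ler_nat.
have x1 : 1 <= expR (4 * S x).
  by rewrite -expR0 ler_expR mulr_ge0.
have e47 : expR (4 * S x) <= expR (7 * S x).
  by rewrite ler_expR ler_wpM2r// ler_nat.
have e7 : expR (3 * S x) * expR (4 * S x) = expR (7 * S x).
  by rewrite -expRD; congr expR; ring.
rewrite /envc.
have B0 : 0 <= B by apply: le_trans hB; exact: ltW.
have W' : `|root G H x - root G' H x| <= e * ((1 + A + B * lipc) * expR (4 * S x)).
  apply: le_trans W _.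
  have E1 : `|1 + hell G H * rscore G H x - (1 + hell G' H * rscore G' H x)| <=
      e ^+ 2 * ((A + B * lipc) * expR (4 * S x)).
    rewrite (_ : _ - _ = (hell G H - hell G' H) * rscore G H x +
      hell G' H * (rscore G H x - rscore G' H x)); last by ring.
    apply: le_trans (ler_normD _ _) _.
    rewrite (normrM (hell G H - _)) (normrM (hell G' H)) (ger0_norm (ltW h0')).
    have T1 : `|hell G H - hell G' H| * `|rscore G H x| <= e ^+ 2 * (A * expR (4 * S x)).
      apply: ler_pM => //; apply: le_trans R1 _.
      by rewrite ler_wpM2l// ltW.
    have T2 : hell G' H * `|rscore G H x - rscore G' H x| <=
        B * (lipc * e ^+ 2 * expR (4 * S x)) by apply: ler_pM => //; exact: ltW.
    by apply: le_trans (lerD T1 T2) _; apply: eq_ler; ring.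
  apply: le_trans (ler_wsqrtr E1) _.
  rewrite sqrtrM ?sqr_ge0// sqrtr_sqr (ger0_norm e0) ler_wpM2l//.
  have y0 : 0 <= (A + B * lipc) * expR (4 * S x).
    by rewrite mulr_ge0 ?expR_ge0// addr_ge0 ?mulr_ge0// ltW.
  apply: (@le_trans _ _ (1 + (A + B * lipc) * expR (4 * S x))); last first.
    rewrite [leRHS](_ : _ = expR (4 * S x) + (A + B * lipc) * expR (4 * S x)).
      by rewrite lerD2r.
    by ring.
  move: (_ * expR _) y0 => y y0.
  rewrite -(@ger0_norm _ (1 + y)) ?addr_ge0// -sqrtr_sqr ler_wsqrtr//.
  by have := sqr_ge0 y; nra.
move: (root G H x) (root G' H x) w0 w0' W' => w w' w0 w0' W'.
move: (rscore G H x) (rscore G' H x) R1 R2 R3 {W} => s s' R1 R2 R3.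
have w1 : 1 + w != 0 by rewrite gt_eqF// ltr_pwDl.
have w1' : 1 + w' != 0 by rewrite gt_eqF// ltr_pwDl.
(* The two terms carry the changes of numerator and denominator; their growth rates 4 and [3 + 4]
   are at most 7. *)
have -> : s / (1 + w) - s' / (1 + w') =
    (s - s') / (1 + w) - s' * ((w - w') / (1 + w) / (1 + w')).
  by field; rewrite w1 w1'.
apply: le_trans (ler_normB _ _) _; rewrite !normrM.
have V0 (z : R) : 0 <= z -> `|(1 + z)^-1| <= 1.
  by move=> z0; rewrite ger0_norm ?invr_ge0 ?addr_ge0// invr1D_le1.
have T1 : `|s - s'| * `|(1 + w)^-1| <= e * (lipc * expR (7 * S x)).
  apply: (@le_trans _ _ (lipc * e ^+ 2 * expR (4 * S x))).
    by apply: le_trans R3; rewrite ler_piMr// V0.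
  rewrite (_ : _ * e ^+ 2 * _ = e * (lipc * (e * expR (4 * S x)))); last by ring.
  rewrite ler_wpM2l// ler_wpM2l//; apply: le_trans e47.
  by rewrite ler_piMl// expR_ge0.
have T2 : `|s'| * (`|w - w'| * `|(1 + w)^-1| * `|(1 + w')^-1|) <=
    e * (A * (1 + A + B * lipc) * expR (7 * S x)).
  apply: (@le_trans _ _ (A * expR (3 * S x) * (e * ((1 + A + B * lipc) * expR (4 * S x))))).
    apply: ler_pM; rewrite ?mulr_ge0//.
    apply: le_trans W'; rewrite -mulrA ler_piMr//.
    by rewrite mulr_ile1// V0.
  by rewrite -e7; apply: eq_ler; ring.
by apply: le_trans (lerD T1 T2) _; apply: eq_ler; ring.
Qed.

End normalized_scores.

(** * Deviation inequalities *)

Section outer_probability.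
Context dsp (T : measurableType dsp) {R : realType} (P : probability T R).
Implicit Types A B F : set T.

(** Outer probability is used because [Ghat] is an arbitrary map and the events range over
    uncountably many mixtures; monotonicity and finite subadditivity take the place of
    measurability. *)
Lemma mu_ext_bigsetU I (r : seq I) (F : I -> set T) :
  (mu_ext P (\big[setU/set0]_(i <- r) F i) <= \sum_(i <- r) mu_ext P (F i))%E.
Proof.
elim: r => [|i r IH]; first by rewrite !big_nil mu_ext0.
rewrite !big_cons; apply: le_trans (outer_measureU2 _ _ _) _.
by rewrite leeD2l.
Qed.

Lemma mu_ext_finite_cover (I : finType) F (G : I -> set T) (b : I -> R) :
  F `<=` [set w | exists i, G i w] ->
  (forall i, (mu_ext P (G i) <= (b i)%:E)%E) -> (mu_ext P F <= (\sum_i b i)%:E)%E.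
Proof.
move=> FG Gb; apply: (@le_trans _ _ (mu_ext P (\big[setU/set0]_i G i))).
  apply: le_mu_ext => w /FG[i Gi]; rewrite -bigcup_seq /=.
  by exists i => //=; rewrite mem_index_enum.
apply: le_trans (mu_ext_bigsetU _ _) _; rewrite -sumEFin.
by apply: lee_sum => i _; exact: Gb.
Qed.

Lemma mu_ext_le1 F : (mu_ext P F <= 1)%E.
Proof.
apply: le_trans (le_mu_ext P (@subsetT _ F)) _.
by rewrite measurable_mu_extE//; exact: probability_le1.
Qed.

End outer_probability.

(** * Chernoff and Bernstein bounds under the true law *)

Section exponential_inequalities.
Context {R : realType} {d : nat}.
Variable Sigma : 'M[R]_d.
Hypothesis Spd : symposdef Sigma.
Variables (H : mixing R d) (rad : R).
Hypothesis rad0 : 0 <= rad.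
Hypothesis bH : ballmix rad H.
Implicit Types (x : 'rV[R]_d) (g h Y : 'rV[R]_d -> R).

Local Notation mratio := (mratio Sigma).

Definition expect h : R := gint Sigma (fun x => h x * mratio H x).

Let eH : expgrowth (mratio H). Proof. exact: expgrowth_mratio. Qed.

Let H0 x : 0 <= mratio H x. Proof. by apply: ltW; exact: mratio_gt0 bH. Qed.

Lemma expectD g h : expgrowth g -> expgrowth h ->
  expect (fun x => g x + h x) = expect g + expect h.
Proof.
move=> eg eh; rewrite /expect -gintD//; try exact: expgrowthM.
by congr gint; apply/funext => x; rewrite mulrDl.
Qed.

Lemma expectZ c h : expgrowth h -> expect (fun x => c * h x) = c * expect h.
Proof.
move=> eh; rewrite /expect -gintZ//; last exact: expgrowthM.
by congr gint; apply/funext => x; rewrite mulrA.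
Qed.

Lemma expect_sum I (r : seq I) (F : I -> 'rV[R]_d -> R) :
  (forall i, expgrowth (F i)) ->
  expect (fun x => \sum_(i <- r) F i x) = \sum_(i <- r) expect (F i).
Proof.
move=> eF; rewrite /expect -gint_sum//; last by move=> i; exact: expgrowthM.
by congr gint; apply/funext => x; rewrite mulr_suml.
Qed.

Lemma expect_le g h : expgrowth g -> expgrowth h -> (forall x, g x <= h x) ->
  expect g <= expect h.
Proof.
move=> eg eh gh; apply: gint_le => //; try exact: expgrowthM.
by move=> x; rewrite ler_wpM2r.
Qed.

Lemma expect_ge0 h : (forall x, 0 <= h x) -> 0 <= expect h.
Proof. by move=> h0; apply: gint_ge0 => // x; rewrite mulr_ge0. Qed.

Context dsp (T : measurableType dsp) (P : probability T R).
Variables (n : nat) (X : 'I_n -> {RV P >-> 'rV[R]_d}).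
Hypothesis n0 : (0 < n)%N.
Hypothesis iidX : iid_with_density X (mixture_pdf Sigma H).

Lemma prob_expect i (A : set 'rV[R]_d) : measurable A ->
  P (X i @^-1` A) = (expect (\1_A))%:E.
Proof.
move=> mA; rewrite /expect gint_indicE//.
transitivity (distribution P (X i) A) => //; rewrite iidX.1//.
by apply: eq_integral => x _; rewrite mixture_pdfE.
Qed.

Lemma expect1 : expect (cst 1) = 1.
Proof.
have := prob_expect (Ordinal n0) (@measurableT _ 'rV[R]_d).
rewrite preimage_setT probability_setT => -[E]; rewrite [RHS]E.
by congr expect; apply/funext => x; rewrite indicE in_setT.
Qed.

Lemma expect_cst c : expect (cst c) = c.
Proof.
rewrite -[RHS]mulr1 -expect1 -expectZ; last exact: expgrowth_cst.
by congr expect; apply/funext => x; rewrite mulr1.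
Qed.

Lemma prob_prod (A : 'I_n -> set 'rV[R]_d) : (forall i, measurable (A i)) ->
  mu_ext P [set w | forall i, A i (X i w)] = (\prod_i expect (\1_(A i)))%:E.
Proof.
move=> mA; have mXA i : measurable (X i @^-1` A i).
  by rewrite -[X in measurable X]setTI; exact: measurable_funPT.
have := iidX.2 finset.setT A mA.
rewrite (_ : \bigcap_(_ in _) _ = [set w | forall i, A i (X i w)]).
  rewrite measurable_mu_extE => [E|].
    apply: (etrans E); rewrite -prodEFin; apply: eq_big => [i|i _].
      by rewrite inE.
    exact: prob_expect.
  rewrite (_ : mkset _ = \big[setI/setT]_i (X i @^-1` A i)).
    by apply: bigsetI_measurable => i _.
  rewrite -bigcap_seq; apply/seteqP; split => w Aw i.
    by move=> _; exact: (Aw i).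
  by apply: (Aw i); rewrite /= mem_index_enum.
apply/seteqP; split => w Aw i; last by move=> _; exact: (Aw i).
by apply: (Aw i); rewrite /= inE.
Qed.

(* Independence is only available for events, so [g] is first rounded to the
   multiples of [1 / N]. *)
Lemma chernoff (M : R) g (dl : R) : measurable_fun setT g ->
  (forall x, 0 <= g x <= M) -> 0 < dl ->
  (mu_ext P [set w | (1 <= \prod_i g (X i w))%R] <= ((expect g + dl) ^+ n)%:E)%E.
Proof.
move=> mg gM dl0.
have M0 : 0 <= M by have /andP[/le_trans] := gM 0; exact.
pose N := (Num.truncn dl^-1).+1; have N0 : 0 < N%:R :> R by rewrite ltr0n.
have Ndl : N%:R^-1 <= dl.
  by rewrite invf_ple ?posrE// ltW// truncnS_gt.
pose K := (Num.truncn (N%:R * M)).+1.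
pose A (j : 'I_K) : set 'rV[R]_d := [set x | j%:R <= N%:R * g x < j.+1%:R].
have mNg : measurable_fun setT (fun x => N%:R * g x) by exact: measurable_funM.
have mA j : measurable (A j).
  rewrite (_ : A j = (fun x => N%:R * g x) @^-1` `[j%:R, j.+1%:R[%classic); last first.
    by apply/seteqP; split => x /=; rewrite in_itv.
  rewrite -[X in measurable X]setTI; exact: mNg.
have coverA x : exists j, A j x.
  have Ng0 : 0 <= N%:R * g x by have /andP[? _] := gM x; rewrite mulr_ge0// ltW.
  have gK : (Num.truncn (N%:R * g x) < K)%N.
    by rewrite ltnS le_truncn// ler_wpM2l ?(ltW N0)//; have /andP[] := gM x.
  by exists (Ordinal gK); rewrite /A /=; exact: truncn_itv.
pose c (j : 'I_K) : R := j.+1%:R / N%:R.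
have c0 j : 0 <= c j by rewrite divr_ge0 // ltW.
have gc j x : A j x -> 0 <= g x <= c j.
  move=> /andP[_ h]; have /andP[-> _] := gM x.
  by rewrite /c ler_pdivlMr// mulrC ltW.
pose q (j : 'I_K) : R := expect (\1_(A j)).
have q0 j : 0 <= q j by apply: expect_ge0 => x; rewrite indicE.
(* Markov's inequality for the rounded product: the cells [f] of the sample have
   [1 <= \prod_i c (f i)], so this product may multiply their probability. The sum over all [f]
   factorizes into an n-th power. *)
apply: (@le_trans _ _ (\sum_(f : {ffun 'I_n -> 'I_K}) \prod_i (c (f i) * q (f i)))%:E).
  apply: (@mu_ext_finite_cover _ _ _ _ _ _ (fun f : {ffun 'I_n -> 'I_K} =>
      [set w | (forall i, A (f i) (X i w)) /\ 1 <= \prod_i c (f i)])).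
    move=> w /= gw; have Ai i : exists j, A j (X i w) by exact: coverA.
    pose f := [ffun i => projT1 (cid (Ai i))].
    have fA i : A (f i) (X i w) by rewrite ffunE; exact: (projT2 (cid (Ai i))).
    exists f; split=> //; apply: le_trans gw _.
    by apply: ler_prod => i _; exact: gc.
  move=> f; have [cf|cf] := lerP 1 (\prod_i c (f i)); last first.
    rewrite (_ : [set w | _ /\ _] = set0).
      apply: (@le_trans _ _ 0%:E%E); first by rewrite mu_ext0.
      by rewrite lee_fin prodr_ge0// => i _; rewrite mulr_ge0.
    by apply/seteqP; split => w //= [].
  apply: (@le_trans _ _ (mu_ext P [set w | forall i, A (f i) (X i w)])).
    by apply: le_mu_ext => w [].
  rewrite (prob_prod (A := fun i => A (f i)))// lee_fin big_split /=.
  by rewrite ler_peMl//; apply: prodr_ge0 => i _; exact: q0.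
rewrite lee_fin -(bigA_distr_bigA (fun _ j => c j * q j)) /= prodr_const card_ord.
have eA j : expgrowth (\1_(A j) : 'rV[R]_d -> R) by exact: expgrowth_indic.
have eg : expgrowth g.
  split => //; exists M, 0; split => // x; have /andP[g0 g1] := gM x.
  by rewrite mul0r expR0 mulr1 ger0_norm.
apply: lerXn2r; rewrite ?nnegrE.
- by apply: sumr_ge0 => j _; rewrite mulr_ge0.
- rewrite addr_ge0 ?(ltW dl0)// expect_ge0// => x.
  by have /andP[] := gM x.
apply: (@le_trans _ _ (expect g + expect (cst N%:R^-1))); last first.
  by rewrite expect_cst lerD2l.
rewrite -expectD//; last exact: expgrowth_cst.
have -> : \sum_j c j * q j = expect (fun x => \sum_j c j * \1_(A j) x).
  rewrite expect_sum; last by move=> j; exact: expgrowthZ.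
  by apply: eq_bigr => j _; rewrite expectZ.
apply: expect_le.
- by apply: expgrowth_sum => j; exact: expgrowthZ.
- by apply: expgrowthD => //; exact: expgrowth_cst.
move=> x; have [j Aj] := coverA x.
rewrite (bigD1 j)//= indicE mem_set// mulr1 big1 ?addr0; last first.
  move=> i ij; rewrite indicE memNset ?mulr0//= => Ai.
  move: Aj Ai; rewrite /A /= => /andP[j1 j2] /andP[i1 i2].
  have : (j%:R < i.+1%:R :> R) by exact: le_lt_trans i2.
  have : (i%:R < j.+1%:R :> R) by exact: le_lt_trans j2.
  rewrite !ltr_nat !ltnS => h1 h2; move/negP: ij; apply; apply/eqP/val_inj.
  by apply/eqP; rewrite eqn_leq h1 h2.
move: Aj => /andP[j1 _]; rewrite /c -natr1 mulrDl mul1r lerD2r.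
by rewrite ler_pdivrMr// mulrC.
Qed.

(** From [1 - y <= expR (- y)] and [1 <= (1 + y + 2 * y ^+ 2) * (1 - y)]. *)
Lemma expR_le_quadratic (y : R) : `|y| <= 2^-1 -> expR y <= 1 + y + 2 * y ^+ 2.
Proof.
move=> y2; have [yl yr] : - 2^-1 <= y /\ y <= 2^-1 by apply/andP; rewrite -ler_norml.
have y1 : 0 < 1 - y by lra.
apply: (@le_trans _ _ (1 - y)^-1).
  rewrite -[expR y]invrK -expRN lef_pV2 ?posrE ?expR_gt0//.
  exact: expR_ge1Dx.
rewrite -[leLHS]mul1r ler_pdivrMr//.
have -> : (1 + y + 2 * y ^+ 2) * (1 - y) = 1 + y ^+ 2 * (1 - 2 * y) by ring.
by rewrite lerDl mulr_ge0 ?sqr_ge0//; lra.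
Qed.

(** The Chernoff bound for [Y] cut off outside [A], where the quadratic bound of the exponential
    applies. The term [s * tau] pays for the change of mean, and the summand 1 for the rounding
    slack [expR z / n] after the n-th power. *)
Lemma bernstein Y (A : set 'rV[R]_d) (s v tau lambda : R) :
  expgrowth Y -> measurable A -> 0 < s ->
  (forall x, A x -> `|s * Y x| <= 2^-1) ->
  expect (fun x => Y x ^+ 2) <= v -> expect (fun x => `|Y x| * \1_(~` A) x) <= tau ->
  (mu_ext P [set w | (forall i, A (X i w)) /\
      (lambda <= \sum_i (Y (X i w) - expect Y))%R]
    <= (expR (1 + (- (s * lambda) + n%:R * (2 * s ^+ 2 * v + s * tau))))%:E)%E.
Proof.
move=> eY mA s0 sY vY tY.
have e1A : expgrowth (\1_A : 'rV[R]_d -> R) by exact: expgrowth_indic.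
have e1C : expgrowth (\1_(~` A) : 'rV[R]_d -> R).
  by apply: expgrowth_indic; exact: measurableC.
have nR : 0 < n%:R :> R by rewrite ltr0n.
pose b := expect Y + lambda / n%:R.
pose g x := expR (s * (Y x * \1_A x - b)).
have mg : measurable_fun setT g.
  apply: measurableT_comp => //; apply: measurable_funM => //.
  apply: measurable_funB => //; apply: measurable_funM; first by have [] := eY.
  by have [] := e1A.
have YA x : `|s * (Y x * \1_A x)| <= 2^-1.
  rewrite indicE; have [/set_mem Ax|_] := boolP (x \in A).
    by rewrite mulr1 sY.
  by rewrite !mulr0 normr0 invr_ge0.
have gM x : 0 <= g x <= expR (2^-1 + `|s * b|).
  rewrite /g expR_ge0 ler_expR mulrBr /=; apply: lerD.
    by apply: le_trans (ler_norm _) _.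
  by apply: le_trans (ler_norm _) _; rewrite normrN.
pose z := 2 * s ^+ 2 * v + s * tau - s * lambda / n%:R.
have Eg : expect g <= expR z.
  have eq1 : expgrowth (fun x => 1 + s * (Y x * \1_A x) + 2 * (s ^+ 2 * Y x ^+ 2)).
    apply: expgrowthD; last first.
      do 2 apply: expgrowthZ.
      by have := expgrowthM eY eY; congr expgrowth; apply/funext => x; rewrite expr2.
    apply: expgrowthD; first exact: expgrowth_cst.
    by apply: expgrowthZ; exact: expgrowthM.
  have eg : expgrowth g.
    split => //; exists (expR (2^-1 + `|s * b|)), 0; split.
    - exact: expR_ge0.
    - by [].
    - by move=> x; have /andP[? ?] := gM x; rewrite mul0r expR0 mulr1 ger0_norm.
  apply: (@le_trans _ _ (expect (fun x => expR (- (s * b)) *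
      (1 + s * (Y x * \1_A x) + 2 * (s ^+ 2 * Y x ^+ 2))))).
    apply: expect_le => //; first exact: expgrowthZ.
    move=> x; rewrite /g mulrBr addrC expRD ler_wpM2l ?expR_ge0//.
    apply: le_trans (expR_le_quadratic (YA x)) _; rewrite lerD2l ler_wpM2l//.
    rewrite exprMn ler_wpM2l ?sqr_ge0// exprMn ler_piMr ?sqr_ge0//.
  rewrite expectZ//.
  have eYA : expgrowth (fun x => Y x * \1_A x) by exact: expgrowthM.
  have eYC' : expgrowth (fun x => `|Y x| * \1_(~` A) x).
    by apply: expgrowthM => //; exact: expgrowth_norm.
  have eY2 : expgrowth (fun x => Y x ^+ 2).
    by have := expgrowthM eY eY; congr expgrowth; apply/funext => x; rewrite expr2.
  have YAE : expect (fun x => Y x * \1_A x) <= expect Y + tau.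
    apply: le_trans (lerD (lexx _) tY); rewrite -expectD//.
    apply: expect_le => //; first exact: expgrowthD.
    move=> x; rewrite !indicE in_setC; case: (_ \in _); rewrite /= ?mulr1 ?mulr0 ?addr0//.
    by rewrite -lerBlDl sub0r -normrN ler_norm.
  have -> : z = - (s * b) + (s * (expect Y + tau) + 2 * (s ^+ 2 * v)).
    by rewrite /z /b; ring.
  rewrite expRD ler_wpM2l ?expR_ge0//.
  apply: le_trans (expR_ge1Dx _).
  rewrite expectD; [|apply: expgrowthD|do 2 apply: expgrowthZ => //]; last 2 first.
  - exact: expgrowth_cst.
  - exact: expgrowthZ.
  rewrite expectD; [|exact: expgrowth_cst|exact: expgrowthZ].
  rewrite expect_cst expectZ// expectZ; last exact: expgrowthZ.
  rewrite expectZ// -addrA lerD2l; apply: lerD; first by rewrite ler_wpM2l// ltW.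
  by rewrite ler_wpM2l// ler_wpM2l ?sqr_ge0.
have dl0 : 0 < expR z / n%:R by rewrite divr_gt0// expR_gt0.
apply: (@le_trans _ _ (mu_ext P [set w | (1 <= \prod_i g (X i w))%R])).
  apply: le_mu_ext => w [Aw lw] /=.
  rewrite /g -expR_sum -expR0 ler_expR -mulr_sumr mulr_ge0 ?(ltW s0)//.
  rewrite (eq_bigr (fun i => Y (X i w) - expect Y - lambda / n%:R)); last first.
    by move=> i _; rewrite indicE mem_set// mulr1 /b opprD addrA.
  rewrite sumrB sumr_const card_ord -[X in _ - X]mulr_natr divfK ?gt_eqF//.
  by rewrite subr_ge0.
apply: le_trans (chernoff mg gM dl0) _; rewrite lee_fin.
apply: (@le_trans _ _ ((expR (z + n%:R^-1)) ^+ n)); last first.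
  rewrite -expRM_natl ler_expR; apply: eq_ler; rewrite /z; field.
  by rewrite gt_eqF.
apply: lerXn2r; rewrite ?nnegrE ?expR_ge0//.
  by rewrite addr_ge0 ?(ltW dl0)// expect_ge0// => x; exact: expR_ge0.
apply: (@le_trans _ _ (expR z * (1 + n%:R^-1))).
  by rewrite mulrDr mulr1 lerD2r.
by rewrite (expRD z) ler_wpM2l ?expR_ge0// expR_ge1Dx.
Qed.

End exponential_inequalities.

(** * Grids of parameters *)

Section cells.
Context {R : realType} {U : Type} {I : finType}.
Variables (prm : U -> I -> R) (M e : R).
Hypothesis e0 : 0 < e.

Definition cellnb : nat := (Num.truncn (2 * M / e)).+1.

(** Rounds each parameter to a grid of step [e]. Out of range [inord] returns a default index, hence
    the bounds by [M] in [cell_close]. *)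
Definition cell (u : U) : {ffun I -> 'I_cellnb} :=
  [ffun i => inord (Num.truncn ((prm u i + M) / e))].

Lemma cell_close u u' : (forall i, `|prm u i| <= M) -> (forall i, `|prm u' i| <= M) ->
  cell u = cell u' -> forall i, `|prm u i - prm u' i| <= e.
Proof.
move=> uM u'M uu' i.
have tr z : (forall i, `|prm z i| <= M) -> 0 <= (prm z i + M) / e /\
    (Num.truncn ((prm z i + M) / e) < cellnb)%N.
  move=> /(_ i); rewrite ler_norml => /andP[h1 h2].
  have h3 : 0 <= (prm z i + M) / e by rewrite divr_ge0 ?(ltW e0)//; lra.
  split => //; rewrite ltnS le_truncn// ler_wpM2r ?invr_ge0 ?(ltW e0)//; lra.
have [p0 p1] := tr u uM; have [q0 q1] := tr u' u'M.
have := congr1 (fun f : {ffun I -> 'I_cellnb} => val (f i)) uu'.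
rewrite !ffunE /= !inordK// => E.
have := truncn_itv p0; have := truncn_itv q0; rewrite -E.
move: (Num.truncn _) => t /andP[a1 a2] /andP[b1 b2].
have : `|(prm u i + M) / e - (prm u' i + M) / e| <= 1.
  by rewrite ler_norml; rewrite -natr1 in a2 b2; apply/andP; split; lra.
rewrite -mulrBl normrM (@gtr0_norm _ e^-1) ?invr_gt0// ler_pdivrMr// mul1r.
by rewrite (_ : _ - _ = prm u i - prm u' i)//; ring.
Qed.

Lemma card_cells_le : 0 <= M -> e <= 1 ->
  (#|{ffun I -> 'I_cellnb}|)%:R <= ((2 * M + 1) / e) ^+ #|I|.
Proof.
move=> M0 e1; rewrite card_ffun card_ord natrX.
apply: lerXn2r; rewrite ?nnegrE//.
  by rewrite divr_ge0 ?(ltW e0)// addr_ge0// mulr_ge0.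
rewrite /cellnb -natr1 [leRHS]mulrDl; apply: lerD.
  by rewrite truncn_le divr_ge0 ?(ltW e0)// mulr_ge0.
by rewrite mul1r invf_ge1.
Qed.

End cells.

(** * Mean and second moment of a score *)

Section score_moments.
Context {R : realType} {d : nat}.
Variable Sigma : 'M[R]_d.
Hypothesis Spd : symposdef Sigma.
Variables (rad : R) (G H : mixing R d).
Hypotheses (rad0 : 0 <= rad) (bG : ballmix rad G) (bH : ballmix rad H).
Hypothesis mass1 : expect Sigma H (cst 1) = 1.
Hypothesis h0 : 0 < hellinger (mixture_pdf Sigma G) (mixture_pdf Sigma H).

Let eta := hellinger (mixture_pdf Sigma G) (mixture_pdf Sigma H).
Let r x := mratio Sigma G x.
Let q x := mratio Sigma H x.

Let r0 x : 0 < r x. Proof. exact: mratio_gt0 bG. Qed.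
Let q0 x : 0 < q x. Proof. exact: mratio_gt0 bH. Qed.

Let gint_mratio K : gint Sigma (mratio Sigma K) = mint K (cst (gint Sigma (cst 1))).
Proof.
have := gint_wordv_mratio Spd [::] K.
rewrite (_ : (fun x => wordv [::] x * mratio Sigma K x) = mratio Sigma K); last first.
  by apply/funext => x; rewrite wordv_nil mul1r.
move=> ->; congr mint; apply/funext => t; congr gint; apply/funext => x.
by rewrite wordv_nil.
Qed.

Let gintq : gint Sigma q = 1.
Proof.
by rewrite -mass1 /expect; congr gint; apply/funext => x; rewrite mul1r.
Qed.

(** All mixtures have the mass of the reference Gaussian, by translation, so mass one passes from
    [H] to [G]. *)
Let gintr : gint Sigma r = 1.
Proof.
move: gintq; rewrite /r /q !gint_mratio (mint_cst _ bG) (mint_cst _ bH).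
by [].
Qed.

Let expgrowth_r : expgrowth r. Proof. exact: expgrowth_mratio. Qed.
Let expgrowth_q : expgrowth q. Proof. exact: expgrowth_mratio. Qed.

Let expgrowth_sqrt_rq : expgrowth (fun x => Num.sqrt (r x) * Num.sqrt (q x)).
Proof. by apply: expgrowthM; exact: expgrowth_sqrt. Qed.

Let sqrt_ratio x : Num.sqrt (r x / q x) * q x = Num.sqrt (r x) * Num.sqrt (q x).
Proof.
rewrite -{2}(sqr_sqrtr (ltW (q0 x))) expr2 mulrA; congr (_ * _).
by rewrite -sqrtrM ?divr_ge0 ?ltW// divfK// gt_eqF.
Qed.

Lemma affinity : gint Sigma (fun x => Num.sqrt (r x) * Num.sqrt (q x)) = 1 - eta ^+ 2.
Proof.
have -> : eta ^+ 2 = 2^-1 * gint Sigma (hgap Sigma G H) by exact: hellinger_sqr bG bH.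
have -> : gint Sigma (hgap Sigma G H) =
    gint Sigma (fun x => (r x + q x) - 2 * (Num.sqrt (r x) * Num.sqrt (q x))).
  congr gint; apply/funext => x; rewrite /hgap sqrrB.
  rewrite !sqr_sqrtr ?(ltW (r0 x)) ?(ltW (q0 x))//.
  by rewrite -/(r x) -/(q x); ring.
rewrite gintB//; [|exact: expgrowthD|exact: expgrowthZ].
by rewrite gintD// gintZ// gintr gintq; field.
Qed.

Lemma expect_hscore : expect Sigma H (hscore Sigma G H) = - eta.
Proof.
have -> : expect Sigma H (hscore Sigma G H) = gint Sigma (fun x =>
    eta^-1 * (Num.sqrt (r x) * Num.sqrt (q x) - q x)).
  congr gint; apply/funext => x; rewrite /hscore -/(r x) -/(q x) -/eta.
  by rewrite mulrAC mulrBl sqrt_ratio mul1r mulrC.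
rewrite gintZ//; last exact: expgrowthB.
rewrite gintB// affinity gintq; field.
by rewrite gt_eqF.
Qed.

Lemma expect_hscore_sqr : expect Sigma H (fun x => hscore Sigma G H x ^+ 2) = 2.
Proof.
have -> : expect Sigma H (fun x => hscore Sigma G H x ^+ 2) = gint Sigma (fun x =>
    (eta ^+ 2)^-1 * hgap Sigma G H x).
  congr gint; apply/funext => x; rewrite /hscore -/(r x) -/(q x) -/eta /hgap.
  have s0 : 0 < Num.sqrt (q x) by rewrite sqrtr_gt0.
  have qE : q x = Num.sqrt (q x) ^+ 2 by rewrite sqr_sqrtr// ltW.
  have -> : Num.sqrt (r x / q x) = Num.sqrt (r x) / Num.sqrt (q x).
    by rewrite sqrtrM ?(ltW (r0 x))// sqrtrV ?(ltW (q0 x)).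
  rewrite {2}qE -/(r x) -/(q x).
  by move: (Num.sqrt (r x)) (Num.sqrt (q x)) s0 => u v s0; field; rewrite !gt_eqF.
have H2 := hellinger_sqr Spd rad0 bG bH.
rewrite gintZ//; last exact: expgrowth_hgap.
rewrite -/eta in H2.
have -> : gint Sigma (hgap Sigma G H) = 2 * eta ^+ 2 by rewrite H2 mulrA divff// mul1r.
by rewrite mulrCA mulVf ?mulr1// expf_neq0// gt_eqF.
Qed.

Lemma expgrowth_hscore : expgrowth (hscore Sigma G H).
Proof.
have mf : measurable_fun setT (hscore Sigma G H).
  (* Division by [q x] is written with [expR] and [ln], to stay within compositions of measurable
     functions. *)
  rewrite (_ : hscore Sigma G H = fun x =>
      (Num.sqrt (r x * expR (- ln (q x))) - 1) / eta); last first.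
    by apply/funext => x; rewrite /hscore expRN lnK// posrE.
  apply: measurable_funM => //; apply: measurable_funB => //.
  apply: (measurableT_comp (continuous_measurable_fun (@sqrt_continuous R))).
  apply: measurable_funM; first by have [] := expgrowth_r.
  apply: measurableT_comp => //; apply: measurableT_comp => //.
  by apply: (measurableT_comp (@measurable_ln R)); have [] := expgrowth_q.
have c0 := llrc_ge0 Sigma rad.
apply: (expgrowth_le (g := fun x => eta^-1 * (2 + expR (llrc Sigma rad) *
    expR (llrc Sigma rad * l1norm x) * r x))) => //.
  apply: expgrowthZ; apply: expgrowthD; first exact: expgrowth_cst.
  by apply: expgrowthM => //; apply: expgrowthZ; exact: expgrowth_expR.
move=> x; rewrite /hscore -/(r x) -/(q x) -/eta mulrC normrM [leRHS]normrM ler_wpM2l//.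
have rq : r x / q x <= expR (llrc Sigma rad) * expR (llrc Sigma rad * l1norm x) * r x.
  rewrite mulrC ler_wpM2r ?(ltW (r0 x))// -[leRHS]invrK.
  rewrite lef_pV2 ?posrE ?invr_gt0 ?mulr_gt0 ?expR_gt0//.
  by rewrite -expRD -expRN -[X in X + _]mulr1 -mulrDr; exact: mratio_ge bH.
rewrite [leRHS]ger0_norm ?addr_ge0 ?mulr_ge0 ?expR_ge0 ?(ltW (r0 x))//.
have y0 : 0 <= r x / q x by rewrite divr_ge0// ltW.
apply: (@le_trans _ _ (2 + r x / q x)); last by rewrite lerD2l.
apply: le_trans (ler_normB _ _) _; rewrite normr1 ger0_norm ?sqrtr_ge0//.
have s1 : Num.sqrt (r x / q x) <= 1 + r x / q x.
  rewrite -[leRHS]ger0_norm ?addr_ge0// -sqrtr_sqr ler_wsqrtr//.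
  by move: (r x / q x) y0 => y y0; have := sqr_ge0 y; nra.
by lra.
Qed.

End score_moments.

(** * Deviations below an envelope with eight moments *)

Section truncated_deviation.
Context {R : realType} {d : nat}.
Variable Sigma : 'M[R]_d.
Hypothesis Spd : symposdef Sigma.
Variables (rad : R) (H : mixing R d).
Hypotheses (rad0 : 0 <= rad) (bH : ballmix rad H).
Context dsp (T : measurableType dsp) (P : probability T R).
Variables (n : nat) (X : 'I_n -> {RV P >-> 'rV[R]_d}).
Hypothesis n0 : (0 < n)%N.
Hypothesis iidX : iid_with_density X (mixture_pdf Sigma H).
Variables (F : 'rV[R]_d -> R) (K : R).
Hypotheses (eF : expgrowth F) (F1 : forall x, 1 <= F x).
Hypothesis FK : expect Sigma H (fun x => F x ^+ 8) <= K.

Local Notation E := (expect Sigma H).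

(** With eight moments, some sample point leaves this set with probability at most [K / n]; inside
    it [dev_scale * F] is at most [sqrt (ln n)] divided by the fourth root of [n], hence small. *)
Definition trunc_set : set 'rV[R]_d := [set x | F x ^+ 4 <= n%:R].

Let nR : 0 < n%:R :> R. Proof. by rewrite ltr0n. Qed.

Let expgrowthX j : expgrowth (fun x => F x ^+ j).
Proof.
elim: j => [|j IH].
  by have := expgrowth_cst (d := d) (1 : R); congr expgrowth; apply/funext => x.
by have := expgrowthM eF IH; congr expgrowth; apply/funext => x; rewrite exprS.
Qed.

Lemma expect_envX_le j : (j <= 8)%N -> E (fun x => F x ^+ j) <= K.
Proof.
move=> j8; apply: le_trans FK; apply: expect_le rad0 bH _ _ _ _ _ => // x.
exact: ler_weXn2l.
Qed.

Lemma measurable_trunc_set : measurable trunc_set.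
Proof.
rewrite (_ : trunc_set = (fun x => F x ^+ 4) @^-1` `]-oo, n%:R]%classic).
  rewrite -[X in measurable X]setTI; have [mF _] := expgrowthX 4.
  exact: mF.
by apply/seteqP; split => x /=; rewrite in_itv.
Qed.

Let expgrowth_indicC : expgrowth (\1_(~` trunc_set) : 'rV[R]_d -> R).
Proof. by apply: expgrowth_indic; apply: measurableC; exact: measurable_trunc_set. Qed.

Let markov j i : (j + 4 * i <= 8)%N ->
  E (fun x => F x ^+ j * \1_(~` trunc_set) x) <= K / n%:R ^+ i.
Proof.
move=> ji; apply: (@le_trans _ _ (E (fun x => (n%:R ^+ i)^-1 * F x ^+ (j + 4 * i)))).
  apply: expect_le rad0 bH _ _ _ _ _ => //; first exact: expgrowthM.
    exact: expgrowthZ.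
  move=> x; rewrite indicE; have F0 : 0 <= F x by apply: le_trans (F1 x).
  have [/set_mem /= /negP|_] := boolP (x \in _); last first.
    by rewrite mulr0 mulr_ge0 ?invr_ge0 ?exprn_ge0.
  rewrite -ltNge => /ltW h; rewrite mulr1 exprD mulrCA ler_peMr ?exprn_ge0//.
  rewrite mulrC ler_pdivlMr ?exprn_gt0// mul1r exprM.
  by rewrite lerXn2r ?nnegrE ?exprn_ge0// ltW.
by rewrite expectZ// mulrC ler_wpM2r ?invr_ge0 ?exprn_ge0 ?expect_envX_le// ltW.
Qed.

Lemma trunc_prob :
  (mu_ext P [set w | exists i, ~ trunc_set (X i w)] <= (K / n%:R)%:E)%E.
Proof.
have mC : measurable (~` trunc_set) by apply: measurableC; exact: measurable_trunc_set.
have -> : K / n%:R = \sum_(i < n) K / n%:R ^+ 2.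
  rewrite sumr_const card_ord -[RHS]mulr_natl; field.
  by rewrite gt_eqF.
apply: (mu_ext_finite_cover (G := fun i : 'I_n => X i @^-1` (~` trunc_set))) => // i.
rewrite measurable_mu_extE; last first.
  by rewrite -[X in measurable X]setTI; exact: measurable_funPT.
apply: (@le_trans _ _ (P (X i @^-1` (~` trunc_set)))) => //.
rewrite (prob_expect Spd iidX i mC) lee_fin; have := @markov 0 2 isT.
congr (_ <= _); congr (E _).
by apply/funext => x; rewrite expr0 mul1r.
Qed.

Definition dev_scale : R := Num.sqrt (ln n%:R) / Num.sqrt n%:R.

Hypothesis ln1 : 1 <= ln n%:R :> R.
Hypothesis lnn : ln n%:R <= n%:R :> R.

Lemma dev_scale_gt0 : 0 < dev_scale.
Proof. by rewrite divr_gt0 ?sqrtr_gt0// (lt_le_trans _ ln1). Qed.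

Let ln0 : 0 <= ln n%:R :> R. Proof. exact: le_trans ln1. Qed.

Lemma dev_scale_sqr : dev_scale ^+ 2 = ln n%:R / n%:R.
Proof. by rewrite expr_div_n !sqr_sqrtr// ltW. Qed.

Lemma dev_scale_le1 : dev_scale <= 1.
Proof.
rewrite -(@ler_pXn2r _ 2)// ?nnegrE ?(ltW dev_scale_gt0)// expr1n dev_scale_sqr.
by rewrite ler_pdivrMr// mul1r.
Qed.

(** With [s = M * dev_scale] the exponent is, up to a constant, [ln n] times
    [- 6 * M + 2 * M * (M * v)], at most [- 2 * M] when [M * v <= 2]: a smaller variance buys a
    larger power of [n] at the same level 6. *)
Lemma truncated_bernstein Y (c v : R) (M : nat) : (0 < M)%N ->
  16 * M%:R ^+ 4 * ln n%:R ^+ 2 <= n%:R :> R ->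
  expgrowth Y -> 0 <= c <= 1 -> (forall x, `|Y x| <= c * F x) ->
  E (fun x => Y x ^+ 2) <= v -> M%:R * v <= 2 ->
  (mu_ext P [set w | (forall i, trunc_set (X i w)) /\
      (6 * (n%:R * dev_scale) <= \sum_i (Y (X i w) - E Y))%R]
    <= (expR (1 + M%:R * K) / n%:R ^+ (2 * M))%:E)%E.
Proof.
move=> M0 nM eY /andP[c0 c1] YF Yv Mv.
have s0 := dev_scale_gt0; have s2 := dev_scale_sqr; have s1 := dev_scale_le1.
have MR : 0 < M%:R :> R by rewrite ltr0n.
have YF' x : `|Y x| <= F x.
  apply: le_trans (YF x) _; rewrite ler_piMl//; exact: le_trans (F1 x).
pose s := M%:R * dev_scale.
have sp : 0 < s by rewrite mulr_gt0.
have K0 : 0 <= K.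
  by apply: le_trans FK; apply: expect_ge0 rad0 bH _ _ => // x; rewrite exprn_even_ge0.
have sY x : trunc_set x -> `|s * Y x| <= 2^-1.
  rewrite /trunc_set /= => Fx; rewrite normrM (gtr0_norm sp).
  apply: (@le_trans _ _ (s * F x)); first by rewrite ler_wpM2l// ltW.
  have F0 : 0 <= F x by apply: le_trans (F1 x).
  suff : (s * F x) ^+ 4 <= (2^-1) ^+ 4.
    by rewrite ler_pXn2r ?nnegrE// mulr_ge0// ltW.
  rewrite exprMn; apply: (@le_trans _ _ (s ^+ 4 * n%:R)).
    by rewrite ler_wpM2l// exprn_ge0// ltW.
  rewrite /s exprMn (_ : dev_scale ^+ 4 = (dev_scale ^+ 2) ^+ 2); last by rewrite -exprM.
  rewrite s2 (_ : _ * n%:R = M%:R ^+ 4 * ln n%:R ^+ 2 / n%:R).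
    rewrite ler_pdivrMr// exprVn [leRHS]mulrC ler_pdivlMr ?exprn_gt0//.
    have -> : 2 ^+ 4 = 16 :> R by rewrite -natrX.
    by rewrite mulrC mulrA.
  by field; rewrite gt_eqF.
have tauY : E (fun x => `|Y x| * \1_(~` trunc_set) x) <= K / n%:R.
  apply: (@le_trans _ _ (E (fun x => F x ^+ 1 * \1_(~` trunc_set) x))).
    apply: expect_le rad0 bH _ _ _ _ _ => //.
    - by apply: expgrowthM => //; exact: expgrowth_norm.
    - by apply: expgrowthM => //; exact: expgrowthX.
    by move=> x; rewrite expr1 ler_wpM2r// indicE.
  exact: (@markov 1 1 isT).
have := bernstein Spd rad0 bH n0 iidX (6 * (n%:R * dev_scale)) eY
  measurable_trunc_set sp sY Yv tauY.
move=> /le_trans; apply; rewrite lee_fin.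
rewrite -[n%:R ^+ _]lnK ?posrE ?exprn_gt0// lnXn// -expRN -expRD ler_expR.
rewrite -addrA lerD2l.
have -> : - (s * (6 * (n%:R * dev_scale))) +
    n%:R * (2 * s ^+ 2 * v + s * (K / n%:R)) =
    - (6 * M%:R) * (n%:R * dev_scale ^+ 2) +
    2 * M%:R * (M%:R * v) * (n%:R * dev_scale ^+ 2) + dev_scale * (M%:R * K).
  by rewrite /s; field; rewrite gt_eqF.
have -> : n%:R * dev_scale ^+ 2 = ln n%:R by rewrite s2 mulrC divfK// gt_eqF.
have h1 : 2 * M%:R * (M%:R * v) * ln n%:R <= 2 * M%:R * 2 * ln n%:R.
  by rewrite ler_wpM2r// ler_wpM2l// mulr_ge0// ltW.
have h2 : dev_scale * (M%:R * K) <= M%:R * K.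
  by rewrite ler_piMl// mulr_ge0// ltW.
have h3 : ln n%:R *+ (2 * M) = 2 * M%:R * ln n%:R :> R.
  by rewrite -[LHS]mulr_natl natrM.
rewrite h3; move: h1 h2; lra.
Qed.

End truncated_deviation.

Lemma sum_telescope3 {R : comRingType} (I : finType) (a b c : I -> R) (u v w : R) :
  \sum_i (a i - u) = \sum_i (a i - b i - (u - v)) +
    (\sum_i (b i - c i - (v - w)) + \sum_i (c i - w)).
Proof. by rewrite -!big_split; apply: eq_bigr => i _ /=; ring. Qed.

Lemma three_parts {R : realFieldType} (a b c z : R) :
  18 * z <= a + (b + c) -> a <= 6 * z -> c < 6 * z -> 6 * z <= b.
Proof. by lra. Qed.

(** * Two-level covering of the scores *)

Section density_rate.
Context {R : realType} {d : nat}.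
Variable Sigma : 'M[R]_d.
Hypothesis Spd : symposdef Sigma.
Variables (rad : R) (k kstar : nat).
Hypothesis rad0 : 0 <= rad.
Implicit Types (G H : mixing R d).

Local Notation hell G H :=
  (hellinger (mixture_pdf Sigma G) (mixture_pdf Sigma H)).

Variables (A B b K : R).
Hypothesis A0 : 0 < A.
Hypothesis HA : forall G H, ballmix rad G -> ballmix rad H ->
  forall w : seq 'I_d, (size w <= 2 * (k + kstar))%N ->
    `|dint G H (wordv w)| <= A * hell G H.
Hypothesis HB : forall G H, ballmix rad G -> ballmix rad H -> hell G H <= B.
Hypothesis B0 : 0 <= B.
Let F (x : 'rV[R]_d) : R := expR (b * (1 + l1norm x)).
Hypothesis b0 : 0 <= b.
Hypothesis FA : forall x : 'rV[R]_d,
  A * expR (3 * (growthc Sigma rad * (1 + l1norm x))) <= F x.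
Hypothesis FC : forall x : 'rV[R]_d,
  envc k kstar A B * expR (7 * (growthc Sigma rad * (1 + l1norm x))) <= F x.
Hypothesis K1 : 1 <= K.

Let eF : expgrowth F.
Proof.
have := expgrowthZ (expR b) (expgrowth_expR (d := d) b0); congr expgrowth.
by apply/funext => x; rewrite -expRD /F mulrDr mulr1.
Qed.

Let F1 x : 1 <= F x.
Proof. by rewrite -expR0 ler_expR mulr_ge0// addr_ge0// l1norm_ge0. Qed.

(** Words of bounded length are encoded by tuples over [option 'I_d], read through [pmap id], to
    form a finite type. The nodes of [H] are fixed and need no index. *)
Let idx : finType := option ('I_k * 'I_d + (2 * (k + kstar)).-tuple (option 'I_d)).

Let prm H G (i : idx) : R := match i with
  | None => hell G H
  | Some (inl (a, j)) => node k G H a ord0 j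
  | Some (inr t) => ngap Sigma G H (wordv (pmap id t))
  end.

Let Mx : R := A + B + rad.

Let prm_bound H G : ballmix rad H -> admissible Sigma rad k G H ->
  forall i, `|prm H G i| <= Mx.
Proof.
move=> bH [bG Gk h0] [[[a j]|t]|] /=.
- apply: le_trans (coord_le_enorm _ _) _; apply: le_trans (node_bound k rad0 a bG bH) _.
  by rewrite /Mx lerDr addr_ge0// ltW.
- apply: le_trans (ngap_word_bound (k := k) (kstar := kstar) HA bG bH h0 _) _.
    by rewrite size_pmap (leq_trans (count_size _ _))// size_tuple.
  by rewrite /Mx -addrA lerDl addr_ge0.
- rewrite ger0_norm ?(ltW h0)//; apply: le_trans (HB bG bH) _.
  by rewrite /Mx addrAC lerDr addr_ge0// ltW.
Qed.

Let prm_close H G G' e : 0 <= e -> (forall i, `|prm H G i - prm H G' i| <= e) ->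
  close_params Sigma k kstar e G G' H.
Proof.
move=> e0 c; split; last exact: (c None).
- move=> a j; have [ak|ka] := ltnP a k.
    exact: (c (Some (inl (Ordinal ak, j)))).
  by rewrite /node ltnNge ka /= subrr normr0.
- move=> w wn.
  have sz : size (map Some w ++ nseq (2 * (k + kstar) - size w) None) == (2 * (k + kstar))%N.
    by rewrite size_cat size_map size_nseq subnKC.
  have := c (Some (inr (Tuple sz))); rewrite /prm /=.
  rewrite (_ : pmap id _ = w)// pmap_cat (_ : pmap id (nseq _ _) = [::]); last first.
    by elim: (_ - _)%N.
  by rewrite cats0; elim: {c wn sz} w => //= i w ->.
Qed.

(** There are of the order of [n ^+ (2 * #|idx|)] fine cells, and with [M = N] each one fails with
    probability of order [n ^- (2 * N)]; two powers of [n] remain. *)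
Let N := #|idx|.+1.

(** Independent of [n], and so small that the second moment of an increment, at most
    [delta ^+ 2 * K], meets the condition [N * v <= 2]. *)
Let delta : R := (N%:R * K)^-1.

Definition rate_cst : R :=
  K + (#|{ffun idx -> 'I_(cellnb Mx (delta ^+ 2))}|)%:R * expR (1 + K) +
  (2 * Mx + 1) ^+ #|idx| * expR (1 + N%:R * K).

Definition cover_size : nat := N.

Section sample.
Variable H : mixing R d.
Hypotheses (bH : ballmix rad H) (Hk : ncomp H = kstar).
Context dsp (T : measurableType dsp) (P : probability T R).
Variables (n : nat) (X : 'I_n -> {RV P >-> 'rV[R]_d}).
Hypothesis n0 : (0 < n)%N.
Hypothesis iidX : iid_with_density X (mixture_pdf Sigma H).
Hypothesis FK : expect Sigma H (fun x => F x ^+ 8) <= K.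

Hypothesis ln1 : 1 <= ln n%:R :> R.
Hypothesis lnn : ln n%:R <= n%:R :> R.
Hypothesis nN : 16 * cover_size%:R ^+ 4 * ln n%:R ^+ 2 <= n%:R :> R.
Hypothesis nK : K ^+ 2 <= n%:R.

Local Notation E := (expect Sigma H).
Local Notation adm G := (admissible Sigma rad k G H).
Local Notation hsc G := (hscore Sigma G H).
Local Notation s0 := (dev_scale n (R := R)).
Local Notation Tn := (trunc_set n F).

Let size_ge1 : 1 <= N%:R :> R. Proof. by rewrite ler1n. Qed.

Let sizeK_ge1 : 1 <= N%:R * K. Proof. by rewrite -[leLHS]mulr1 ler_pM. Qed.

Let delta0 : 0 < delta. Proof. by rewrite invr_gt0 (lt_le_trans ltr01). Qed.

Let delta1 : delta <= 1. Proof. by rewrite invf_le1// (lt_le_trans ltr01). Qed.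

Let mass1 : E (cst 1) = 1. Proof. exact: expect1 iidX. Qed.

(* [rep c] is an arbitrary admissible mixture of the cell [c]; it is [H] when the
   cell contains none. *)
Let rep e (c : {ffun idx -> 'I_(cellnb Mx e)}) : mixing R d :=
  if pselect (exists G, adm G /\ cell (prm H) Mx e G = c) is left ex
  then projT1 (cid ex) else H.

Let repP e G : adm G -> let G' := rep (cell (prm H) Mx e G) in
  adm G' /\ cell (prm H) Mx e G' = cell (prm H) Mx e G.
Proof.
move=> aG /=; rewrite /rep; case: pselect => [ex|[]]; last by exists G.
exact: (projT2 (cid ex)).
Qed.

Let rep_lip e G x : 0 < e <= 1 -> adm G ->
  `|hsc G x - hsc (rep (cell (prm H) Mx (e ^+ 2) G)) x| <= e * F x.
Proof.
move=> /andP[e0 e1] aG; have [aG' cG'] := @repP (e ^+ 2) _ aG.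
have e20 : 0 < e ^+ 2 by rewrite exprn_gt0.
have e01 : 0 <= e <= 1 by rewrite (ltW e0).
have cl : close_params Sigma k kstar (e ^+ 2) G (rep (cell (prm H) Mx (e ^+ 2) G)) H.
  apply: prm_close; first exact: ltW.
  by apply: (cell_close e20 _ _ (esym cG')) => i; exact: prm_bound.
apply: le_trans (hscore_lip rad0 A0 HA HB x aG aG' bH Hk e01 cl) _.
exact: (ler_wpM2l (ltW e0) (FC x)).
Qed.

Let eh G : adm G -> expgrowth (hsc G).
Proof. by move=> [bG _ h0]; exact: expgrowth_hscore rad0 bG bH. Qed.

Let hF G x : adm G -> `|hsc G x| <= F x.
Proof. by move=> aG; apply: le_trans (FA x); exact: (hscore_bound rad0 A0 HA x aG bH Hk). Qed.

(* Two-level chaining: the coarse cells, of width [delta ^+ 2], are finitely many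
   independently of [n], while across the fine cells, of width [n^-2], only the
   increments are tested, and their variance is small enough to beat the
   polynomial number of cells. *)
Let coarse c : (mu_ext P [set w | adm (rep c) /\ ((forall i, Tn (X i w)) /\
    6 * (n%:R * s0) <= \sum_i (hsc (@rep (delta ^+ 2) c) (X i w) - E (hsc (rep c))))%R]
  <= (expR (1 + K) / n%:R)%:E)%E.
Proof.
have [aG|naG] := pselect (adm (rep c)); last first.
  rewrite (_ : [set w | _] = set0); last by apply/seteqP; split => w // [].
  apply: (@le_trans _ _ 0%:E%E); first by rewrite mu_ext0.
  by rewrite lee_fin divr_ge0 ?expR_ge0.
have [bG _ h0] := aG.
apply: (@le_trans _ _ (mu_ext P [set w | (forall i, Tn (X i w)) /\
    (6 * (n%:R * s0) <= \sum_i (hsc (rep c) (X i w) - E (hsc (rep c))))%R])).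
  by apply: le_mu_ext => w [].
have n1 : 1 <= n%:R :> R by rewrite ler1n.
apply: (le_trans (truncated_bernstein (c := 1) (v := 2) (M := 1) Spd rad0 bH n0 iidX
  eF F1 FK ln1 lnn isT _ (eh aG) _ _ _ _)).
- apply: le_trans nN; rewrite ler_wpM2r ?sqr_ge0// ler_wpM2l//.
  by rewrite lerXn2r ?nnegrE// ler_nat.
- by rewrite ler01 lexx.
- by move=> x; rewrite mul1r; exact: hF.
- by rewrite (expect_hscore_sqr Spd rad0 bG bH h0).
- by rewrite mul1r.
rewrite lee_fin mul1r ler_wpM2l ?expR_ge0// lef_pV2 ?posrE ?exprn_gt0 ?ltr0n//.
by rewrite muln1 -[leLHS]expr1 ler_weXn2l.
Qed.

Let fine_rate : R := expR (1 + N%:R * K) / n%:R ^+ (2 * N).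

Let fine_level c : (mu_ext P [set w | adm (rep c) /\ ((forall i, Tn (X i w)) /\
    (6 * (n%:R * s0) <= \sum_i ((hsc (@rep (n%:R^-1 ^+ 2) c) (X i w) -
        hsc (rep (cell (prm H) Mx (delta ^+ 2) (rep c))) (X i w)) -
      E (fun x => hsc (rep c) x -
        hsc (rep (cell (prm H) Mx (delta ^+ 2) (rep c))) x)))%R)]
  <= fine_rate%:E)%E.
Proof.
have [aG|naG] := pselect (adm (rep c)); last first.
  rewrite (_ : [set w | _] = set0); last by apply/seteqP; split => w // [].
  apply: (@le_trans _ _ 0%:E%E); first by rewrite mu_ext0.
  by rewrite lee_fin divr_ge0 ?expR_ge0 ?exprn_ge0.
set G0 := rep (cell _ _ _ (rep c)).
have [aG0 _] : adm G0 /\ _ := @repP (delta ^+ 2) _ aG.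
have eY : expgrowth (fun x => hsc (rep c) x - hsc G0 x).
  by apply: expgrowthB; exact: eh.
have YF x : `|hsc (rep c) x - hsc G0 x| <= delta * F x.
  by apply: rep_lip => //; rewrite delta0.
apply: (@le_trans _ _ (mu_ext P [set w | (forall i, Tn (X i w)) /\
    (6 * (n%:R * s0) <= \sum_i (hsc (rep c) (X i w) - hsc G0 (X i w) -
      E (fun x => hsc (rep c) x - hsc G0 x)))%R])).
  by apply: le_mu_ext => w [].
apply: (truncated_bernstein (c := delta) (v := delta ^+ 2 * K) Spd rad0 bH n0 iidX
  eF F1 FK ln1 lnn _ nN eY) => //.
- by rewrite (ltW delta0).
- have eX2 : expgrowth (fun x => F x ^+ 2).
    by have := expgrowthM eF eF; congr expgrowth; apply/funext => x; rewrite expr2.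
  apply: (@le_trans _ _ (E (fun x => delta ^+ 2 * F x ^+ 2))).
    apply: (expect_le Spd rad0 bH).
    - by have := expgrowthM eY eY; congr expgrowth; apply/funext => x; rewrite expr2.
    - exact: expgrowthZ.
    move=> x; rewrite -exprMn -(real_normK (num_real (_ - _))).
    by apply: lerXn2r (YF x); rewrite ?nnegrE// mulr_ge0 ?(ltW delta0)// expR_ge0.
  rewrite expectZ// ler_wpM2l ?sqr_ge0//.
  exact: (expect_envX_le Spd rad0 bH eF F1 FK).
- have K0 : 0 < K by exact: lt_le_trans K1.
  rewrite /delta (_ : _ * _ = (N%:R * K)^-1); last by field; rewrite !gt_eqF.
  by apply: le_trans delta1 _; rewrite ler1n.
Qed.

Let bad : set T := [set w | exists G, [/\ ballmix rad G, (ncomp G <= k)%N,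
  18 * s0 < hell G H &
  0 <= \sum_i ln (mratio Sigma G (X i w) / mratio Sigma H (X i w))]].

(** The inequality [ln y / 2 <= sqrt y - 1] passes from the likelihood ratio to the scores. As these
    have mean [- hell G H], centring adds [n * hell G H] to their sum. *)
Let score_sum_ge G w : adm G -> 18 * s0 < hell G H ->
  0 <= \sum_i ln (mratio Sigma G (X i w) / mratio Sigma H (X i w)) ->
  18 * (n%:R * s0) <= \sum_i (hsc G (X i w) - E (hsc G)).
Proof.
move=> [bG _ h0] hs lg; have nR : 0 < n%:R :> R by rewrite ltr0n.
rewrite (expect_hscore Spd rad0 bG bH mass1 h0).
under eq_bigr do rewrite opprK.
rewrite big_split /= sumr_const card_ord -[X in _ + X]mulr_natl mulrCA.
apply: ler_wpDl; last by rewrite ler_wpM2l// ?ltW.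
rewrite -mulr_suml divr_ge0 ?(ltW h0)//.
apply: le_trans (_ : 2^-1 *
  (\sum_i ln (mratio Sigma G (X i w) / mratio Sigma H (X i w))) <= _).
  by rewrite mulr_ge0.
rewrite mulr_sumr; apply: ler_sum => i _.
have r0 := mratio_gt0 Sigma (X i w) rad0 bG.
have q0 := mratio_gt0 Sigma (X i w) rad0 bH.
set y := _ / _; have y0 : 0 < y by rewrite divr_gt0.
have s0' : 0 < Num.sqrt y by rewrite sqrtr_gt0.
rewrite -{1}(sqr_sqrtr (ltW y0)) lnXn// -[ln _ *+ _]mulr_natl mulrA mulVf// mul1r.
by rewrite lerBrDl; have := expR_ge1Dx (ln (Num.sqrt y)); rewrite lnK.
Qed.

(** The score of [G] is split through a fine representative [G1] and the coarse representative [G0]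
    of [G1]. Taking [G0] from [G1] rather than from [G] lets the fine cells alone index the
    increments. *)
Let bad_cover : bad `<=`
  [set w | exists i, ~ Tn (X i w)] `|`
  ([set w | exists c, adm (rep c) /\ ((forall i, Tn (X i w)) /\
    6 * (n%:R * s0) <= \sum_i (hsc (@rep (delta ^+ 2) c) (X i w) - E (hsc (rep c))))%R] `|`
  [set w | exists c, adm (rep c) /\ ((forall i, Tn (X i w)) /\
    (6 * (n%:R * s0) <= \sum_i ((hsc (@rep (n%:R^-1 ^+ 2) c) (X i w) -
        hsc (rep (cell (prm H) Mx (delta ^+ 2) (rep c))) (X i w)) -
      E (fun x => hsc (rep c) x -
        hsc (rep (cell (prm H) Mx (delta ^+ 2) (rep c))) x)))%R)]).
Proof.
move=> w [G [bG Gk hG lG]].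
have nR : 0 < n%:R :> R by rewrite ltr0n.
have s00 : 0 < s0 by exact: dev_scale_gt0.
have h0 : 0 < hell G H by apply: le_lt_trans hG; rewrite mulr_ge0// ltW.
have aG : adm G by [].
have [Tw|nTw] := pselect (forall i, Tn (X i w)); last first.
  by left; apply/existsNP.
right.
pose G1 := rep (cell (prm H) Mx (n%:R^-1 ^+ 2) G).
have [aG1 _] : adm G1 /\ _ := @repP (n%:R^-1 ^+ 2) _ aG.
pose G0 := rep (cell (prm H) Mx (delta ^+ 2) G1).
have [aG0 _] : adm G0 /\ _ := @repP (delta ^+ 2) _ aG1.
have [l0|/negP l0] :=
  pselect (is_true (6 * (n%:R * s0) <= \sum_i (hsc G0 (X i w) - E (hsc G0)))).
  by left; exists (cell (prm H) Mx (delta ^+ 2) G1).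
have eG := eh aG; have eG1 := eh aG1; have eG0 := eh aG0.
rewrite -ltNge in l0.
right; exists (cell (prm H) Mx (n%:R^-1 ^+ 2) G).
split; first exact: aG1.
split; first exact: Tw.
rewrite -/G1 -/G0.
have EB g h : expgrowth g -> expgrowth h -> E (fun x => g x - h x) = E g - E h.
  move=> eg eh'; rewrite -[- E h]mulN1r -expectZ// -expectD//; last exact: expgrowthZ.
  by congr (E _); apply/funext => x; rewrite mulN1r.
rewrite (EB _ _ eG1 eG0).
(* No probability enters here: at width [n^-2] the scores differ by at most [F / n]. On [Tn] the
   envelope is at most [sqrt n], as is [K] by [nK], so the sum is at most [2 * sqrt n]. *)
have small : \sum_i (hsc G (X i w) - hsc G1 (X i w) - (E (hsc G) - E (hsc G1)))
    <= 6 * (n%:R * s0).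
  rewrite -(EB _ _ eG eG1).
  have n1 : 0 < (n%:R^-1 : R) <= 1 by rewrite invr_gt0 nR invf_le1// ler1n.
  have vF x : `|hsc G x - hsc G1 x| <= n%:R^-1 * F x by exact: rep_lip.
  have EF : E F <= K.
    have := @expect_envX_le _ _ _ Spd _ _ rad0 bH _ _ eF F1 FK 1 isT.
    by congr (_ <= _); congr (E _); apply/funext => x; rewrite expr1.
  have E1 : `|E (fun x => hsc G x - hsc G1 x)| <= n%:R^-1 * K.
    have eD : expgrowth (fun x => hsc G x - hsc G1 x) by exact: expgrowthB.
    apply: (@le_trans _ _ (E (fun x => n%:R^-1 * F x))); last first.
      by rewrite expectZ// ler_wpM2l// ltW//; have /andP[] := n1.
    apply/ler_normlP; split.
      rewrite -[leLHS]mulN1r -expectZ//.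
      apply: (expect_le Spd rad0 bH); [exact: expgrowthZ|exact: expgrowthZ|].
      by move=> x; rewrite mulN1r; apply: le_trans (vF x); rewrite -normrN ler_norm.
    apply: (expect_le Spd rad0 bH) => //; first exact: expgrowthZ.
    by move=> x; apply: le_trans (vF x); rewrite ler_norm.
  pose q := Num.sqrt (n%:R : R).
  have q0 : 0 < q by rewrite sqrtr_gt0.
  have q2 : q ^+ 2 = n%:R by rewrite sqr_sqrtr// ltW.
  have Kq : K <= q.
    rewrite -(@ler_pXn2r _ 2)// ?nnegrE ?(ltW q0)//; first by rewrite q2.
    exact: le_trans K1.
  have term i : hsc G (X i w) - hsc G1 (X i w) - E (fun x => hsc G x - hsc G1 x)
      <= n%:R^-1 * (2 * q).
    have Fq : F (X i w) <= q.
      have := Tw i; rewrite /trunc_set /= -q2 (_ : 4%N = (2 * 2)%N)// exprM => h.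
      have F2 : F (X i w) ^+ 2 <= q.
        by rewrite -(@ler_pXn2r _ 2)// ?nnegrE ?sqr_ge0// ltW.
      apply: le_trans F2; rewrite expr2 ler_peMr//; first exact: expR_ge0.
    apply: le_trans (ler_norm _) _; apply: le_trans (ler_normB _ _) _.
    apply: le_trans (lerD (vF _) E1) _; rewrite -mulrDr ler_wpM2l ?invr_ge0//.
    by rewrite mulr_natl mulr2n lerD.
  apply: le_trans (ler_sum _ (fun i _ => term i)) _.
  rewrite sumr_const card_ord -[leLHS]mulr_natl mulVKf ?gt_eqF//.
  have -> : n%:R * s0 = q * Num.sqrt (ln n%:R).
    by rewrite -{1}q2 /dev_scale -/q; field; rewrite gt_eqF.
  have sl : 1 <= Num.sqrt (ln n%:R : R) by rewrite -[leLHS]sqrtr1 ler_wsqrtr.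
  have : q <= q * Num.sqrt (ln n%:R) by rewrite ler_peMr// ltW.
  move: (q * _) => z; have := q0; lra.
have tot := score_sum_ge aG hG lG.
have split3 := sum_telescope3 (fun i => hsc G (X i w)) (fun i => hsc G1 (X i w))
  (fun i => hsc G0 (X i w)) (E (hsc G)) (E (hsc G1)) (E (hsc G0)).
rewrite split3 in tot; exact: three_parts tot small l0.
Qed.

Lemma sample_density_rate : (mu_ext P bad <= (rate_cst / n%:R)%:E)%E.
Proof.
rewrite /rate_cst.
have nR : 0 < n%:R :> R by rewrite ltr0n.
have Mx0 : 0 <= Mx by rewrite /Mx !addr_ge0// ltW.
apply: le_trans (le_mu_ext P bad_cover) _.
apply: le_trans (outer_measureU2 _ _ _) _.
set a := _ * expR (1 + K); set a' := _ * expR (1 + N%:R * K).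
have -> : (K + a + a') / n%:R = K / n%:R + (a / n%:R + a' / n%:R).
  by rewrite -addrA [LHS]mulrDl [X in _ + X]mulrDl.
rewrite EFinD; apply: leeD.
  exact: (trunc_prob Spd rad0 bH n0 iidX eF F1 FK).
apply: le_trans (outer_measureU2 _ _ _) _.
rewrite EFinD; apply: leeD.
  apply: le_trans (mu_ext_finite_cover (b := fun=> expR (1 + K) / n%:R) _ coarse) _.
    by move=> w [c hc]; exists c.
  by rewrite sumr_const lee_fin -[leLHS]mulr_natl mulrA.
apply: le_trans (mu_ext_finite_cover (b := fun=> fine_rate) _ fine_level) _.
  by move=> w [c hc]; exists c.
rewrite sumr_const lee_fin -[leLHS]mulr_natl /fine_rate.
have e0 : 0 < n%:R^-1 ^+ 2 :> R by rewrite exprn_gt0// invr_gt0.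
have e1 : n%:R^-1 ^+ 2 <= 1 :> R by rewrite expr_le1 ?invr_ge0// invf_le1// ler1n.
have C := @card_cells_le R idx Mx _ e0 Mx0 e1.
apply: le_trans (ler_wpM2r _ C) _; first by rewrite divr_ge0 ?expR_ge0 ?exprn_ge0.
(* As [2 * N = 2 + 2 * #|idx|], the number of cells leaves a factor [n ^- 2], which is at most
   [n ^- 1]. *)
rewrite exprVn invrK exprMn -exprM [(2 * N)%N]mulnS exprD mulrC /a'.
have n1 : 1 <= n%:R :> R by rewrite ler1n.
have : 0 <= (2 * Mx + 1) ^+ #|idx| by rewrite exprn_ge0// addr_ge0// mulr_ge0.
have np : 0 < n%:R ^+ (2 * #|idx|) :> R by rewrite exprn_gt0.
move: (_ ^+ #|idx|) (n%:R ^+ (2 * #|idx|)) np (expR_gt0 (1 + N%:R * K)).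
move=> u v v0; move: (expR _) => w w0 u0.
rewrite (_ : _ * (u * v) = u * w / n%:R ^+ 2); last by field; rewrite !gt_eqF.
rewrite ler_wpM2l ?mulr_ge0 ?(ltW w0)// lef_pV2 ?posrE ?exprn_gt0//.
by rewrite -[leLHS]expr1 ler_weXn2l.
Qed.

End sample.
End density_rate.

(** * The density estimation rate *)

Section rate_constants.
Context {R : realType} {d : nat}.
Variable Sigma : 'M[R]_d.
Hypothesis Spd : symposdef Sigma.
Implicit Types (G H : mixing R d).

Local Notation hell G H :=
  (hellinger (mixture_pdf Sigma G) (mixture_pdf Sigma H)).

(** Through the fourth root [y] of [n]: [ln n = 4 * ln y <= 4 * y], hence
    [ln n ^+ 2 <= 16 * sqrt n]. *)
Lemma ln_threshold (N : nat) (K : R) : exists n0 : nat, forall n, (n0 <= n)%N ->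
  [/\ 1 <= ln n%:R :> R, ln n%:R <= n%:R :> R,
      16 * N%:R ^+ 4 * ln n%:R ^+ 2 <= n%:R :> R & K ^+ 2 <= n%:R].
Proof.
pose z := expR 1 + K ^+ 2 + (256 * N%:R ^+ 4) ^+ 2 : R.
have e1 : 0 < expR 1 :> R by exact: expR_gt0.
have K2 : 0 <= K ^+ 2 by exact: sqr_ge0.
have N2 : 0 <= (256 * N%:R ^+ 4) ^+ 2 :> R by exact: sqr_ge0.
exists (Num.truncn z).+1 => n zn.
have {}zn : z <= n%:R by rewrite ltW// (lt_le_trans (truncnS_gt z))// ler_nat.
have n1 : expR 1 <= n%:R :> R by apply: le_trans zn; rewrite /z; lra.
have n0 : 0 < n%:R :> R by exact: lt_le_trans n1.
have ln1 : 1 <= ln n%:R :> R by rewrite -[leLHS]expRK ler_ln// posrE.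
split => //.
- by have := expR_ge1Dx (ln (n%:R : R)); rewrite lnK ?posrE//; lra.
- pose q := Num.sqrt (n%:R : R); pose y := Num.sqrt q.
  have q0 : 0 < q by rewrite sqrtr_gt0.
  have y0 : 0 < y by rewrite sqrtr_gt0.
  have q2 : q ^+ 2 = n%:R by rewrite sqr_sqrtr// ltW.
  have y2 : y ^+ 2 = q by rewrite sqr_sqrtr// ltW.
  have lny : ln n%:R = 4 * ln y :> R.
    by rewrite -q2 -y2 -exprM lnXn// -[LHS]mulr_natl.
  have ly : ln y <= y by have := expR_ge1Dx (ln y); rewrite lnK ?posrE//; lra.
  have l2 : ln n%:R ^+ 2 <= 16 * q.
    rewrite -y2 lny exprMn (_ : 4 ^+ 2 = 16 :> R); last by rewrite -natrX.
    rewrite ler_wpM2l// lerXn2r ?nnegrE ?(ltW y0)//.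
    by have := ln1; rewrite lny; lra.
  have Nq : 256 * N%:R ^+ 4 <= q.
    rewrite -(@ler_pXn2r _ 2)// ?nnegrE ?(ltW q0)// q2.
    by apply: le_trans zn; rewrite /z; lra.
  apply: (@le_trans _ _ (16 * N%:R ^+ 4 * (16 * q))).
    by rewrite ler_wpM2l// mulr_ge0// exprn_ge0.
  rewrite (_ : _ * (16 * q) = 256 * N%:R ^+ 4 * q); last by ring.
  by rewrite -q2 expr2 ler_wpM2r// ltW.
- by apply: le_trans zn; rewrite /z; lra.
Qed.

(** Any bound uniform over the ball serves, so the normalization of the Gaussian is again
    avoided. *)
Lemma hellinger_bounded (rad : R) : 0 <= rad -> exists2 B : R, 0 <= B &
  forall G H, ballmix rad G -> ballmix rad H -> hell G H <= B.
Proof.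
move=> r0; have [K K0 HK] := gint_expR_mratio Spd r0 (lexx 0).
exists (1 + 2 * K); first by rewrite addr_ge0// mulr_ge0// ltW.
move=> G H bG bH.
have KG L : ballmix rad L -> gint Sigma (mratio Sigma L) <= K.
  move=> bL; apply: le_trans (HK L bL); apply: eq_ler; congr gint.
  by apply/funext => x; rewrite mul0r expR0 mul1r.
have eG := expgrowth_mratio Sigma G; have eH := expgrowth_mratio Sigma H.
have h2 : hell G H ^+ 2 <= 2 * K.
  rewrite (hellinger_sqr Spd r0 bG bH).
  apply: (@le_trans _ _ (gint Sigma (hgap Sigma G H))).
    rewrite ler_piMl ?invf_le1 ?ler1n//; apply: gint_ge0 => // x; exact: sqr_ge0.
  apply: (@le_trans _ _ (gint Sigma (fun x => mratio Sigma G x + mratio Sigma H x))).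
    apply: gint_le => //; [exact: expgrowth_hgap|exact: expgrowthD|].
    move=> x; rewrite /hgap sqrrB !sqr_sqrtr ?(ltW (mratio_gt0 _ _ r0 _))//.
    by rewrite lerD2r gerBl mulrn_wge0// mulr_ge0 ?sqrtr_ge0.
  by rewrite gintD// mulr_natl mulr2n lerD// KG.
have h0 : 0 <= hell G H by exact: sqrtr_ge0.
by move: (hell G H) h0 h2 => h h0 h2; have := sqr_ge0 (h - 1); lra.
Qed.

Lemma mle_density_rate (rad : R) (k kstar : nat) : 0 <= rad ->
  exists2 C : R, 0 < C & forall H, ballmix rad H -> ncomp H = kstar ->
  forall dsp (T : measurableType dsp) (P : probability T R) (n : nat)
    (X : 'I_n -> {RV P >-> 'rV[R]_d}), (0 < n)%N ->
  iid_with_density X (mixture_pdf Sigma H) ->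
  (mu_ext P [set w | exists G, [/\ ballmix rad G, (ncomp G <= k)%N,
      (18 * dev_scale n < hell G H)%R &
      (0 <= \sum_i ln (mratio Sigma G (X i w) / mratio Sigma H (X i w)))%R]]
    <= (C / n%:R)%:E)%E.
Proof.
move=> r0.
have [A A0 HA'] := moment_gap_le Spd (2 * (k + kstar)) r0.
have HA G H (bG : ballmix rad G) (bH : ballmix rad H) := HA' G H bG bH.
have [B B0 HB] := hellinger_bounded r0.
pose g := growthc Sigma rad.
have g0 : 0 <= g by rewrite /g /growthc addr_ge0// mulr_ge0// llrc_ge0.
have lip0 : 0 <= lipc k kstar A by rewrite /lipc addr_ge0// mulr_ge0// ltW.
have env0 : 0 <= envc k kstar A B.
  rewrite /envc addr_ge0// mulr_ge0 ?(ltW A0)// addr_ge0 ?mulr_ge0//.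
  by rewrite addr_ge0// ltW.
(* Since [c <= expR (c * (1 + l1norm x))], multiplicative constants move into the exponent, and one
   exponential dominates both the scores and their modulus. *)
pose b := A + envc k kstar A B + 7 * g.
have b0 : 0 <= b by rewrite /b addr_ge0 ?mulr_ge0// addr_ge0// ltW.
have L1 (x : 'rV[R]_d) : 1 <= 1 + l1norm x by rewrite lerDl l1norm_ge0.
have dom (c m : R) (x : 'rV[R]_d) : 0 <= c -> 0 <= m -> c + m * g <= b ->
    c * expR (m * (g * (1 + l1norm x))) <= expR (b * (1 + l1norm x)).
  move=> c0 m0 cm; apply: (@le_trans _ _ (expR (c * (1 + l1norm x)) *
      expR (m * (g * (1 + l1norm x))))).
    rewrite ler_wpM2r ?expR_ge0//; apply: (@le_trans _ _ (expR c)).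
      by apply: le_trans (expR_ge1Dx _); rewrite lerDr.
    by rewrite ler_expR; apply: (ler_peMr c0 (L1 x)).
  rewrite -expRD ler_expR mulrA -mulrDl ler_wpM2r//.
  exact: le_trans ler01 (L1 x).
have FA (x : 'rV[R]_d) :
    A * expR (3 * (g * (1 + l1norm x))) <= expR (b * (1 + l1norm x)).
  by apply: dom; rewrite ?(ltW A0)// /b; lra.
have FC (x : 'rV[R]_d) : envc k kstar A B * expR (7 * (g * (1 + l1norm x))) <=
    expR (b * (1 + l1norm x)).
  by apply: dom => //; rewrite /b; have := ltW A0; lra.
have [K' K'0 HK'] := gint_expR_mratio Spd r0 (mulr_ge0 (ler0n R 8) b0).
pose K := 1 + expR (8 * b) * K'.
have K1 : 1 <= K by rewrite lerDl mulr_ge0 ?expR_ge0// ltW.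
have FK H : ballmix rad H ->
    expect Sigma H (fun x => expR (b * (1 + l1norm x)) ^+ 8) <= K.
  move=> bH; apply: (@le_trans _ _ (expR (8 * b) * K')); last by rewrite lerDr.
  apply: le_trans (ler_wpM2l (expR_ge0 _) (HK' H bH)).
  rewrite -gintZ//; last first.
    apply: expgrowthM; last exact: expgrowth_mratio.
    by apply: expgrowth_expR; rewrite mulr_ge0.
  apply: eq_ler; congr gint; apply/funext => x; rewrite mulrA -expRD -expRM_natl.
  by congr (expR _ * _); ring.
pose N := cover_size (d := d) k kstar.
have [n0 Hn0] := ln_threshold N K.
pose C := rate_cst (d := d) rad k kstar A B K.
have C0 : 0 <= C.
  have M0 : 0 <= 2 * (A + B + rad) + 1.
    by rewrite addr_ge0// mulr_ge0// !addr_ge0// ltW.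
  apply: addr_ge0; last exact: mulr_ge0 (exprn_ge0 _ M0) (expR_ge0 _).
  apply: addr_ge0; first exact: le_trans ler01 K1.
  exact: mulr_ge0 (ler0n _ _) (expR_ge0 _).
(* The summand [n0] makes the bound at least 1 when [n < n0], where the deviation inequalities do
   not apply. *)
exists (1 + n0%:R + C); first by rewrite -addrA ltr_pwDl// addr_ge0.
move=> H bH Hk dsp T P n X npos iid.
have nR : 0 < n%:R :> R by rewrite ltr0n.
have [nn0|n0n] := ltnP n n0.
  apply: le_trans (mu_ext_le1 _ _) _; rewrite lee_fin ler_pdivlMr// mul1r.
  have : n%:R <= n0%:R :> R by rewrite ler_nat ltnW.
  by move: C0; lra.
have [ln1 lnn nN nK] := Hn0 n n0n.
apply: le_trans (sample_density_rate Spd r0 A0 HA HB B0 b0 FA FC K1 bH Hk npos iid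
  (FK H bH) ln1 lnn nN nK) _.
rewrite lee_fin ler_wpM2r ?invr_ge0 ?(ltW nR)// -/C lerDr addr_ge0//.
Qed.

End rate_constants.

(** * From the two estimates to the theorem *)

Section theorem4_proof.
Context {R : realType} {d : nat}.
Implicit Types (G H : mixing R d) (Theta : set 'rV[R]_d).

Lemma mixing_le_ballmix (rad : R) k Theta G :
  (forall t, Theta t -> enorm t <= rad) -> mixing_le k Theta G -> ballmix rad G.
Proof. by move=> Tr [_ GT w1 ws]; split => // i; [have /andP[] := w1 i|exact/Tr/GT]. Qed.

Lemma true_mixing_le k kstar Theta H : (0 < kstar)%N -> (kstar <= k)%N ->
  true_mixing kstar Theta H -> mixing_le k Theta H.
Proof.
move=> k0 kk [Hk HT w0 ws _]; split => //; first by rewrite Hk k0.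
move=> j; rewrite ltW//= -ws (bigD1 j)//= lerDl.
by apply: sumr_ge0 => i _; exact: ltW.
Qed.

End theorem4_proof.

Theorem theorem4 (R : realType) (d : nat) (Sigma : 'M[R]_d) (kstar : nat) :
  (0 < d)%N -> symposdef Sigma -> (2 <= kstar)%N ->
  exists (Cglobal : R -> R -> R) (Cdensity cdensity : set 'rV[R]_d -> R),
  forall (rad C0 : R) (Theta : set 'rV[R]_d),
    0 < rad -> 1 <= C0 ->
    compact Theta -> (forall theta, Theta theta -> enorm theta <= rad) ->
  [/\ 0 < Cglobal rad C0, 0 < Cdensity Theta, 0 < cdensity Theta
    & forall k : nat, (kstar < k)%N ->
      (forall Gs G : mixing R d,
         true_mixing kstar Theta Gs -> one_cluster C0 Gs ->
         mixing_le k Theta G ->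
         Cglobal rad C0 * sep Gs ^+ (2 * kstar - 2) * W2 G Gs ^+ 2
           <= hellinger (mixture_pdf Sigma G) (mixture_pdf Sigma Gs)) /\
      (exists2 K : R, 0 < K &
         forall Gs : mixing R d, true_mixing kstar Theta Gs ->
         forall (dsp : measure_display) (T : measurableType dsp)
           (P : probability T R) (n : nat)
           (X : 'I_n -> {RV P >-> 'rV[R]_d}) (Ghat : T -> mixing R d),
         (0 < n)%N ->
         iid_with_density X (mixture_pdf Sigma Gs) ->
         (forall w, is_mle Sigma k Theta (fun i => X i w) (Ghat w)) ->
         (mu_ext P [set w | (Cdensity Theta * Num.sqrt (d%:R * ln n%:R / n%:R)
               < hellinger (mixture_pdf Sigma (Ghat w)) (mixture_pdf Sigma Gs))%R]
            <= (K * n%:R `^ (- cdensity Theta))%:E)%E /\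
         (one_cluster C0 Gs ->
          (mu_ext P [set w | (Num.sqrt (Cdensity Theta / Cglobal rad C0) *
                (d%:R * ln n%:R / n%:R) `^ (4^-1) * sep Gs ^- (kstar - 1)
                < W2 (Ghat w) Gs)%R]
             <= (K * expR (- cdensity Theta * ln n%:R))%:E)%E))].
Proof.
move=> d0 Spd k2.
(* The constant must become a function of [rad] and [C0]. [choice] asks for a value at every pair,
   and pairs with a negative entry receive 1. *)
have lower (rc : R * R) : exists C : R, 0 <= rc.1 -> 0 <= rc.2 -> 0 < C /\
    forall G H, ballmix rc.1 G -> ballmix rc.1 H -> ncomp H = kstar -> 0 < sep H ->
      one_cluster rc.2 H -> C * sep H ^+ (2 * kstar - 2) * W2 G H ^+ 2 <=
        hellinger (mixture_pdf Sigma G) (mixture_pdf Sigma H).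
  have [[r0 c0]|n0] := pselect (0 <= rc.1 /\ 0 <= rc.2); last first.
    by exists 1 => r0 c0; case: n0.
  by have [C C0 HC] := hellinger_W2_lower_bound Spd r0 c0 k2; exists C.
have [Cg HCg] := choice lower.
(* Both 18 and the exponent 1 come from [mle_density_rate]; the dependence on [rad] and [k] sits in
   [K]. *)
exists (fun rad C0 => Cg (rad, C0)), (fun=> 18), (fun=> 1) => rad C0 Theta r0 C01 _ Tr.
have C00 : 0 <= C0 by exact: le_trans C01.
have [Cg0 Hlow] := HCg (rad, C0) (ltW r0) C00; rewrite /= in Cg0 Hlow.
split => // k kk.
have low Gs G : true_mixing kstar Theta Gs -> one_cluster C0 Gs ->
    mixing_le k Theta G -> Cg (rad, C0) * sep Gs ^+ (2 * kstar - 2) * W2 G Gs ^+ 2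
      <= hellinger (mixture_pdf Sigma G) (mixture_pdf Sigma Gs).
  move=> tGs cl Gk; have [Hk _ _ _ s0] := tGs; apply: Hlow => //.
  - exact: mixing_le_ballmix Tr Gk.
  - apply: mixing_le_ballmix Tr (true_mixing_le _ (ltnW kk) tGs).
    exact: ltn_trans k2.
split => //.
have [K K0 HK] := mle_density_rate Spd k kstar (ltW r0).
exists K => // Gs tGs dsp T P n X Ghat n0 iid mle.
have nR : 0 < n%:R :> R by rewrite ltr0n.
have Gsk : mixing_le k Theta Gs.
  by apply: true_mixing_le (ltnW kk) tGs; exact: ltn_trans k2.
have bGs := mixing_le_ballmix Tr Gsk.
have [Hk _ _ _ s0] := tGs.
have ln0 : 0 <= ln n%:R :> R by rewrite ln_ge0// ler1n.
pose t : R := d%:R * ln n%:R / n%:R.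
have t0 : 0 <= t by rewrite /t divr_ge0 ?mulr_ge0.
have rate : (mu_ext P [set w | (18 * Num.sqrt t
      < hellinger (mixture_pdf Sigma (Ghat w)) (mixture_pdf Sigma Gs))%R]
    <= (K / n%:R)%:E)%E.
  apply: le_trans (HK Gs bGs Hk dsp T P n X n0 iid).
  apply: le_mu_ext => w /= hw; have [Gk Gmax] := mle w.
  have bG := mixing_le_ballmix Tr Gk; have [/andP[_ nk] _ _ _] := Gk.
  exists (Ghat w); split => //.
    (* As [d] is at least 1, the level [18 * dev_scale n] is below the one in the statement. *)
    apply: le_lt_trans hw; rewrite ler_wpM2l// /dev_scale -sqrtrV ?ler0n//.
    rewrite -sqrtrM// ler_wsqrtr// /t ler_wpM2r ?invr_ge0//.
    by rewrite ler_peMl// ler1n.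
  (* The true measure competes in the maximization because [kstar < k]; the reference density then
     cancels in the log-likelihood difference. *)
  have := Gmax Gs Gsk; rewrite /loglik ler_pM2l ?invr_gt0// -subr_ge0 -sumrB.
  move=> /le_trans; apply; apply: ler_sum => i _.
  have g0 := mratio_gt0 Sigma (X i w) (ltW r0) bG.
  have h0 := mratio_gt0 Sigma (X i w) (ltW r0) bGs.
  have f0 := gauss_pdf_gt0 Spd 0 (X i w).
  rewrite !(mixture_pdfE Spd) ln_div ?posrE//.
  rewrite (lnM (x := mratio _ _ _)) ?posrE// (lnM (x := mratio _ Gs _)) ?posrE//.
  by rewrite opprD addrACA subrr addr0.
have pE : n%:R `^ (-1) = (n%:R)^-1 :> R by rewrite powR_inv1// ltW.
have eE : expR (- 1 * ln n%:R) = (n%:R)^-1 :> R by rewrite mulN1r expRN lnK// posrE.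
split; first by rewrite pE.
move=> cl; rewrite eE; apply: le_trans rate; apply: le_mu_ext => w /= hw.
have [Gk _] := mle w.
apply: lt_le_trans (low Gs (Ghat w) tGs cl Gk).
set s := sep Gs in s0 hw *; set c := Cg _ in Cg0 hw *.
have kE : (2 * kstar - 2)%N = (2 * (kstar - 1))%N.
  by rewrite mulnBr muln1.
have s1 : 0 < s ^+ (kstar - 1) by rewrite exprn_gt0.
have q0 : 0 <= t `^ 4^-1 by exact: powR_ge0.
have qE : (t `^ 4^-1) ^+ 2 = Num.sqrt t.
  rewrite -powR12_sqrt// -powR_mulrn// -powRrM; congr (_ `^ _).
  by field.
have l0 : 0 <= Num.sqrt (18 / c) * t `^ 4^-1 / s ^+ (kstar - 1).
  by rewrite divr_ge0 ?(ltW s1)// mulr_ge0// sqrtr_ge0.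
(* Squaring turns the fourth root into [Num.sqrt t] and the exponent [kstar - 1] into that of the
   lower bound. *)
have : (Num.sqrt (18 / c) * t `^ 4^-1 / s ^+ (kstar - 1)) ^+ 2 < W2 (Ghat w) Gs ^+ 2.
  by rewrite ltr_pXn2r// ?nnegrE// (le_trans l0)// ltW.
rewrite expr_div_n exprMn qE sqr_sqrtr; last by rewrite divr_ge0// ltW.
rewrite ltr_pdivrMr ?exprn_gt0// => h.
have -> : 18 * Num.sqrt t = c * (18 / c * Num.sqrt t).
  by rewrite mulrA mulrCA divff ?gt_eqF// mulr1.
by rewrite kE mulnC exprM -(mulrA c (_ ^+ _)) (ltr_pM2l Cg0) [ltRHS]mulrC.
Qed.
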